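(* Let $L_1,L_2,L_3>0$ and let $\Omega=(0,L_1)\times(0,L_2)\times\left(\frac{2L_3}{2\pi}\mathbb{S}^1\right)$. The set of eigenfunctions $$\begin{aligned}\widetilde{\mathcal C}:=\;&\{Y^{j(n),n}\mid n\in\mathbb N^3,\ \#_0(n)\le 1,\ n_i\le 3,\ j(n)\in\{1,2-\#_0(n)\}\}\\ &\cup\{Z^{j(n),n}\mid n\in\mathbb N^3,\ \#_0(n)\le 1,\ n_i\le 4,\ j(n)\in\{1,2-\#_0(n)\}\}\\ &\cup\{Z^{1,n}\mid n\in\mathbb N^3,\ \#_0(n)=2,\ n_3=0,\ n_i\le 4\}\ \cup\ \{Z^{(0,0,0)}\}\end{aligned}$$ is $(\mathtt L,\mathrm D(A))$-saturating.
   Context: $\mathbb N=\{0,1,2,\dots\}$. Functions on $\Omega$ are identified with functions on $(0,L_1)\times(0,L_2)\times\mathbb R$ that are $2L_3$-periodic in $x_3$; $\mathbf n$ is the outward unit normal to $\partial\Omega$ (the lateral boundary $x_1\in\{0,L_1\}$ or $x_2\in\{0,L_2\}$). Spaces: $H=\{u\in L^2(\Omega,\mathbb R^3)\mid \operatorname{div}u=0,\ (u\cdot\mathbf n)|_{\partial\Omega}=0\}$ with the $L^2$ norm; $\mathrm D(A)=\{u\in H^2(\Omega,\mathbb R^3)\mid u\in H,\ (\operatorname{curl}u-(\mathbf n\cdot\operatorname{curl}u)\mathbf n)|_{\partial\Omega}=0\}$ (domain of the Stokes operator $A$ under Lions boundary conditions). $\Pi$ is the orthogonal projection of $L^2(\Omega,\mathbb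 R^3)$ onto $H$. For $u,v\in \mathrm D(A)$, $B(u,v)=\Pi((u\cdot\nabla)v)$, and $\mathcal B(a,b)=B(a,b)+B(b,a)$. Saturating sets: let $U=\mathrm D(A)$ and let $\mathcal C\subset U$ be a finite set. For a finite-dimensional space $E$ with $\mathcal C\subset E\subset U$, put $\mathcal F_{\mathtt L}(E)=E+\big(\operatorname{span}\{\mathcal B(a,b)\mid a\in\mathcal C,\ b\in E,\ (B(a,a),B(b,b))\in H\times H\}\cap U\big)$. Set $\mathcal G^0=\operatorname{span}\mathcal C$ and $\mathcal G^{j+1}=\mathcal F_{\mathtt L}(\mathcal G^j)$. The set $\mathcal C$ is called $(\mathtt L,\mathrm D(A))$-saturating if $\bigcup_{j\in\mathbb N}\mathcal G^j$ is dense in $H$. Eigenfunctions: for $k\in\mathbb N^3$, $\#_0(k)$ is the number of zero components of $k$. For $k\neq 0$, $\{k\}_0^{\perp_{[L]}}=\{z\in\mathbb R^3\setminus\{0\}\mid \frac{z_1k_1}{L_1}+\frac{z_2k_2}{L_2}+\frac{z_3k_3}{L_3}=0,\ z_i=0\text{ if }k_i=0\}$. With $C_i=\cos\left(\frac{k_i\pi x_i}{L_i}\right)$, $S_i=\sin\left(\frac{k_i\pi x_i}{L_i}\right)$ and $w=w^{j(k),k}$, $$Y^{j(k),k}=\begin{pmatrix}w_1S_1C_2C_3\\ w_2C_1S_2C_3\\ w_3C_1C_2S_3\end{pmatrix},\qquad Z^{j(k),k}=\begin{pmatrix}w_1S_1C_2S_3\\ w_2C_1S_2S_3\\ -w_3C_1C_2C_3\end{pmatrix}.$$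 The $Y^{j(k),k}$ are defined for $\#_0(k)\le1$, $j(k)\in\{1,2-\#_0(k)\}$, where $\{w^{j(k),k}\mid j(k)\in\{1,2-\#_0(k)\}\}\subset\{k\}_0^{\perp_{[L]}}$ is any fixed linearly independent orthogonal family. The $Z^{j(k),k}$ are defined as follows: if $\#_0(k)\le1$ and $k_3\ne0$, $j(k)\in\{1,2-\#_0(k)\}$ and the vectors $w^{j(k),k}$ are chosen in the same way as for $Y$; if $k_3=0$ and $\#_0(k)\in\{1,2\}$, then $j(k)=1$ and $w^{1,k}=(0,0,w_3^{1,k})$ with $w_3^{1,k}\neq0$; if $k=(0,0,0)$, $w=(0,0,-1)$, so $Z^{(0,0,0)}=(0,0,1)^\top$. *)

(* Defs.v *)
From HB Require Import structures.
From mathcomp Require Import all_boot all_order all_algebra.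
From mathcomp Require Import all_classical all_reals all_analysis.

Set Implicit Arguments.
Unset Strict Implicit.
Unset Printing Implicit Defensive.

Import Order.TTheory GRing.Theory Num.Theory numFieldNormedType.Exports.
Local Open Scope classical_set_scope.
Local Open Scope ring_scope.

Definition ax1 : 'I_3 := @Ordinal 3 0 isT.
Definition ax2 : 'I_3 := @Ordinal 3 1 isT.
Definition ax3 : 'I_3 := @Ordinal 3 2 isT.

Definition vec3 (T : Type) (a b c : T) : 'I_3 -> T :=
  fun i => nth a [:: a; b; c] i.

Definition lspan (R : realType) (V : lmodType R) (S : set V) : set V :=
  [set u | exists n (c : 'I_n -> R) (v : 'I_n -> V),
     (forall i, S (v i)) /\ u = \sum_i c i *: v i].

Section Domain.
Variables (R : realType) (L : 'I_3 -> R).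

Notation vfield := ('I_3 -> R * R * R -> R).

Definition crd (x : R * R * R) : 'I_3 -> R := vec3 x.1.1 x.1.2 x.2.

Definition basis (i : 'I_3) : R * R * R :=
  ((i == ax1)%:R, (i == ax2)%:R, (i == ax3)%:R).

Let mR := measurableTypeR R.
Let leb := @lebesgue_measure R.

(* One period in x3 of the strip (0,L1) x (0,L2) x R: a fundamental domain of
   Omega. *)
Definition cell : set (mR * mR * mR) :=
  `]0, L ax1[%classic `*` `]0, L ax2[%classic `*` `[0, 2 * L ax3[%classic.

Lemma measurable_cell : measurable cell.
Proof.
by apply: measurableX; [apply: measurableX|]; exact: measurable_itv.
Qed.

Definition muO : {measure set (mR * mR * mR) -> \bar R} :=
  mrestr (leb \x leb \x leb)%E measurable_cell.

Definition periodic (f : R * R * R -> R) : Prop :=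
  forall x : R * R * R, 0 < x.1.1 < L ax1 -> 0 < x.1.2 < L ax2 ->
    f (x.1.1, x.1.2, x.2 + 2 * L ax3) = f x.

(* Elements of L^2(Omega) are handled through measurable periodic
   representatives; H, DA and is_B below are invariant under passing to another
   representative of the same class. *)
Definition L2 (f : R * R * R -> R) : Prop :=
  periodic f /\ f \in Lfun muO 2%:E.

Definition L2v (u : vfield) : Prop := forall i, L2 (u i).

Definition dotL2 (u v : vfield) : R :=
  \sum_(i < 3) \int[muO]_x (u i x * v i x).

Definition normL2 (u : vfield) : R := Num.sqrt (dotL2 u u).

Definition partial (i : 'I_3) (f : R * R * R -> R) : R * R * R -> R :=
  fun x => 'D_(basis i) f x.

Definition smooth (f : R * R * R -> R) : Prop :=
  forall s : seq 'I_3, let g := foldr partial f s in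
    continuous g /\ forall i x, derivable g x (basis i).

(* C^oo up to the boundary *)
Definition smooth_bar (phi : R * R * R -> R) : Prop :=
  smooth phi /\ periodic phi.

(* C^oo with compact support in Omega; the support is only constrained in the
   x1 and x2 directions because the x3 direction is a circle. *)
Definition smooth_c (phi : R * R * R -> R) : Prop :=
  smooth_bar phi /\
  exists2 d : R, 0 < d & forall x, phi x != 0 ->
    d <= x.1.1 <= L ax1 - d /\ d <= x.1.2 <= L ax2 - d.

Definition weak_partial (i : 'I_3) (f g : R * R * R -> R) : Prop :=
  forall phi, smooth_c phi ->
    \int[muO]_x (f x * partial i phi x) = - \int[muO]_x (g x * phi x).

(* f is in H^1(Omega), with weak gradient G *)
Definition H1grad (f : R * R * R -> R) (G : vfield) : Prop :=
  L2 f /\ forall i, L2 (G i) /\ weak_partial i f (G i).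

Definition H2 (f : R * R * R -> R) : Prop :=
  exists2 G, H1grad f G & forall i, exists K, H1grad (G i) K.

Definition weak_div (u : vfield) (d : R * R * R -> R) : Prop :=
  forall phi, smooth_c phi ->
    \int[muO]_x (\sum_(i < 3) u i x * partial i phi x)
    = - \int[muO]_x (d x * phi x).

(* The normal trace of u, where u and d = div u are in L^2, is the functional
   <u.n, phi> = int_Omega (u . grad phi + (div u) phi) (Green's formula). *)
Definition normal_trace (u : vfield) (d phi : R * R * R -> R) : R :=
  \int[muO]_x ((\sum_(i < 3) u i x * partial i phi x) + d x * phi x).

Definition H : set vfield :=
  [set u | [/\ L2v u, weak_div u (cst 0) &
     forall phi, smooth_bar phi -> normal_trace u (cst 0) phi = 0]].

(* The lateral boundary consists of four faces: F.1 tells whether the face is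
   orthogonal to e2 (true) or e1 (false), F.2 whether it is the upper one. *)
Definition face : Type := (bool * bool)%type.

Definition face_axis (F : face) : 'I_3 := if F.1 then ax2 else ax1.

Definition outward_normal (F : face) : 'I_3 -> R :=
  fun i => if i == face_axis F then (if F.2 then 1 else -1) else 0.

Definition face_pt (F : face) (p : R * R) : R * R * R :=
  let s := if F.2 then L (face_axis F) else 0 in
  if F.1 then (p.1, s, p.2) else (s, p.1, p.2).

Definition face_dom (F : face) : set (mR * mR) :=
  `]0, L (if F.1 then ax1 else ax2)[%classic `*` `[0, 2 * L ax3[%classic.

Lemma measurable_face_dom F : measurable (face_dom F).
Proof. by apply: measurableX; exact: measurable_itv. Qed.

Definition muF (F : face) : {measure set (mR * mR) -> \bar R} :=
  mrestr (leb \x leb)%E (measurable_face_dom F).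

(* g is the trace on F of the H^1 function f, i.e. the L^2(F)-limit of the
   restrictions of smooth functions converging to f in H^1(Omega). *)
Definition is_trace (F : face) (f : R * R * R -> R) (g : R * R -> R) : Prop :=
  g \in Lfun (muF F) 2%:E /\
  exists (G : vfield) (phi : nat -> R * R * R -> R),
  [/\ H1grad f G, forall m, smooth_bar (phi m),
      (fun m => \int[muO]_x ((phi m x - f x) ^+ 2)) @ \oo --> (0 : R),
      forall i, (fun m => \int[muO]_x ((partial i (phi m) x - G i x) ^+ 2))
                  @ \oo --> (0 : R)
    & (fun m => \int[muF F]_p ((phi m (face_pt F p) - g p) ^+ 2))
                  @ \oo --> (0 : R)].

(* indices modulo 3: (curl u)_i = d_{i+1} u_{i+2} - d_{i+2} u_{i+1} *)
Definition is_curl (u w : vfield) : Prop :=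
  exists2 G : 'I_3 -> vfield, forall i, H1grad (u i) (G i) &
    forall i x, w i x = G (i + 2) (i + 1) x - G (i + 1) (i + 2) x.

(* (curl u - (n . curl u) n) = 0 on the boundary, in the sense of traces *)
Definition lions_bc (u : vfield) : Prop :=
  exists2 w, is_curl u w & forall F, exists2 c : 'I_3 -> R * R -> R,
    forall i, is_trace F (w i) (c i) &
    forall i, {ae muF F, forall p,
      c i p - (\sum_(k < 3) outward_normal F k * c k p) * outward_normal F i
      = 0}.

Definition DA : set vfield :=
  [set u | [/\ forall i, H2 (u i), H u & lions_bc u]].

Definition is_leray (f w : vfield) : Prop :=
  [/\ L2v f, H w & forall h, H h -> dotL2 (f - w) h = 0].

Definition is_convect (u v f : vfield) : Prop :=
  exists2 G : 'I_3 -> vfield, forall i, H1grad (v i) (G i) &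
    forall i x, f i x = \sum_(j < 3) u j x * G i j x.

(* w represents B(u,v); it is determined up to a null set. *)
Definition is_B (u v w : vfield) : Prop :=
  exists2 f, is_convect u v f & is_leray f w.

(* w represents B(a,b) + B(b,a) *)
Definition is_symB (a b w : vfield) : Prop :=
  exists w1 w2, [/\ is_B a b w1, is_B b a w2 & w = w1 + w2].

(* H p and H q are the condition (B(a,a), B(b,b)) in H x H. *)
Definition FL (C E : set vfield) : set vfield :=
  let S := [set w | exists a b, [/\ C a, E b,
              exists p q, [/\ is_B a a p, is_B b b q, H p & H q]
            & is_symB a b w]] in
  [set u + v | u in E & v in lspan S `&` DA].

Fixpoint Gseq (C : set vfield) (j : nat) : set vfield :=
  if j is j'.+1 then FL C (Gseq C j') else lspan C.

Definition L2_dense_in (A B : set vfield) : Prop :=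
  forall h, B h -> forall eps : R, 0 < eps ->
    exists2 g, A g & normL2 (h - g) < eps.

Definition saturating (C : set vfield) : Prop :=
  [/\ finite_set C, C `<=` DA & L2_dense_in (\bigcup_j Gseq C j) H].

Definition num0 (k : 'I_3 -> nat) : nat := #|[pred i | k i == 0%N]|.

Definition perpL (k : 'I_3 -> nat) : set ('I_3 -> R) :=
  [set z | [/\ z != 0, \sum_(i < 3) z i * (k i)%:R / L i = 0 &
               forall i, k i = 0%N -> z i = 0]].

(* j(k) ranges over {1, 2 - #_0(k)}, which is {1} when #_0(k) = 1: the list may
   have a repetition. *)
Definition jset (k : 'I_3 -> nat) : seq nat := [:: 1%N; (2 - num0 k)%N].

Definition Ck (k : 'I_3 -> nat) (i : 'I_3) (x : R * R * R) : R :=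
  cos ((k i)%:R * pi * crd x i / L i).
Definition Sk (k : 'I_3 -> nat) (i : 'I_3) (x : R * R * R) : R :=
  sin ((k i)%:R * pi * crd x i / L i).

Definition Y (w : 'I_3 -> R) (k : 'I_3 -> nat) : vfield :=
  vec3 (fun x => w ax1 * Sk k ax1 x * Ck k ax2 x * Ck k ax3 x)
       (fun x => w ax2 * Ck k ax1 x * Sk k ax2 x * Ck k ax3 x)
       (fun x => w ax3 * Ck k ax1 x * Ck k ax2 x * Sk k ax3 x).

Definition Z (w : 'I_3 -> R) (k : 'I_3 -> nat) : vfield :=
  vec3 (fun x => w ax1 * Sk k ax1 x * Ck k ax2 x * Sk k ax3 x)
       (fun x => w ax2 * Ck k ax1 x * Sk k ax2 x * Sk k ax3 x)
       (fun x => - w ax3 * Ck k ax1 x * Ck k ax2 x * Ck k ax3 x).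

Definition perp_family (k : 'I_3 -> nat) (w : nat -> 'I_3 -> R) : Prop :=
  [/\ {in jset k, forall j, perpL k (w j)},
      {in jset k &, forall j j', j != j' -> \sum_(i < 3) w j i * w j' i = 0}
    & forall c : nat -> R, \sum_(j <- undup (jset k)) c j *: w j = 0 ->
        {in jset k, forall j, c j = 0}].

Definition admissibleY (w : nat -> ('I_3 -> nat) -> 'I_3 -> R) : Prop :=
  forall k, (num0 k <= 1)%N -> perp_family k (w^~ k).

Definition admissibleZ (w : nat -> ('I_3 -> nat) -> 'I_3 -> R) : Prop :=
  (forall k, (num0 k <= 1)%N -> k ax3 <> 0%N -> perp_family k (w^~ k)) /\
  (forall k, k ax3 = 0%N -> num0 k = 1%N \/ num0 k = 2%N ->
     [/\ w 1%N k ax1 = 0, w 1%N k ax2 = 0 & w 1%N k ax3 != 0]).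

Definition Z000 : vfield := Z (vec3 0 0 (-1)) (fun=> 0%N).

Definition Ctilde (wY wZ : nat -> ('I_3 -> nat) -> 'I_3 -> R) : set vfield :=
  [set u | exists n j, [/\ (num0 n <= 1)%N, forall i, (n i <= 3)%N,
                           j \in jset n & u = Y (wY j n) n]] `|`
  [set u | exists n j, [/\ (num0 n <= 1)%N, forall i, (n i <= 4)%N,
                           j \in jset n & u = Z (wZ j n) n]] `|`
  [set u | exists n, [/\ num0 n = 2%N, n ax3 = 0%N, forall i, (n i <= 4)%N
                       & u = Z (wZ 1%N n) n]] `|`
  [set Z000].

End Domain.

(* Main.v *)
Require Import Defs.
From HB Require Import structures.
From mathcomp Require Import all_boot all_order all_algebra.
From mathcomp Require Import all_classical all_reals all_analysis.
From mathcomp Require Import measurable_realfun zify ring lra.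

Set Implicit Arguments.
Unset Strict Implicit.
Unset Printing Implicit Defensive.

Import Order.TTheory GRing.Theory Num.Theory numFieldNormedType.Exports.
Local Open Scope classical_set_scope.
Local Open Scope ring_scope.

(* Every field of the generating set is a mode: a field Y or Z with frequency
   k = (k_i pi / L_i) and amplitude w orthogonal to k. For two modes u and v the
   field (u . grad) v is, by the product-to-sum formulas, a finite sum of modes
   with amplitudes no longer orthogonal to their frequency; the Leray projection
   projects these amplitudes, the rest being a gradient. Call k full if all modes
   of frequency k are reached. Z^(0,0,0) exchanges Y^k and Z^k when k_3 <> 0; the
   shears Z^(1,0,0) and Z^(0,1,0) increase k_1 and k_2 at a fixed k_3 <> 0; the
   plane modes Y^(p,0,1) and Y^(0,q,1) with p, q <= 2 increase k_3, and also yield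
   the frequencies with k_3 = 0. So all frequencies are full.

   For density, thresholds of cosine polynomials converge boundedly to indicators
   of boxes, so by a Dynkin argument each component of h in H is the L^2 limit of
   s_i p_i, with p_i a trigonometric polynomial and s_i the sine vanishing on the
   faces orthogonal to e_i. The field (s_i p_i)_i is a combination of modes, that
   is P + grad phi with P reached; as h - P is orthogonal to grad phi, P is at
   least as close to h as P + grad phi. *)

(** * Integration over the cell *)

(** Two obstacles shape the induction on frequencies. A bracket with a shear or a plane mode yields
    two or four frequencies at once, so a new one can be split off only when the others are already
    full; this dictates the order in which frequencies are treated. Moreover, at a frequency without
    zero component the amplitudes form a plane, while a partner with a zero frequency supplies only
    one amplitude. Shears avoid this by acting on a whole plane of partner amplitudes. To raise k_3,
    the amplitudes given by Y^(p,0,1) with partner (0,q,s) and by Y^(0,q,1) with partner (p,0,s) are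
    combined at (p,q,s+1); with the frequency they have a determinant containing the factor s - 1,
    so both levels k_3 = 1 and k_3 = 2 come from the generating set. The values p = 2 and q = 2
    serve to come back down: a shear applied to (1,1,t) couples (1,0,t) with (1,2,t). In the density
    part, the sines s_i carry the boundary condition: a trigonometric polynomial that does not
    vanish on the faces orthogonal to e_i is not the i-th component of a sum of modes. *)

Section Restriction.
Context d (T : measurableType d) (R : realType).
Variables (mu : {measure set T -> \bar R}) (D : set T) (mD : measurable D).
Local Open Scope ereal_scope.

(** The restricted measure ignores the complement of [D] and agrees with [mu] on the measurable
    subsets of [D]. *)
Lemma ge0_integral_mrestr (f : T -> \bar R) :
  measurable_fun setT f -> (forall x, 0 <= f x) ->
  \int[mrestr mu mD]_x f x = \int[mu]_(x in D) f x.
Proof.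
move=> mf f0.
have mC := measurableC mD.
have restr_set0 (m : {measure set T -> \bar R}) (E : set T) (mE : measurable E) :
    m E = 0 -> \int[m]_(x in E) f x = 0.
  by move=> mE0; apply: null_set_integral => //; exact: measurable_funTS.
have split_int (m : {measure set T -> \bar R}) :
    \int[m]_x f x = \int[m]_(x in D) f x + \int[m]_(x in ~` D) f x.
  rewrite -ge0_integral_setU ?setUv//; first by apply/disj_setPLR; rewrite setCK.
rewrite split_int [X in _ + X]restr_set0 ?adde0//=; last first.
  by rewrite /mrestr setICl measure0.
apply: eq_measure_integral => A mA AD.
by rewrite /= /mrestr setIidl.
Qed.

Lemma integral_mrestr (f : T -> \bar R) :
  measurable_fun setT f ->
  \int[mrestr mu mD]_x f x = \int[mu]_(x in D) f x.
Proof.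
move=> mf; rewrite [in LHS]integralE [in RHS]integralE.
by congr (_ - _); apply: ge0_integral_mrestr => //;
  [exact: measurable_funepos|exact: measurable_funeneg].
Qed.

Lemma integrable_mrestr (f : T -> \bar R) :
  measurable_fun setT f ->
  (mrestr mu mD).-integrable setT f <-> mu.-integrable D f.
Proof.
move=> mf; split=> /integrableP[_ foo]; apply/integrableP; split => //.
- exact: measurable_funTS.
- by rewrite -ge0_integral_mrestr//; exact: measurableT_comp.
- by rewrite ge0_integral_mrestr//; exact: measurableT_comp.
Qed.
End Restriction.

Section ContinuousMeasurable.
Variable R : realType.
Let mR := measurableTypeR R.

(** Bridge between the product topology and the product sigma-algebra: a countable family with
    measurable preimages that refines every neighbourhood. In this form the property passes to
    products factor by factor; [h] carries the measurable copy of a space to its topological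
    copy. *)
Definition measurable_basis d (T : topologicalType) (S : measurableType d)
    (h : S -> T) : Prop :=
  exists (I : countType) (B : I -> set T),
    (forall i, measurable (h @^-1` B i)) /\
    forall x A, nbhs x A -> exists2 i, B i x & B i `<=` A.

Lemma open_measurable_basis d (T : topologicalType) (S : measurableType d)
    (h : S -> T) (U : set T) :
  measurable_basis h -> open U -> measurable (h @^-1` U).
Proof.
move=> [I [B [mB baseB]]] oU.
have -> : U = \bigcup_(i in [set i | B i `<=` U]) B i.
  apply/seteqP; split=> [x Ux|x [i /= BU Bx]]; last exact: BU.
  by have [i Bx BU] := baseB x U (open_nbhs_nbhs (conj oU Ux)); exists i.
rewrite preimage_bigcup bigcup_mkcond; apply: countable_bigcupT_measurable => //.
by move=> i; case: ifP.
Qed.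

Lemma measurable_basisR : measurable_basis (id : mR -> R).
Proof.
exists (rat * rat)%type, (fun q => `]ratr q.1, ratr q.2[%classic).
split=> [q|x A /nbhs_ballP[e /= e0 xA]]; first exact: measurable_itv.
have [p] := @rat_in_itvoo R (x - e) x ltac:(lra).
have [q] := @rat_in_itvoo R x (x + e) ltac:(lra).
rewrite !in_itv/= => xq px; exists (p, q); first by rewrite /= in_itv/=; lra.
move=> y /=; rewrite in_itv/= => /andP[py yq]; apply: xA.
by rewrite /ball/= ltr_norml; lra.
Qed.

Lemma measurable_basis_prod d1 d2 (T1 T2 : topologicalType)
    (S1 : measurableType d1) (S2 : measurableType d2) (h1 : S1 -> T1)
    (h2 : S2 -> T2) :
  measurable_basis h1 -> measurable_basis h2 ->
  measurable_basis (fun x : S1 * S2 => (h1 x.1, h2 x.2)).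
Proof.
move=> [I1 [B1 [mB1 base1]]] [I2 [B2 [mB2 base2]]].
exists (I1 * I2)%type, (fun i => B1 i.1 `*` B2 i.2); split.
  by move=> i; exact: measurableX (mB1 i.1) (mB2 i.2).
move=> [x1 x2] A [[A1 A2] /= [xA1 xA2] A12].
have [i1 Bx1 BA1] := base1 _ _ xA1; have [i2 Bx2 BA2] := base2 _ _ xA2.
by exists (i1, i2) => //= -[y1 y2] [/= /BA1 ? /BA2 ?]; apply: A12.
Qed.

Lemma open_measurable_prod3 (U : set (R * R * R)) :
  open U -> measurable (U : set (mR * mR * mR)).
Proof.
move=> oU; pose h (x : mR * mR * mR) : R * R * R := ((x.1.1, x.1.2), x.2).
have -> : (U : set (mR * mR * mR)) = h @^-1` U.
  by apply/seteqP; split=> -[[a b] c].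
apply: open_measurable_basis oU.
have base2 := measurable_basis_prod measurable_basisR measurable_basisR.
have base3 := measurable_basis_prod base2 measurable_basisR.
exact: base3.
Qed.

Lemma continuous_measurable3 (f : R * R * R -> R) : continuous f ->
  measurable_fun setT (f : mR * mR * mR -> R).
Proof.
move=> /continuousP cf.
apply: (measurability _ (measurable_realfun.RGenOpens.measurableE R)) => _ [_ [a [b ->] <-]].
rewrite setTI; apply: open_measurable_prod3; apply: cf; exact: interval_open.
Qed.
End ContinuousMeasurable.

Section SquareIntegrable.
Context d (T : measurableType d) (R : realType).
Variable mu : {measure set T -> \bar R}.

Lemma Lfun2P (f : T -> R) :
  f \in Lfun mu 2%:E <->
  measurable_fun setT f /\ mu.-integrable setT (EFin \o (fun x => f x ^+ 2)).
Proof.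
split=> [f2|[mf /integrableP[_ foo]]].
  split; last exact: Lfun2_integrable_sqr.
  by have /set_mem := sub_Lfun_mfun f2.
rewrite inE; apply/andP; split; rewrite inE//=.
rewrite /finite_norm unlock /=; apply: poweR_lty.
move: foo; congr (_ < _)%E; apply: eq_integral => x _.
by rewrite /= powR_mulrn// ger0_norm ?sqr_ge0// real_normK ?num_real//.
Qed.

Lemma Lfun2_integrableM (f g : T -> R) :
  f \in Lfun mu 2%:E -> g \in Lfun mu 2%:E ->
  mu.-integrable setT (EFin \o (fun x => f x * g x)).
Proof. by move=> f2 g2; apply/Lfun1_integrable; exact: Lfun2_mul_Lfun1. Qed.

Lemma bounded_integrable_mrestr (D : set T) (mD : measurable D) (f : T -> R) (M : R) :
  (mu D < +oo)%E -> measurable_fun setT f -> (forall x, D x -> `|f x| <= M) ->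
  (mrestr mu mD).-integrable setT (EFin \o f).
Proof.
move=> muD mf fM; apply/(integrable_mrestr _ mD); first exact/measurable_EFinP.
apply: measurable_bounded_integrable => //; first exact: measurable_funTS.
by exists M; split; [exact: num_real|move=> N MN x /fM fx /=; lra].
Qed.

End SquareIntegrable.

Lemma bounded_Lfun2_mrestr d (T : measurableType d) (R : realType)
    (mu : {measure set T -> \bar R}) (D : set T) (mD : measurable D)
    (f : T -> R) (M : R) :
  (mu D < +oo)%E -> measurable_fun setT f -> (forall x, D x -> `|f x| <= M) ->
  f \in Lfun (mrestr mu mD) 2%:E.
Proof.
move=> muD mf fM; apply/Lfun2P; split => //.
apply: (@bounded_integrable_mrestr _ _ _ _ _ _ _ (M ^+ 2)) => //.
  exact: measurable_funX.
move=> x /fM; rewrite normrX => fx.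
by rewrite lerXn2r ?nnegrE// (le_trans _ fx).
Qed.

Section Cell.
Variables (R : realType) (L : 'I_3 -> R).
Let mR := measurableTypeR R.
Let leb := @lebesgue_measure R.
Local Notation muO := (muO L).
Local Notation cell := (cell L).

Lemma mem_cell (x : R * R * R) :
  cell x <-> [/\ 0 < x.1.1 < L ax1, 0 < x.1.2 < L ax2 & 0 <= x.2 < 2 * L ax3].
Proof. by rewrite /Defs.cell/= !in_itv/=; split=> [[[]]|[]]. Qed.

Lemma leb3_cell : ((leb \x leb \x leb) cell < +oo)%E.
Proof.
rewrite /Defs.cell product_measure1E//; last first.
  by apply: measurableX; exact: measurable_itv.
rewrite [X in (X * _)%E]product_measure1E//.
by rewrite /leb /= ?lebesgue_measure_itv/= !lte_fin; do 3 case: ifPn => _ ;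
  rewrite ?mul0e ?mule0 -?EFinB -?EFinM ltry.
Qed.

Definition cell_bounded (f : R * R * R -> R) : Prop :=
  exists M, forall x, cell x -> `|f x| <= M.

(** The box is closed because traces need the same bound on the lateral faces, which [cell] leaves
    out. *)
Lemma continuous_closed_cell_bounded (f : R * R * R -> R) : continuous f ->
  exists M, forall x, 0 <= x.1.1 <= L ax1 -> 0 <= x.1.2 <= L ax2 ->
    0 <= x.2 <= 2 * L ax3 -> `|f x| <= M.
Proof.
move=> cf; pose K := `[0, L ax1] `*` `[0, L ax2] `*` `[0, 2 * L ax3].
have cK : compact K.
  by apply: compact_setX; [apply: compact_setX|]; exact: segment_compact.
have /compact_bounded [M [_ fM]] : compact (f @` K).
  by apply: continuous_compact => //; exact: continuous_subspaceT.
exists (M + 1) => x x1 x2 x3; apply: (fM (M + 1)); first by rewrite ltrDl.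
by exists x => //; rewrite /K /= !in_itv/= x1 x2 x3.
Qed.

Lemma continuous_cell_bounded (f : R * R * R -> R) :
  continuous f -> cell_bounded f.
Proof.
move=> /continuous_closed_cell_bounded[M fM].
by exists M => x /mem_cell[x1 x2 x3]; apply: fM; lra.
Qed.

Lemma bounded_integrable_muO (f : R * R * R -> R) :
  measurable_fun setT (f : mR * mR * mR -> R) -> cell_bounded f ->
  muO.-integrable setT (EFin \o f).
Proof.
by move=> mf [M fM]; exact: (bounded_integrable_mrestr _ leb3_cell mf fM).
Qed.

Lemma Rintegral_muO_cell (f : R * R * R -> R) :
  measurable_fun setT (f : mR * mR * mR -> R) ->
  \int[muO]_x f x = \int[(leb \x leb \x leb)%E]_(x in cell) f x.
Proof.
by move=> mf; rewrite /Rintegral integral_mrestr//; exact/measurable_EFinP.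
Qed.

Lemma bounded_L2_muO (f : R * R * R -> R) :
  measurable_fun setT (f : mR * mR * mR -> R) -> cell_bounded f ->
  f \in Lfun muO 2%:E.
Proof.
by move=> mf [M fM]; exact: (bounded_Lfun2_mrestr _ leb3_cell mf fM).
Qed.

End Cell.

Section TripleFubini.
Context d1 d2 d3 (T1 : measurableType d1) (T2 : measurableType d2)
  (T3 : measurableType d3) (R : realType).
Variables (m1 : {sigma_finite_measure set T1 -> \bar R})
  (m2 : {sigma_finite_measure set T2 -> \bar R})
  (m3 : {sigma_finite_measure set T3 -> \bar R}).

(** Makes [m1 \x m2] an admissible first factor, so that Fubini for two factors applies to triples.
    The rectangles are enumerated by decoding [n]; indices that decode to nothing repeat the
    rectangle (0, 0). *)
Lemma product_measure1_sigma_finite : sigma_finite setT (m1 \x m2)%E.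
Proof.
have [F TF Ffin] := sigma_finiteT m1; have [G TG Gfin] := sigma_finiteT m2.
pose p n : nat * nat := odflt (0, 0)%N (unpickle n).
exists (fun n => F (p n).1 `*` G (p n).2) => [|n].
  apply/seteqP; split=> // -[x y] _.
  have [i _ Fx] : (\bigcup_n F n) x by rewrite -TF.
  have [j _ Gy] : (\bigcup_n G n) y by rewrite -TG.
  by exists (pickle (i, j)) => //; rewrite /p pickleK.
have [mF Fn] := Ffin (p n).1; have [mG Gn] := Gfin (p n).2.
split; first exact: measurableX.
by rewrite product_measure1E// lte_mul_pinfty// ge0_fin_numE.
Qed.

Let m12 : {sigma_finite_measure set (T1 * T2)%type -> \bar R} :=
  HB.pack (product_measure1 m1 m2)
    (Measure_isSigmaFinite.Build _ _ _ _ product_measure1_sigma_finite).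

Lemma integral21_prod3 (f : T1 * T2 * T3 -> \bar R) :
  (m1 \x m2 \x m3)%E.-integrable setT f ->
  (\int[m3]_z \int[m1 \x m2]_w f (w, z) = \int[m1 \x m2 \x m3]_x f x)%E.
Proof. exact: (@integral21_prod_meas1 _ _ _ _ _ m12 m3 f). Qed.

Lemma integral12_prod3 (f : T1 * T2 * T3 -> \bar R) :
  (m1 \x m2 \x m3)%E.-integrable setT f ->
  (\int[m1 \x m2]_w \int[m3]_z f (w, z) = \int[m1 \x m2 \x m3]_x f x)%E.
Proof. exact: (@integral12_prod_meas1 _ _ _ _ _ m12 m3 f). Qed.
End TripleFubini.

Section CoordinateLines.
Variable R : realType.

(** The point [a] with its [i]-th coordinate replaced by [t]: partial derivatives become derivatives
    in one variable along such lines. *)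
Definition line (a : R * R * R) (i : 'I_3) (t : R) : R * R * R :=
  a + (t - crd a i) *: Defs.basis R i.

Lemma line_quotient (F : R * R * R -> R) a i :
  (fun h => h^-1 *: ((F \o shift a) (h *: Defs.basis R i) - F a)) =
  (fun h => h^-1 *: (((F \o line a i) \o shift (crd a i)) (h *: (1 : R))
                     - (F \o line a i) (crd a i))).
Proof.
apply/funext => h /=; congr (h^-1 *: (F _ - F _)); last first.
  by rewrite /line subrr scale0r addr0.
by rewrite /shift/= /line addrK addrC -[h *: 1]/(h * 1) mulr1.
Qed.

Lemma is_derive_line (F : R * R * R -> R) a i :
  derivable F a (Defs.basis R i) ->
  is_derive (crd a i) (1 : R) (F \o line a i) (partial i F a).
Proof.
by move=> dF; split; rewrite /partial/= /derivable /derive -line_quotient.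
Qed.

Lemma line1 (x y z t : R) : line (x, y, z) ax1 t = (t, y, z).
Proof. by rewrite /line/= /Defs.basis/= /crd /vec3/=; congr (_, _, _); rewrite /= /GRing.scale/=; ring. Qed.
Lemma line2 (x y z t : R) : line (x, y, z) ax2 t = (x, t, z).
Proof. by rewrite /line/= /Defs.basis/= /crd /vec3/=; congr (_, _, _); rewrite /= /GRing.scale/=; ring. Qed.
Lemma line3 (x y z t : R) : line (x, y, z) ax3 t = (x, y, t).
Proof. by rewrite /line/= /Defs.basis/= /crd /vec3/=; congr (_, _, _); rewrite /= /GRing.scale/=; ring. Qed.

Lemma ord3P (P : 'I_3 -> Prop) : P ax1 -> P ax2 -> P ax3 -> forall i, P i.
Proof.
by move=> P1 P2 P3 [[|[|[|//]]] Hi]; [move: P1|move: P2|move: P3];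
  congr P; exact: val_inj.
Qed.

Lemma crd_line a i t : crd (line a i t) i = t.
Proof.
by case: a => -[x y] z; elim/ord3P: i; rewrite ?line1 ?line2 ?line3.
Qed.

Lemma line_line a i s t : line (line a i s) i t = line a i t.
Proof.
by case: a => -[x y] z; elim/ord3P: i; rewrite ?line1 ?line2 ?line3.
Qed.

Lemma is_derive_along_line (F : R * R * R -> R) a i t :
  (forall x, derivable F x (Defs.basis R i)) ->
  is_derive t (1 : R) (F \o line a i) (partial i F (line a i t)).
Proof.
move=> dF; have := is_derive_line (dF (line a i t)); rewrite crd_line.
by congr is_derive; apply/funext => s /=; rewrite line_line.
Qed.

Lemma continuous_line a i : continuous (line a i).
Proof.
move=> t; apply: cvgD; first exact: cvg_cst.
by apply: cvgZr_tmp; apply: cvgB; [exact: cvg_id|exact: cvg_cst].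
Qed.

End CoordinateLines.

(** * Vanishing of integrals of partial derivatives *)

Section IntegralPartial.
Variables (R : realType) (L : 'I_3 -> R).
Hypothesis L_gt0 : forall i, 0 < L i.
Let mR := measurableTypeR R.
Let leb := @lebesgue_measure R.
Local Notation muO := (muO L).
Local Notation cell := (cell L).

(** The boolean [b] covers both kinds of sides of the cell: open at 0 in the directions 1 and 2,
    closed at 0 in the direction 3. *)
Lemma integral_derive0 (f F : R -> R) (l : R) (b : bool) : 0 < l ->
  continuous f -> (forall x, is_derive x (1 : R) F (f x)) -> F l = F 0 ->
  (\int[leb]_(x in [set` Interval (BSide b 0%R) (BLeft l)]) (f x)%:E = 0)%E.
Proof.
move=> l0 cf dF Fl.
have mf (D : set R) : measurable_fun D (EFin \o f).
  by apply: measurable_funTS; apply/measurable_EFinP; exact: continuous_measurable_fun.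
have -> : (\int[leb]_(x in [set` Interval (BSide b 0%R) (BLeft l)]) (f x)%:E =
           \int[leb]_(x in `[0%R, l]) (f x)%:E)%E.
  rewrite /leb integral_itv_bndo_bndc; last exact: mf.
  by case: b => //; rewrite integral_itv_obnd_cbnd//; exact: mf.
have cF : continuous F.
  by move=> x; apply/differentiable_continuous/derivable1_diffP; exact: (@ex_derive _ _ _ _ _ _ _ (dF x)).
rewrite (@continuous_FTC2 _ f F)//.
- by rewrite Fl subee.
- exact: continuous_subspaceT.
- split.
  + by move=> x _; exact: (@ex_derive _ _ _ _ _ _ _ (dF x)).
  + by apply: cvg_at_right_filter; exact: cF.
  + by apply: cvg_at_left_filter; exact: cF.
- by move=> x _; rewrite derive1E (@derive_val _ _ _ _ _ _ _ (dF x)).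
Qed.

Lemma integral_patch_derive0 (P : bool) (f F : R -> R) (l : R) (b : bool) :
  0 < l ->
  (P -> [/\ continuous f, forall x, is_derive x (1 : R) F (f x) & F l = F 0]) ->
  (\int[leb]_x
     (if P && (x \in Interval (BSide b 0%R) (BLeft l)) then (f x)%:E else 0%E))%E
  = 0%E.
Proof.
move=> l0; case: P => [/(_ isT)[cf dF Fl]|_]; last by rewrite integral0_eq.
rewrite -[RHS](integral_derive0 b l0 cf dF Fl) [RHS]integral_mkcond.
by apply: eq_integral => x _; rewrite patchE /= mem_setE.
Qed.

Lemma patch_cellE (g : R * R * R -> R) x y z :
  ((EFin \o g) \_ cell) (x, y, z) =
  (if [&& x \in `]0, L ax1[, y \in `]0, L ax2[ & z \in `[0, 2 * L ax3[]
   then (g (x, y, z))%:E else 0%E).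
Proof.
rewrite patchE; case: ifPn => [/set_mem[[/= -> ->] ->]//|].
by rewrite notin_setE => /= c; case: ifPn => // /and3P[? ? ?]; case: c.
Qed.

Definition len (i : 'I_3) : R := vec3 (L ax1) (L ax2) (2 * L ax3) i.

Lemma integrable_section (g : R * R * R -> R) z : continuous g ->
  (leb \x leb)%E.-integrable setT (fun xy => ((EFin \o g) \_ cell) (xy, z)).
Proof.
move=> cg; have mg := continuous_measurable3 cg.
pose Q : set (mR * mR) := `]0, L ax1[ `*` `]0, L ax2[.
have mQ : measurable Q by apply: measurableX; exact: measurable_itv.
have [zI|zI] := boolP (z \in `[0, 2 * L ax3[); last first.
  rewrite (_ : (fun _ => _) = cst 0%E); first exact: integrable0.
  apply/funext => -[x y]; rewrite patch_cellE (negbTE zI).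
  by case: (x \in _); case: (y \in _).
rewrite (_ : (fun _ => _) = (EFin \o (fun xy => g (xy, z))) \_ Q); last first.
  apply/funext => -[x y]; rewrite patch_cellE zI patchE in_setX !mem_setE andbT.
  by [].
apply: (iffLR (integrable_mkcond _ mQ)); apply: measurable_bounded_integrable => //.
- rewrite /= /Q product_measure1E//= /leb !lebesgue_measure_itv/= !lte_fin.
  by do 2 case: ifPn => _; rewrite ?mul0e ?mule0 -?EFinB -?EFinM ltry.
- apply: measurable_funTS; exact: (measurable_fun_pair1 (z : mR) mg).
have [M gM] := continuous_cell_bounded L cg.
exists M; split; [exact: num_real|move=> N MN [x y] [/= xI yI]].
have /gM : cell (x, y, z) by split.
by move=> ?; lra.
Qed.

Lemma len_gt0 i : 0 < len i.
Proof. by move: i; apply: ord3P; rewrite /len/vec3/= ?mulr_gt0. Qed.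

(** [P] says that the two other coordinates lie in the cell. If not, the integrand is zero; if so,
    the line meets the cell and the end values of [F] agree on it. *)
Lemma integral_line_partial0 i (F : R * R * R -> R) a (P b : bool) :
  (forall x, derivable F x (Defs.basis R i)) ->
  continuous (partial i F) ->
  (forall x, cell x -> F (line x i (len i)) = F (line x i 0)) ->
  (P -> exists t, cell (line a i t)) ->
  (\int[leb]_t (if P && (t \in Interval (BSide b 0%R) (BLeft (len i)))
                then (partial i F (line a i t))%:E else 0%E))%E = 0%E.
Proof.
move=> dF cF F0 Pcell.
apply: (@integral_patch_derive0 P (fun t => partial i F (line a i t))
  (F \o line a i) (len i) b (len_gt0 i)) => HP; split.
- move=> t; apply: (@continuous_comp _ _ _ (line a i) (partial i F)); [exact: continuous_line|exact: cF].
- by move=> t; exact: is_derive_along_line.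
- have [t ct] := Pcell HP; have := F0 _ ct.
  by rewrite (line_line a i t (len i)) (line_line a i t 0).
Qed.

(** Fubini with the [i]-th variable innermost; the fundamental theorem of calculus then leaves a
    difference of end values, which is zero. *)
Lemma integral_partial0 (i : 'I_3) (F : R * R * R -> R) :
  (forall x, derivable F x (Defs.basis R i)) ->
  continuous (partial i F) ->
  (forall x, cell x -> F (line x i (len i)) = F (line x i 0)) ->
  \int[muO]_x partial i F x = 0.
Proof.
move=> dF cF F0; set g := partial i F.
have mg : measurable_fun setT (g : mR * mR * mR -> R) by exact: continuous_measurable3.
rewrite Rintegral_muO_cell// /Rintegral [X in fine X](_ : _ = 0%E)//.
have ig : (leb \x leb \x leb)%E.-integrable cell (EFin \o g).
  apply/(integrable_mrestr _ (measurable_cell L)); first exact/measurable_EFinP.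
  by apply: bounded_integrable_muO => //; exact: continuous_cell_bounded.
rewrite integral_mkcond; set G := _ \_ _.
have iG : (leb \x leb \x leb)%E.-integrable setT G.
  exact: (iffLR (integrable_mkcond _ (measurable_cell L)) ig).
have Lhalf j : 0 < L j / 2 < L j.
  by rewrite divr_gt0//= ltr_pdivrMr// ltr_pMr// ltr1n.
have L3 : 0 <= L ax3 < 2 * L ax3 by have := L_gt0 ax3; lra.
have line0 := fun a P b => @integral_line_partial0 i F a P b dF cF F0.
have : i = ax1 \/ i = ax2 \/ i = ax3 by move: (i); apply: ord3P; intuition.
move=> [|[|]] ei; rewrite ei in line0.
- rewrite -(integral21_prod3 iG); apply: integral0_eq => z _.
  have iGz : (leb \x leb)%E.-integrable setT (fun xy => G (xy, z)).
    exact: integrable_section.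
  rewrite -(integral21_prod_meas1 iGz); apply: integral0_eq => y _.
  rewrite /fubini_G -(line0 (0, y, z) ((y \in `]0, L ax2[) && (z \in `[0, 2 * L ax3[)) false); last first.
    by move=> yz; exists (L ax1 / 2); rewrite line1; apply/mem_cell; move: yz; rewrite !in_itv/= => /andP[].
  apply: eq_integral => x _; rewrite /G patch_cellE line1 /g ei /len /vec3/=.
  by case: (x \in _); case: (y \in _); case: (z \in _).
- rewrite -(integral21_prod3 iG); apply: integral0_eq => z _.
  have iGz : (leb \x leb)%E.-integrable setT (fun xy => G (xy, z)).
    exact: integrable_section.
  rewrite -(integral12_prod_meas1 iGz); apply: integral0_eq => x _.
  rewrite /fubini_F -(line0 (x, 0, z) ((x \in `]0, L ax1[) && (z \in `[0, 2 * L ax3[)) false); last first.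
    by move=> xz; exists (L ax2 / 2); rewrite line2; apply/mem_cell; move: xz; rewrite !in_itv/= => /andP[].
  apply: eq_integral => y _; rewrite /G patch_cellE line2 /g ei /len /vec3/=.
  by case: (x \in _); case: (y \in _); case: (z \in _).
- rewrite -(integral12_prod3 iG); apply: integral0_eq => -[x y] _.
  rewrite -(line0 (x, y, 0) ((x \in `]0, L ax1[) && (y \in `]0, L ax2[)) true); last first.
    by move=> xy; exists (L ax3); rewrite line3; apply/mem_cell; move: xy; rewrite !in_itv/= => /andP[].
  apply: eq_integral => z _; rewrite /G patch_cellE line3 /g ei /len /vec3/=.
  by case: (x \in _); case: (y \in _); case: (z \in _).
Qed.
End IntegralPartial.

(** * Smooth fields *)

Section Smooth.
Variables (R : realType) (L : 'I_3 -> R).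
Notation sfield := (R * R * R -> R).
Implicit Types (f g : sfield) (i j : 'I_3).

Lemma smooth_continuous f : smooth f -> continuous f.
Proof. by move=> /(_ [::])[]. Qed.

Lemma smooth_derivable f : smooth f -> forall i x, derivable f x (Defs.basis R i).
Proof. by move=> /(_ [::])[_]; exact. Qed.

Lemma smooth_partial i f : smooth f -> smooth (partial i f).
Proof. by move=> sf s; have := sf (rcons s i); rewrite foldr_rcons. Qed.

Lemma partialD i f g : smooth f -> smooth g ->
  partial i (f + g) = partial i f + partial i g.
Proof. by move=> sf sg; apply/funext => x; rewrite /partial deriveD//; exact: smooth_derivable. Qed.

Lemma partialZ i (c : R) f : smooth f -> partial i (c *: f) = c *: partial i f.
Proof. by move=> sf; apply/funext => x; rewrite /partial deriveZ//; exact: smooth_derivable. Qed.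

(** Smoothness by coinduction: a class closed under partial derivatives contains all the iterated
    ones, so only first-order regularity has to be checked. *)
Lemma smooth_stable (P : sfield -> Prop) :
  (forall f, P f -> continuous f /\ forall i x, derivable f x (Defs.basis R i)) ->
  (forall f i, P f -> P (partial i f)) -> forall f, P f -> smooth f.
Proof.
move=> Pd Pp f Pf s; apply: Pd.
by elim: s => //= i s; exact: Pp.
Qed.

Lemma smoothD f g : smooth f -> smooth g -> smooth (f + g).
Proof.
move=> sf sg; apply: (@smooth_stable (fun h => exists f' g', [/\ smooth f', smooth g' & h = f' + g'])).
- move=> _ [f' [g' [sf' sg' ->]]]; split.
    by move=> x; apply: cvgD; exact: smooth_continuous.
  by move=> i x; apply: derivableD; [exact: (smooth_derivable sf')|exact: (smooth_derivable sg')].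
- move=> _ i [f' [g' [sf' sg' ->]]]; exists (partial i f'), (partial i g').
  by split; [exact: smooth_partial|exact: smooth_partial|exact: partialD].
- by exists f, g.
Qed.

Lemma smoothZ (c : R) f : smooth f -> smooth (c *: f).
Proof.
move=> sf; apply: (@smooth_stable (fun h => exists2 f', smooth f' & h = c *: f')).
- move=> _ [f' sf' ->]; split.
    by move=> x; apply: cvgZl_tmp; exact: smooth_continuous.
  by move=> i x; apply: derivableZ; exact: (smooth_derivable sf').
- move=> _ i [f' sf' ->]; exists (partial i f'); first exact: smooth_partial.
  exact: partialZ.
- by exists f.
Qed.

(** Periodicity is asked at every point, not only above the open cross-section as in [periodic]; the
    difference quotients are then periodic too, and [nice_partial] follows at once. *)
Definition nice f : Prop :=
  smooth f /\ forall x y z, f (x, y, z + 2 * L ax3) = f (x, y, z).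

Lemma nice_smooth_bar f : nice f -> smooth_bar L f.
Proof. by move=> [sf pf]; split=> // -[[x y] z] _ _; exact: pf. Qed.

Lemma niceD f g : nice f -> nice g -> nice (f + g).
Proof.
move=> [sf pf] [sg pg]; split; first exact: smoothD.
by move=> x y z; rewrite !fctE pf pg.
Qed.

Lemma niceZ (c : R) f : nice f -> nice (c *: f).
Proof.
move=> [sf pf]; split; first exact: smoothZ.
by move=> x y z; rewrite !fctE pf.
Qed.

Lemma nice_partial i f : nice f -> nice (partial i f).
Proof.
move=> [sf pf]; split; first exact: smooth_partial.
have addE (a b c d : R) : (a, b, c) + (0, 0, d) = (a, b, c + d).
  by rewrite -[LHS]/(a + 0, b + 0, c + d) !addr0.
have {}pf (a : R * R * R) : f (a + (0, 0, 2 * L ax3)) = f a.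
  by case: a => -[a b] c; rewrite addE pf.
move=> x y z; rewrite /partial /derive -addE (_ : (fun h => _) = fun h : R =>
  h^-1 *: ((f \o shift (x, y, z)) (h *: Defs.basis R i) - f (x, y, z)))//.
by apply/funext => h; rewrite /= addrA !pf.
Qed.

End Smooth.

Section TrigProducts.
Variables (R : realType) (L : 'I_3 -> R).
Hypothesis L_gt0 : forall i, 0 < L i.
Implicit Types (b : 'I_3 -> bool) (k : 'I_3 -> R) (i j : 'I_3).

Definition trig (s : bool) : R -> R := if s then sin else cos.
Definition trig_sign (s : bool) : R := if s then 1 else -1.

Lemma is_derive_trig s (c x : R) :
  is_derive x (1 : R) (fun t => trig s (c * t))
    (trig_sign s * c * trig (~~ s) (c * x)).
Proof.
have dc : is_derive x (1 : R) (fun t => c * t) c.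
  by apply: is_derive_eq; rewrite -[LHS]/(c * 1) mulr1.
case: s => /=; apply: (is_derive_eq (is_derive1_comp _ dc)); ring.
Qed.

Definition trig3 b k (x : R * R * R) : R :=
  trig (b ax1) (k ax1 * x.1.1) * trig (b ax2) (k ax2 * x.1.2) *
  trig (b ax3) (k ax3 * x.2).

Definition flip b i : 'I_3 -> bool := fun j => (j == i) (+) b j.

Lemma is_derive_of_line (F : R * R * R -> R) a i (d : R) :
  is_derive (crd a i) (1 : R) (F \o line a i) d -> is_derive a (Defs.basis R i) F d.
Proof. by case=> dF <-; split; rewrite /derivable /derive line_quotient. Qed.

Lemma is_derive_trig3 b k i a :
  is_derive a (Defs.basis R i) (trig3 b k)
    (trig_sign (b i) * k i * trig3 (flip b i) k a).
Proof.
apply: is_derive_of_line; case: a => -[x y] z.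
have dcst (c t d : R) s (A B : R) :
    is_derive t (1 : R) (fun u => A * trig s (c * u) * B)
      (A * (trig_sign s * c * trig (~~ s) (c * t)) * B).
  have := is_derive_trig s c t => H; apply: is_derive_eq; rewrite !scaler0 ?add0r ?addr0.
  by rewrite /GRing.scale/=; ring.
elim/ord3P: i; rewrite /trig3 /flip/= /comp.
- rewrite (_ : (fun t => _) = fun t => 1 * trig (b ax1) (k ax1 * t) *
     (trig (b ax2) (k ax2 * y) * trig (b ax3) (k ax3 * z))).
    by apply: is_derive_eq; [exact: dcst|rewrite /crd/=; ring].
  by apply/funext => t; rewrite line1/=; ring.
- rewrite (_ : (fun t => _) = fun t => trig (b ax1) (k ax1 * x) *
     trig (b ax2) (k ax2 * t) * trig (b ax3) (k ax3 * z)).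
    by apply: is_derive_eq; [exact: dcst|rewrite /crd/=; ring].
  by apply/funext => t; rewrite line2/=; ring.
- rewrite (_ : (fun t => _) = fun t => (trig (b ax1) (k ax1 * x) *
     trig (b ax2) (k ax2 * y)) * trig (b ax3) (k ax3 * t) * 1).
    by apply: is_derive_eq; [exact: dcst|rewrite /crd/=; ring].
  by apply/funext => t; rewrite line3/=; ring.
Qed.

Lemma partial_trig3 b k i :
  partial i (trig3 b k) = (trig_sign (b i) * k i) *: trig3 (flip b i) k.
Proof.
by apply/funext => a; apply: derive_val; exact: is_derive_trig3.
Qed.

Lemma continuous_trig3 b k : continuous (trig3 b k).
Proof.
have ctrig s : continuous (trig s).
  by case: s; [exact: continuous_sin|exact: continuous_cos].
have cf c s (h : R * R * R -> R) : continuous h -> continuous (fun x => trig s (c * h x)).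
  move=> ch x; apply: (@continuous_comp _ _ _ (fun x => c * h x) (trig s)).
    by apply: cvgM; [exact: cvg_cst|exact: ch].
  exact: ctrig.
have c1 : continuous (fun x : R * R * R => x.1.1).
  by move=> x; apply: (@continuous_comp _ _ _ fst fst); exact: cvg_fst.
have c2 : continuous (fun x : R * R * R => x.1.2).
  by move=> x; apply: (@continuous_comp _ _ _ fst snd); [exact: cvg_fst|exact: cvg_snd].
have c3 : continuous (fun x : R * R * R => x.2) by move=> x; exact: cvg_snd.
by move=> x; apply: cvgM; [apply: cvgM|]; exact: cf.
Qed.

Lemma smooth_trig3 b k : smooth (trig3 b k).
Proof.
apply: (@smooth_stable _ (fun h => exists c b', h = c *: trig3 b' k)).
- move=> _ [c [b' ->]]; split.
    by move=> x; apply: cvgZl_tmp; exact: continuous_trig3.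
  move=> i x; apply: derivableZ.
  exact: (@ex_derive _ _ _ _ _ _ _ (is_derive_trig3 b' k i x)).
- move=> _ i [c [b' ->]].
  exists (c * (trig_sign (b' i) * k i)), (flip b' i).
  apply/funext => x; rewrite /partial deriveZ.
    by rewrite -[LHS]/(c * partial i (trig3 b' k) x) partial_trig3 !fctE /GRing.scale/= mulrA.
  exact: (@ex_derive _ _ _ _ _ _ _ (is_derive_trig3 b' k i x)).
- by exists 1, b; rewrite scale1r.
Qed.

(** Integers rather than naturals: products of modes create differences of frequencies, which are
    kept with their signs. *)
Definition adm k : Prop := exists n : 'I_3 -> int, forall i, k i = (n i)%:~R * pi / L i.

Lemma trig_period s (x : R) (n : int) : trig s (x + n%:~R * (pi *+ 2)) = trig s x.
Proof.
have pos (m : nat) y : trig s (y + m%:R * (pi *+ 2)) = trig s y.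
  elim: m y => [|m IH] y; first by rewrite mul0r addr0.
  rewrite -addn1 natrD mulrDl mul1r addrA.
  by case: s IH => IH /=; rewrite ?sinD2pi ?cosD2pi; exact: IH.
case: n => m; first exact: pos.
by rewrite NegzE rmorphN mulNr -[LHS](pos m.+1) subrK.
Qed.

Lemma adm_periodic b k : adm k -> forall x y z,
  trig3 b k (x, y, z + 2 * L ax3) = trig3 b k (x, y, z).
Proof.
move=> [n kn] x y z; rewrite /trig3/=; congr (_ * _).
rewrite mulrDr -[RHS](trig_period _ _ (n ax3)); congr (trig _ (_ + _)).
by rewrite kn -mulr_natr; field; exact: lt0r_neq0.
Qed.

Lemma nice_trig3 b k : adm k -> nice L (trig3 b k).
Proof. by move=> ak; split; [exact: smooth_trig3|exact: adm_periodic]. Qed.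

Lemma adm_sin k i : adm k -> sin (k i * L i) = 0.
Proof.
move=> [n kn]; rewrite kn mulfVK ?lt0r_neq0//.
have pos (m : nat) : sin (m%:R * pi) = 0 :> R.
  elim: m => [|m IH]; first by rewrite mul0r sin0.
  by rewrite -addn1 natrD mulrDl mul1r sinDpi IH oppr0.
case: (n i) => m; first exact: pos.
rewrite NegzE rmorphN mulNr sinN; apply/eqP; rewrite oppr_eq0; apply/eqP.
exact: (pos m.+1).
Qed.

End TrigProducts.

Lemma sum3E (V : nmodType) (F : 'I_3 -> V) :
  \sum_(i < 3) F i = F ax1 + F ax2 + F ax3.
Proof.
rewrite !big_ord_recr /= big_ord0 add0r; congr (F _ + F _ + F _); exact: val_inj.
Qed.

Section RealIntegrable.
Context d (T : measurableType d) (R : realType).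
Variables (mu : {measure set T -> \bar R}) (f g h : T -> R).
Hypotheses (mf : mu.-integrable setT (EFin \o f))
  (mg : mu.-integrable setT (EFin \o g)) (mh : mu.-integrable setT (EFin \o h)).

Lemma integrable_addr : mu.-integrable setT (EFin \o (fun x => f x + g x)).
Proof. exact: (integrableD measurableT mf mg). Qed.

Lemma integrable_mull (c : R) : mu.-integrable setT (EFin \o (fun x => c * f x)).
Proof. exact: (integrableZl measurableT c mf). Qed.

Lemma Rintegral_add :
  \int[mu]_x (f x + g x) = \int[mu]_x f x + \int[mu]_x g x.
Proof. exact: (RintegralD measurableT mf mg). Qed.
End RealIntegrable.

Lemma Rintegral_add3 d (T : measurableType d) (R : realType)
    (mu : {measure set T -> \bar R}) (f g h : T -> R) :
  mu.-integrable setT (EFin \o f) -> mu.-integrable setT (EFin \o g) ->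
  mu.-integrable setT (EFin \o h) ->
  \int[mu]_x (f x + g x + h x) =
  \int[mu]_x f x + \int[mu]_x g x + \int[mu]_x h x.
Proof.
by move=> mf mg mh; rewrite Rintegral_add ?Rintegral_add//; exact: integrable_addr.
Qed.

Section GoodFields.
Variables (R : realType) (L : 'I_3 -> R).
Hypothesis L_gt0 : forall i, 0 < L i.
Notation sfield := (R * R * R -> R).
Notation vfield := ('I_3 -> R * R * R -> R).
Let mR := measurableTypeR R.
Local Notation muO := (muO L).
Local Notation cell := (cell L).
Implicit Types (f g phi : sfield) (i j : 'I_3) (u v : vfield).

Lemma smooth_measurable f : smooth f -> measurable_fun setT (f : mR * mR * mR -> R).
Proof. by move=> /smooth_continuous/continuous_measurable3. Qed.

Lemma smooth_Lfun f : smooth f -> f \in Lfun muO 2%:E.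
Proof.
move=> sf; apply: bounded_L2_muO; first exact: smooth_measurable.
exact/continuous_cell_bounded/smooth_continuous.
Qed.

Lemma smooth_integrableM f g : smooth f -> smooth g ->
  muO.-integrable setT (EFin \o (fun x => f x * g x)).
Proof. by move=> sf sg; apply: Lfun2_integrableM; exact: smooth_Lfun. Qed.

Lemma nice_L2 f : nice L f -> L2 L f.
Proof.
move=> nf; split; last exact/smooth_Lfun/(proj1 nf).
by have [] := nice_smooth_bar nf.
Qed.

Lemma green i f phi : smooth f -> smooth phi ->
  (forall x, cell x -> f (line x i (len L i)) * phi (line x i (len L i)) =
                       f (line x i 0) * phi (line x i 0)) ->
  \int[muO]_x (f x * partial i phi x) = - \int[muO]_x (partial i f x * phi x).
Proof.
move=> sf sphi ends; apply/eqP; rewrite -addr_eq0 -Rintegral_add; first last.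
- exact: (smooth_integrableM (smooth_partial i sf) sphi).
- exact: (smooth_integrableM sf (smooth_partial i sphi)).
have pE : partial i (f * phi) = (fun x => f x * partial i phi x + partial i f x * phi x).
  apply/funext => x; rewrite /partial deriveM; [|exact: smooth_derivable..].
  by rewrite /GRing.scale/= [X in _ + X]mulrC.
rewrite -pE integral_partial0//.
- move=> x; apply: derivableM; exact: smooth_derivable.
- have cf := smooth_continuous sf; have cphi := smooth_continuous sphi.
  have cdf := smooth_continuous (smooth_partial i sf).
  have cdphi := smooth_continuous (smooth_partial i sphi).
  rewrite pE => x; apply: cvgD.
    by apply: cvgM; [exact: cf|exact: cdphi].
  by apply: cvgM; [exact: cdf|exact: cphi].
Qed.

Lemma smooth_c_boundary i phi x t : smooth_c L phi -> i != ax3 ->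
  (t = 0 \/ t = L i) -> phi (line x i t) = 0.
Proof.
move=> [_ [d d0 supp]] i3 tE; apply/eqP; apply: contraT => /supp.
by case: x => -[x y] z; move: i3 tE; elim/ord3P: i => // _;
  rewrite ?line1 ?line2/= => -[] -> []; lra.
Qed.

Lemma smooth_bar_ends phi x : smooth_bar L phi -> cell x ->
  phi (line x ax3 (len L ax3)) = phi (line x ax3 0).
Proof.
case: x => -[x y] z [_ pphi] /mem_cell[/= xI yI _]; rewrite !line3.
by have := pphi (x, y, 0) xI yI; rewrite /len/= add0r.
Qed.

Lemma nice_ends f x : nice L f -> f (line x ax3 (len L ax3)) = f (line x ax3 0).
Proof.
by case: x => -[x y] z [_ /(_ x y 0)]; rewrite !line3 /len/= add0r.
Qed.

(** The boundary terms of Green's formula vanish: in the directions 1 and 2 because the test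
    function is zero near the faces, in the direction 3 by periodicity. *)
Lemma nice_weak_partial i f : nice L f -> weak_partial L i f (partial i f).
Proof.
move=> nf phi cphi; have [[sphi pphi] _] := cphi; apply: green; [exact: nf.1|exact: sphi|].
move=> x cx; have [i3|i3] := eqVneq i ax3; last first.
  rewrite !(smooth_c_boundary x cphi i3) ?mulr0//; [by left|right].
  by move: i3; elim/ord3P: i.
by rewrite i3 nice_ends// (smooth_bar_ends (conj sphi pphi)).
Qed.

Lemma nice_H1grad f : nice L f -> H1grad L f (fun i => partial i f).
Proof.
move=> nf; split; first exact: nice_L2.
by move=> i; split; [exact/nice_L2/nice_partial|exact: nice_weak_partial].
Qed.

Lemma nice_H2 f : nice L f -> H2 L f.
Proof.
move=> nf; exists (fun i => partial i f); first exact: nice_H1grad.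
by move=> i; exists (fun j => partial j (partial i f)); exact/nice_H1grad/nice_partial.
Qed.

Definition curl u : vfield :=
  fun i x => partial (i + 1) (u (i + 2)) x - partial (i + 2) (u (i + 1)) x.

(** Classical counterpart of [DA], stable under linear combinations: the divergence condition,
    impermeability and the vanishing of the tangential curl on each face hold pointwise, with no
    weak derivative or trace. *)
Definition good u : Prop :=
  [/\ forall i, nice L (u i),
      forall x, \sum_(i < 3) partial i (u i) x = 0,
      forall F p, u (face_axis F) (face_pt L F p) = 0
    & forall F p i, i != face_axis F -> curl u i (face_pt L F p) = 0].

Lemma goodD u v : good u -> good v -> good (u + v).
Proof.
move=> [nu du bu cu] [nv dv bv cv].
have pD i j : partial j ((u + v) i) = partial j (u i) + partial j (v i).
  by rewrite [(u + v) i]fctE partialD//; [exact: (nu _).1|exact: (nv _).1].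
split.
- by move=> i; exact: niceD.
- move=> x; rewrite (eq_bigr (fun i => partial i (u i) x + partial i (v i) x)).
    by rewrite big_split/= du dv addr0.
  by move=> i _; rewrite pD.
- by move=> F p; rewrite !fctE bu bv addr0.
- move=> F p i iF; rewrite /curl !pD !fctE.
  by have := cu F p i iF; have := cv F p i iF; rewrite /curl => ? ?; lra.
Qed.

Lemma goodZ c u : good u -> good (c *: u).
Proof.
move=> [nu du bu cu].
have pZ i j : partial j ((c *: u) i) = c *: partial j (u i).
  by rewrite [(c *: u) i]fctE partialZ//; exact: (nu _).1.
split.
- by move=> i; exact: niceZ.
- move=> x; rewrite (eq_bigr (fun i => c * partial i (u i) x)).
    by rewrite -mulr_sumr du mulr0.
  by move=> i _; rewrite pZ.
- by move=> F p; rewrite !fctE bu scaler0.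
- move=> F p i iF; rewrite /curl !pZ !fctE -[X in X - _]/(c * _) -[X in _ - X]/(c * _).
  by rewrite -mulrBr -/(curl u i _) cu// mulr0.
Qed.

(** Integrating by parts leaves the divergence of [u] against [phi]. Here [phi] need not vanish on
    the faces; it is the normal component of [u] that kills the boundary terms. *)
Lemma good_grad_orth u phi : good u -> smooth_bar L phi ->
  \int[muO]_x (\sum_(i < 3) u i x * partial i phi x) = 0.
Proof.
move=> [nu du bu cu] [sphi pphi].
have su i : smooth (u i) := (nu i).1.
have gi i : \int[muO]_x (u i x * partial i phi x) =
            - \int[muO]_x (partial i (u i) x * phi x).
  apply: green; [exact: su|exact: sphi|] => x cx; move: (i); apply: ord3P.
  - have := bu (false, true) (x.1.2, x.2); have := bu (false, false) (x.1.2, x.2).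
    by case: x {cx} => -[x y] z; rewrite /face_pt/= !line1 /len/= => -> ->; rewrite !mul0r.
  - have := bu (true, true) (x.1.1, x.2); have := bu (true, false) (x.1.1, x.2).
    by case: x {cx} => -[x y] z; rewrite /face_pt/= !line2 /len/= => -> ->; rewrite !mul0r.
  - by rewrite nice_ends// (smooth_bar_ends (conj sphi pphi)).
have iu i := smooth_integrableM (su i) (smooth_partial i sphi).
have idu i := smooth_integrableM (smooth_partial i (su i)) sphi.
under eq_Rintegral do rewrite sum3E.
apply: etrans (Rintegral_add3 (iu ax1) (iu ax2) (iu ax3)) _.
pose I i := \int[muO]_x (partial i (u i) x * phi x).
transitivity (- I ax1 + - I ax2 + - I ax3).
  by congr (_ + _ + _); [exact: (gi ax1)|exact: (gi ax2)|exact: (gi ax3)].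
suff I0 : I ax1 + I ax2 + I ax3 = 0 by rewrite -!opprD I0 oppr0.
apply: etrans (esym (Rintegral_add3 (idu ax1) (idu ax2) (idu ax3))) _.
rewrite [X in Rintegral _ _ X](_ : _ = cst 0); last first.
  by apply/funext => x /=; rewrite -!mulrDl; have := du x; rewrite sum3E => ->; rewrite mul0r.
by rewrite /Rintegral integral0.
Qed.

Lemma good_H u : good u -> H L u.
Proof.
move=> gu; have [nu du bu cu] := gu; split; first by move=> i; exact: nice_L2.
  move=> phi [sphi _]; rewrite good_grad_orth//.
  under [in RHS]eq_Rintegral do rewrite mul0r.
  by rewrite /Rintegral integral0 oppr0.
move=> phi sphi; rewrite /normal_trace -[RHS](good_grad_orth gu sphi).
by apply: eq_Rintegral => x _ /=; rewrite mul0r addr0.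
Qed.

Lemma measurable_face_pt F :
  measurable_fun setT (face_pt L F : mR * mR -> mR * mR * mR).
Proof.
case: F => -[] s; rewrite /face_pt/=; do ?apply: measurable_fun_pair => //.
Qed.

Lemma face_dom_fin F : (((@lebesgue_measure R) \x (@lebesgue_measure R))%E (face_dom L F) < +oo)%E.
Proof.
case: F => -[] s; rewrite /face_dom product_measure1E//= !lebesgue_measure_itv/= !lte_fin.
all: by do 2 case: ifPn => _; rewrite ?mul0e ?mule0 -?EFinB -?EFinM ltry.
Qed.

Lemma nice_trace F f : nice L f -> is_trace L F f (f \o face_pt L F).
Proof.
move=> nf; have cf := smooth_continuous nf.1; split.
  have [M fM] := continuous_closed_cell_bounded L cf.
  apply: (@bounded_Lfun2_mrestr _ _ _ _ _ _ _ M (face_dom_fin F)).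
    apply: measurableT_comp; first exact: smooth_measurable nf.1.
    exact: measurable_face_pt.
  move=> [p q]; case: F => -[] s; rewrite /face_dom/= !in_itv/= => -[pI qI];
    apply: fM; rewrite /face_pt/=; try lra; case: s; rewrite ?lexx ?ltW//.
(* A smooth function is its own approximation: the constant sequence has error zero in all three
   limits. *)
exists (fun i => partial i f), (fun=> f).
have int0 d (T : measurableType d) (mu : {measure set T -> \bar R}) (g : T -> R) :
    (fun _ : nat => \int[mu]_x ((g x - g x) ^+ 2)) @ \oo --> (0 : R).
  under eq_fun do under eq_Rintegral do rewrite subrr expr0n/=.
  by rewrite /Rintegral integral0; exact: cvg_cst.
split=> [||||]; first exact: nice_H1grad.
- by move=> _; exact: nice_smooth_bar.
- exact: int0.
- by move=> i; exact: int0.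
- exact: int0.
Qed.

Lemma good_DA u : good u -> DA L u.
Proof.
move=> gu; have [nu du bu cu] := gu; split; last exists (curl u).
- by move=> i; exact: nice_H2.
- exact: good_H.
- by exists (fun i j => partial j (u i)) => // i; exact: nice_H1grad.
move=> F; exists (fun i => curl u i \o face_pt L F) => i.
  apply: nice_trace; rewrite /curl.
  rewrite (_ : (fun _ => _) = partial (i + 1) (u (i + 2)) + (-1) *: partial (i + 2) (u (i + 1))).
    by apply: niceD; [|apply: niceZ]; exact: nice_partial.
  by apply/funext => x; rewrite !fctE scaleN1r.
apply: aeW => p; rewrite sum3E.
(* For [i] normal to the face, removing the normal part of the curl leaves nothing; for [i]
   tangential, the curl itself vanishes there by [good]. *)
have [iF|iF] := eqVneq i (face_axis F); last first.
  by rewrite /= (cu F p i iF) /outward_normal (negbTE iF) mulr0 subr0.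
rewrite iF /= /outward_normal eqxx; case: F {i iF} => -[] [] /=; ring.
Qed.

End GoodFields.

(** * Modes *)

Section Modes.
Variables (R : realType) (L : 'I_3 -> R).
Hypothesis L_gt0 : forall i, 0 < L i.
Notation sfield := (R * R * R -> R).
Notation vfield := ('I_3 -> R * R * R -> R).
Implicit Types (z : bool) (k m n w a b : 'I_3 -> R) (i j : 'I_3) (u v : vfield).
Local Notation adm := (adm L).

Definition parity z i : 'I_3 -> bool := fun j => (j == i) (+) (z && (j == ax3)).
Definition msign z i : R := if z && (i == ax3) then -1 else 1.

(* [mode false] is the family Y and [mode true] the family Z, with real
   frequencies k_i pi / L_i in place of the integers k_i. *)
Definition mode z k w : vfield :=
  fun i x => msign z i * w i * trig3 (parity z i) k x.

(** The scalar attached to the family [z] at frequency [k]: the divergence of [mode z k w] is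
    [dot w k] times it, and its gradient is minus the mode of amplitude [k]. It is thus the
    potential of the part removed by the Leray projection. *)
Definition pot z k : sfield := trig3 (fun j => z && (j == ax3)) k.

Definition dot a b : R := \sum_(i < 3) a i * b i.

Lemma dotE a b : dot a b = a ax1 * b ax1 + a ax2 * b ax2 + a ax3 * b ax3.
Proof. exact: sum3E. Qed.

Lemma eq_trig3 (b1 b2 : 'I_3 -> bool) k : b1 =1 b2 -> trig3 b1 k = trig3 b2 k.
Proof. by move=> /funext ->. Qed.

Lemma modeE z k w i : mode z k w i = (msign z i * w i) *: trig3 (parity z i) k.
Proof. by apply/funext. Qed.

Lemma partial_mode z k w i j :
  partial j (mode z k w i) =
  (msign z i * w i * (trig_sign R (parity z i j) * k j)) *: trig3 (flip (parity z i) j) k.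
Proof.
rewrite modeE partialZ ?partial_trig3 ?scalerA//; exact: smooth_trig3.
Qed.

Lemma partial_mode_diag z k w i : partial i (mode z k w i) = (w i * k i) *: pot z k.
Proof.
rewrite partial_mode (@eq_trig3 _ (fun j => z && (j == ax3))); last first.
  by move=> j; rewrite /flip /parity; case: (j == i) => //=; rewrite negbK.
congr (_ *: _); rewrite /msign /parity eqxx /=.
by case: (z && _) => /=; ring.
Qed.

Lemma grad_pot z k i : partial i (pot z k) = (-1) *: mode z k k i.
Proof.
rewrite modeE partial_trig3 scalerA; congr (_ *: _).
by rewrite /msign; case: (z && _) => /=; ring.
Qed.

Lemma smooth_pot z k : smooth (pot z k).
Proof. exact: smooth_trig3. Qed.

Lemma nice_mode z k w i : adm k -> nice L (mode z k w i).
Proof. by move=> ak; rewrite modeE; apply: niceZ; exact: nice_trig3. Qed.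

Lemma trig3_face0 (b : 'I_3 -> bool) k F p : adm k -> b (face_axis F) = true ->
  trig3 b k (face_pt L F p) = 0.
Proof.
move=> ak; have s0 := adm_sin L_gt0 _ ak.
by case: F => -[] [] /=; rewrite /trig3 /face_pt/= => ->;
  rewrite /trig ?s0 ?mulr0 ?sin0 ?mul0r ?mulr0 ?mul0r.
Qed.

(** On a lateral face every sine in the normal direction has an argument in pi Z, by [adm]. Such a
    sine occurs in the normal component of the mode and in both terms of each tangential component
    of its curl. *)
Lemma good_mode z k w : adm k -> dot w k = 0 -> good L (mode z k w).
Proof.
move=> ak wk; split.
- by move=> i; exact: nice_mode.
- move=> x; rewrite (eq_bigr (fun i => w i * k i * pot z k x)).
    by rewrite -mulr_suml -/(dot w k) wk mul0r.
  by move=> i _; rewrite partial_mode_diag.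
- move=> F p; rewrite modeE fctE trig3_face0 ?scaler0//.
  by case: F => -[] [] /=; rewrite /parity/= andbF.
- move=> F p i iF; rewrite /curl !partial_mode !fctE.
  (* The [i]-th curl component differentiates the component [l] in the direction [j], with i, j, l
     distinct. The normal axis differs from [i]: if it is [l] the sine is untouched, if it is [j] a
     cosine has been differentiated. *)
  suff par j l : j != l -> i != j -> i != l ->
      flip (parity z l) j (face_axis F) = true.
    by rewrite !trig3_face0 ?scaler0 ?subr0//; apply: par;
      move: (i); apply: ord3P.
  move=> jl ij il; rewrite /flip /parity.
  have -> : z && (face_axis F == ax3) = false by case: F {iF} => -[] [] /=; rewrite andbF.
  by move: iF jl ij il; case: F => -[] [] /=; elim/ord3P: i; elim/ord3P: j; elim/ord3P: l.
Qed.

Definition advect u v : vfield := fun i x => \sum_(j < 3) u j x * partial j (v i) x.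

Definition signs : seq (bool * bool * bool) :=
  [:: (false, false, false); (false, false, true); (false, true, false);
      (false, true, true); (true, false, false); (true, false, true);
      (true, true, false); (true, true, true)].

Definition rho (r : bool * bool * bool) : 'I_3 -> R :=
  vec3 (if r.1.1 then -1 else 1) (if r.1.2 then -1 else 1) (if r.2 then -1 else 1).

Definition hmul a b : 'I_3 -> R := fun i => a i * b i.

(** Sign in the product-to-sum formula for the third direction: [trig z a * trig z' b] is half the
    sum over r_3 = 1, -1 of this sign times [trig (z (+) z') (a + r_3 b)]. *)
Definition csign z z' (r : 'I_3 -> R) : R :=
  if z' then (if z then - r ax3 else r ax3) else 1.

(** The eight sign vectors come from product-to-sum in each of three directions. A sign vector acts
    on [n] and on [b] together because reflecting both leaves a mode unchanged up to sign, as in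
    [mode_refl]. *)
Lemma advect_mode z z' m n a b i x :
  advect (mode z m a) (mode z' n b) i x =
  \sum_(r <- signs) 8^-1 * csign z z' (rho r) *
     mode (z (+) z') (m + hmul (rho r) n)
       (dot a (hmul (rho r) n) *: hmul (rho r) b) i x.
Proof.
have cP (s t y : R) : cos ((s + 1 * t) * y) = cos (s * y) * cos (t * y) - sin (s * y) * sin (t * y).
  by rewrite mul1r mulrDl cosD.
have cM (s t y : R) : cos ((s + -1 * t) * y) = cos (s * y) * cos (t * y) + sin (s * y) * sin (t * y).
  by rewrite mulN1r mulrBl cosB.
have sP (s t y : R) : sin ((s + 1 * t) * y) = sin (s * y) * cos (t * y) + cos (s * y) * sin (t * y).
  by rewrite mul1r mulrDl sinD.
have sM (s t y : R) : sin ((s + -1 * t) * y) = sin (s * y) * cos (t * y) - cos (s * y) * sin (t * y).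
  by rewrite mulN1r mulrBl sinB.
rewrite /advect sum3E !partial_mode !fctE /GRing.scale /signs !big_cons big_nil.
rewrite /mode /trig3 /hmul /flip /parity /msign !dotE !fctE /hmul /csign /GRing.scale.
case: x => -[x y] t.
elim/ord3P: i; case: z; case: z'; rewrite /= /trig_sign /rho /vec3/= /GRing.scale /= !(cP, cM, sP, sM).
(* After the addition formulas only sines and cosines of single arguments remain; with these
   generalised the claim is a polynomial identity. *)
all: move: (cos _) (cos _) (cos _) (cos _) (cos _) (cos _) (sin _) (sin _) (sin _) (sin _) (sin _) (sin _) => *.
all: field.
all: by [].
Qed.

(** For [k = 0] this is the identity, division by zero being 0; hence [dot_perp_proj] and
    [mode_decomp] also cover the zero frequency. *)
Definition perp_proj k w : 'I_3 -> R := w - (dot w k / dot k k) *: k.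

Lemma dotDl a b k : dot (a + b) k = dot a k + dot b k.
Proof. by rewrite !dotE !fctE; ring. Qed.

Lemma dotZl (c : R) a k : dot (c *: a) k = c * dot a k.
Proof. by rewrite !dotE !fctE /GRing.scale/=; ring. Qed.

Lemma dot_eq0 k : dot k k = 0 -> k = 0.
Proof.
rewrite dotE => kk; apply/funext => i; rewrite [RHS]/(0 : R).
suff : [/\ k ax1 = 0, k ax2 = 0 & k ax3 = 0] by case; move: i; apply: ord3P.
split; nra.
Qed.

Lemma dotr0 w : dot w 0 = 0.
Proof. by apply: big1 => i _; exact: mulr0. Qed.

Lemma dot_perp_proj k w : dot (perp_proj k w) k = 0.
Proof.
have [kk|kk] := eqVneq (dot k k) 0.
  by rewrite (dot_eq0 kk) dotr0.
by rewrite dotDl -scaleNr dotZl mulNr divfK// subrr.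
Qed.

Lemma modeD z k w1 w2 : mode z k (w1 + w2) = mode z k w1 + mode z k w2.
Proof. by apply/funext => i; apply/funext => x; rewrite /mode !fctE; ring. Qed.

Lemma modeZ z k (c : R) w : mode z k (c *: w) = c *: mode z k w.
Proof. by apply/funext => i; apply/funext => x; rewrite /mode !fctE /GRing.scale/=; ring. Qed.

Definition grad (phi : sfield) : vfield := fun i => partial i phi.

Lemma mode_decomp z k w :
  mode z k w = mode z k (perp_proj k w) + grad ((- (dot w k / dot k k)) *: pot z k).
Proof.
have -> : grad ((- (dot w k / dot k k)) *: pot z k) = (dot w k / dot k k) *: mode z k k.
  apply/funext => i; rewrite /grad partialZ ?grad_pot; last exact: smooth_pot.
  by rewrite scalerA mulrN1 opprK.
by rewrite /perp_proj modeD -scaleNr modeZ scaleNr addrNK.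
Qed.

Lemma adm0 : adm 0.
Proof. by exists (fun=> 0) => i; rewrite mul0r mul0r. Qed.

Lemma grad_sum_decomp (I : Type) (s : seq I) (z : I -> bool) (c : I -> R)
    (k w : I -> 'I_3 -> R) : (forall r, adm (k r)) ->
  good L (\sum_(r <- s) c r *: mode (z r) (k r) (perp_proj (k r) (w r))) /\
  exists2 phi, nice L phi &
    \sum_(r <- s) c r *: mode (z r) (k r) (w r) =
    \sum_(r <- s) c r *: mode (z r) (k r) (perp_proj (k r) (w r)) + grad phi.
Proof.
move=> ak.
have npot r : nice L (pot (z r) (k r)) by exact: nice_trig3.
elim: s => [|r s [gs [phi nphi Ephi]]].
  rewrite !big_nil; split.
    rewrite -(scale0r (mode false 0 0)); apply: goodZ; apply: good_mode; [exact: adm0|exact: dotr0].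
  exists (0 *: pot false 0).
    by apply: niceZ; apply: nice_trig3 => //; exact: adm0.
  rewrite add0r; apply/funext => i; rewrite /grad partialZ ?scale0r//; exact: smooth_pot.
rewrite !big_cons Ephi; split.
  by apply: goodD => //; apply: goodZ; apply: good_mode; [exact: ak|exact: dot_perp_proj].
exists (c r *: ((- (dot (w r) (k r) / dot (k r) (k r))) *: pot (z r) (k r)) + phi).
  by apply: niceD => //; do 2 apply: niceZ; exact: npot.
rewrite {1}mode_decomp scalerDr -!addrA; congr (_ + _).
rewrite addrCA; congr (_ + _); apply/funext => i.
rewrite /grad partialD; first last.
- exact: nphi.1.
- by do 2 apply: smoothZ; exact: smooth_pot.
by rewrite [in RHS]partialZ//; apply: smoothZ; exact: smooth_pot.
Qed.

Lemma grad_orth_H h phi : H L h -> nice L phi -> dotL2 L h (grad phi) = 0.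
Proof.
move=> [L2h _ /(_ _ (nice_smooth_bar _))] H0 nphi; rewrite -(H0 _ nphi) /normal_trace /dotL2 sum3E.
have ih i : (muO L).-integrable setT (EFin \o (fun x => h i x * partial i phi x)).
  apply: Lfun2_integrableM; first exact: (L2h i).2.
  by apply: smooth_Lfun; apply: smooth_partial; exact: nphi.1.
apply/esym; under eq_Rintegral do rewrite sum3E mul0r addr0.
exact: (Rintegral_add3 (ih ax1) (ih ax2) (ih ax3)).
Qed.

Lemma nice_leray u phi : good L u -> nice L phi -> is_leray L (u + grad phi) u.
Proof.
move=> gu nphi; have nu : forall i, nice L (u i) by case: gu.
split.
- by move=> i; apply: nice_L2 => //; apply: niceD => //; exact: nice_partial.
- exact: good_H.
move=> h Hh; rewrite -(grad_orth_H Hh nphi); apply: eq_bigr => i _.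
by apply: eq_Rintegral => x _; rewrite [u + _]addrC addrK mulrC.
Qed.

Definition Bcoef z z' r : R := 8^-1 * csign z z' (rho r).
Definition Bfreq m n r : 'I_3 -> R := m + hmul (rho r) n.
Definition Bamp a n b r : 'I_3 -> R := dot a (hmul (rho r) n) *: hmul (rho r) b.

(** A representative of B for two arbitrary modes. It serves the side condition that B(a,a) and
    B(b,b) exist in H; the brackets themselves are computed from shorter expansions, in which
    coinciding frequencies are merged. *)
Definition modeB z z' m a n b : vfield :=
  \sum_(r <- signs) Bcoef z z' r *:
    mode (z (+) z') (Bfreq m n r) (perp_proj (Bfreq m n r) (Bamp a n b r)).

Lemma adm_Bfreq m n r : adm m -> adm n -> adm (Bfreq m n r).
Proof.
move=> [p mp] [q nq].
pose e : 'I_3 -> int := fun i =>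
  vec3 (if r.1.1 then -1 else 1) (if r.1.2 then -1 else 1) (if r.2 then -1 else 1) i.
have eE i : (e i)%:~R = rho r i.
  have sE (s : bool) : (if s then -1 else 1 : int)%:~R = (if s then -1 else 1) :> R by case: s.
  by move: i; apply: ord3P; exact: sE.
exists (fun i => p i + e i * q i) => i.
by rewrite /Bfreq fctE /hmul mp nq rmorphD rmorphM/= eE; ring.
Qed.

Lemma is_B_mode z z' m a n b : adm m -> adm n ->
  good L (modeB z z' m a n b) /\ is_B L (mode z m a) (mode z' n b) (modeB z z' m a n b).
Proof.
move=> am an.
have [gW [phi nphi Ephi]] := grad_sum_decomp signs (fun=> z (+) z') (Bcoef z z')
   (Bamp a n b) (fun r => adm_Bfreq r am an).
split=> //; exists (advect (mode z m a) (mode z' n b)).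
  by exists (fun i j => partial j (mode z' n b i)) => // i; apply: nice_H1grad => //; exact: nice_mode.
rewrite (_ : advect _ _ = modeB z z' m a n b + grad phi); first exact: nice_leray.
rewrite -Ephi; apply/funext => i; apply/funext => x; rewrite advect_mode.
by rewrite /signs !big_cons !big_nil !fctE.
Qed.

End Modes.

(** * Reached modes *)

Section LinearSpan.
Variables (R : realType) (V : lmodType R).
Implicit Types (S : set V) (u v : V).

Lemma lspan_sub S u : S u -> lspan S u.
Proof.
by move=> Su; exists 1%N, (fun=> 1), (fun=> u); split=> //; rewrite big_ord1 scale1r.
Qed.

Lemma lspan0 S : lspan S 0.
Proof.
exists 0%N, (fun=> 0), (fun=> 0); split; last by rewrite big_ord0.
by case.
Qed.

Lemma lspanD S u v : lspan S u -> lspan S v -> lspan S (u + v).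
Proof.
move=> [n [c [a [Sa ->]]]] [n' [c' [a' [Sa' ->]]]].
exists (n + n')%N, (fun i => match fintype.split i with inl j => c j | inr j => c' j end),
  (fun i => match fintype.split i with inl j => a j | inr j => a' j end).
split; first by move=> i; case: (fintype.split i).
rewrite big_split_ord/=; congr (_ + _); apply: eq_bigr => i _.
  by rewrite -[lshift _ i]/(fintype.unsplit (inl i)) fintype.unsplitK.
by rewrite -[rshift _ i]/(fintype.unsplit (inr i)) fintype.unsplitK.
Qed.

Lemma lspanZ S (t : R) u : lspan S u -> lspan S (t *: u).
Proof.
move=> [n [c [a [Sa ->]]]]; exists n, (fun i => t * c i), a; split => //.
by rewrite scaler_sumr; apply: eq_bigr => i _; rewrite scalerA.
Qed.

Lemma lspan_min S (P : V -> Prop) : P 0 -> (forall u v, P u -> P v -> P (u + v)) ->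
  (forall (t : R) u, P u -> P (t *: u)) -> (forall u, S u -> P u) ->
  forall u, lspan S u -> P u.
Proof.
move=> P0 PD PZ PS _ [n [c [a [Sa ->]]]].
by elim/big_ind: _ => // i _; apply: PZ; exact: PS.
Qed.

Lemma lspan_mono S S' : S `<=` S' -> lspan S `<=` lspan S'.
Proof.
by move=> SS' u; apply: lspan_min; [exact: lspan0|exact: lspanD|exact: lspanZ|
  by move=> ? /SS'; exact: lspan_sub].
Qed.

End LinearSpan.

Section Reach.
Variables (R : realType) (L : 'I_3 -> R).
Hypothesis L_gt0 : forall i, 0 < L i.
Notation vfield := ('I_3 -> R * R * R -> R).
Variable C : set vfield.
Implicit Types (u v w : vfield) (E : set vfield).

Definition sat_pairs E (w : vfield) : Prop :=
  exists a b, [/\ C a, E b,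
     exists p q, [/\ is_B L a a p, is_B L b b q, H L p & H L q]
   & is_symB L a b w].

(* [Gseq] with the new directions restricted to good fields, so that each
   [Kseq j] is a linear space without discussing closure properties of [DA]. *)
Fixpoint Kseq (j : nat) : set vfield :=
  if j is j'.+1 then
    [set u + v | u in Kseq j' & v in lspan (sat_pairs (Kseq j') `&` good L)]
  else lspan C.

Lemma good0 : good L 0.
Proof.
rewrite -(scale0r (mode false 0 0)); apply: goodZ; apply: good_mode => //.
- exact: adm0.
- exact: dotr0.
Qed.

Lemma Kseq_Gseq j : Kseq j `<=` Gseq L C j.
Proof.
elim: j => [//|j IH] _ [u Ku [v Sv <-]]; exists u; first exact: IH.
exists v => //; split; last first.
  apply: good_DA => //; move: Sv; apply: lspan_min; [exact: good0|exact: goodD|exact: goodZ|].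
  by move=> w [].
move: Sv; apply: lspan_mono => w [[a [b [Ca Kb pq sym]]] _].
by exists a, b; split => //; exact: IH.
Qed.

Lemma KseqD j u v : Kseq j u -> Kseq j v -> Kseq j (u + v).
Proof.
elim: j u v => [|j IH] u v; first exact: lspanD.
move=> [u1 Ku1 [v1 Sv1 <-]] [u2 Ku2 [v2 Sv2 <-]].
exists (u1 + u2); first exact: IH.
by exists (v1 + v2); [exact: lspanD|rewrite addrACA].
Qed.

Lemma KseqZ j (t : R) u : Kseq j u -> Kseq j (t *: u).
Proof.
elim: j u => [|j IH] u; first exact: lspanZ.
move=> [u1 Ku1 [v1 Sv1 <-]].
exists (t *: u1); first exact: IH.
by exists (t *: v1); [exact: lspanZ|rewrite scalerDr].
Qed.

Lemma Kseq_leq i j : (i <= j)%N -> Kseq i `<=` Kseq j.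
Proof.
move=> /subnK <-; elim: (j - i)%N => [//|d IH] u /IH Ku.
by exists u => //; exists 0; [exact: lspan0|rewrite addr0].
Qed.

Definition reach u : Prop := exists j, Kseq j u.

Lemma reach_Gseq u : reach u -> (\bigcup_j Gseq L C j) u.
Proof. by move=> [j /Kseq_Gseq]; exists j. Qed.

Lemma reach_C u : C u -> reach u.
Proof. by exists 0%N; exact: lspan_sub. Qed.

Lemma reach0 : reach 0.
Proof. by exists 0%N; exact: lspan0. Qed.

Lemma reachD u v : reach u -> reach v -> reach (u + v).
Proof.
move=> [i Ku] [j Kv]; exists (maxn i j); apply: KseqD.
  by move: Ku; apply: Kseq_leq; exact: leq_maxl.
by move: Kv; apply: Kseq_leq; exact: leq_maxr.
Qed.

Lemma reachZ (t : R) u : reach u -> reach (t *: u).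
Proof. by move=> [j Ku]; exists j; exact: KseqZ. Qed.

Lemma reachZK (t : R) u : t != 0 -> reach (t *: u) -> reach u.
Proof. by move=> t0 /(reachZ t^-1); rewrite scalerA mulVf// scale1r. Qed.

Lemma reachBr u v : reach (u + v) -> reach v -> reach u.
Proof. by move=> uv /(reachZ (-1)) /(reachD uv); rewrite scaleN1r addrK. Qed.

Local Notation adm := (adm L).

Lemma is_B_list (I : Type) (s : seq I) (z : bool) (c : I -> R)
    (k w : I -> 'I_3 -> R) u v : (forall r, adm (k r)) ->
  (forall i, nice L (v i)) ->
  advect u v = \sum_(r <- s) c r *: mode z (k r) (w r) ->
  is_B L u v (\sum_(r <- s) c r *: mode z (k r) (perp_proj (k r) (w r))).
Proof.
move=> ak nv Ecv.
have [gW [phi nphi Ephi]] := grad_sum_decomp L_gt0 s (fun=> z) c w ak.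
exists (advect u v).
  by exists (fun i j => partial j (v i)) => // i; exact: nice_H1grad.
by rewrite Ecv Ephi; exact: nice_leray.
Qed.

Lemma advectZl (t : R) u v : advect (t *: u) v = t *: advect u v.
Proof.
apply/funext => i; apply/funext => x.
rewrite -[RHS]/(t * \sum_(j < 3) u j x * partial j (v i) x) mulr_sumr.
by apply: eq_bigr => j _; rewrite -[(t *: u) j x]/(t * u j x) mulrA.
Qed.

Lemma advectZr (t : R) u v : (forall i, smooth (v i)) ->
  advect u (t *: v) = t *: advect u v.
Proof.
move=> sv; apply/funext => i; apply/funext => x.
rewrite -[RHS]/(t * \sum_(j < 3) u j x * partial j (v i) x) mulr_sumr.
apply: eq_bigr => j _; rewrite -[(t *: v) i]/(t *: v i) partialZ//.
by rewrite -[(_ *: _) x]/(t * partial j (v i) x) mulrCA.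
Qed.

Lemma perp_projD (k w w' : 'I_3 -> R) : perp_proj k (w + w') = perp_proj k w + perp_proj k w'.
Proof. by rewrite /perp_proj dotDl mulrDl scalerDl opprD addrACA. Qed.

Lemma perp_projZ (k : 'I_3 -> R) (c : R) (w : 'I_3 -> R) : perp_proj k (c *: w) = c *: perp_proj k w.
Proof. by rewrite /perp_proj dotZl scalerBr scalerA mulrA. Qed.

(** Both orders of advection are expanded over the same frequencies and coefficients, so the
    projected amplitudes simply add. The factor [t] absorbs the freedom in the choice of the
    generator: its amplitude is only known up to a nonzero multiple. *)
Lemma reach_symB (I : Type) (s : seq I) z1 z2 z (c : I -> R)
    (k w w' : I -> 'I_3 -> R) m a n b (t : R) :
  adm m -> adm n -> (forall r, adm (k r)) -> t != 0 ->
  C (mode z1 m (t *: a)) -> reach (mode z2 n b) ->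
  advect (mode z1 m a) (mode z2 n b) = \sum_(r <- s) c r *: mode z (k r) (w r) ->
  advect (mode z2 n b) (mode z1 m a) = \sum_(r <- s) c r *: mode z (k r) (w' r) ->
  reach (\sum_(r <- s) c r *: mode z (k r) (perp_proj (k r) (w r + w' r))).
Proof.
move=> am an ak t0 Ca [j Kb] E1 E2; apply: (reachZK t0).
set W := (X in reach (_ *: X)).
have sm : forall i, smooth (mode z1 m a i) by move=> i; exact: (nice_mode L_gt0 z1 a i am).1.
have B1 : is_B L (mode z1 m (t *: a)) (mode z2 n b)
    (\sum_(r <- s) (t * c r) *: mode z (k r) (perp_proj (k r) (w r))).
  apply: is_B_list => //; first by move=> i; exact: nice_mode.
  by rewrite modeZ advectZl E1 scaler_sumr; apply: eq_bigr => r _; rewrite scalerA.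
have B2 : is_B L (mode z2 n b) (mode z1 m (t *: a))
    (\sum_(r <- s) (t * c r) *: mode z (k r) (perp_proj (k r) (w' r))).
  apply: is_B_list => //; first by move=> i; exact: nice_mode.
  by rewrite modeZ advectZr// E2 scaler_sumr; apply: eq_bigr => r _; rewrite scalerA.
have EW : t *: W = \sum_(r <- s) (t * c r) *: mode z (k r) (perp_proj (k r) (w r)) +
                   \sum_(r <- s) (t * c r) *: mode z (k r) (perp_proj (k r) (w' r)).
  rewrite /W scaler_sumr -big_split/=; apply: eq_bigr => r _.
  by rewrite perp_projD modeD scalerA scalerDr.
exists j.+1, 0; first by rewrite -(scale0r (mode z2 n b)); exact: KseqZ.
exists (t *: W); last by rewrite add0r.
apply: lspan_sub; split; last first.
  by apply: goodZ; exact: (grad_sum_decomp L_gt0 s (fun=> z) c _ ak).1.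
exists (mode z1 m (t *: a)), (mode z2 n b); split => //.
  have [g1 H1] := is_B_mode L_gt0 z1 z1 (t *: a) (t *: a) am am.
  have [g2 H2] := is_B_mode L_gt0 z2 z2 b b an an.
  by exists (modeB z1 z1 m (t *: a) m (t *: a)), (modeB z2 z2 n b n b); split => //; exact: good_H.
by exists (\sum_(r <- s) (t * c r) *: mode z (k r) (perp_proj (k r) (w r))),
  (\sum_(r <- s) (t * c r) *: mode z (k r) (perp_proj (k r) (w' r))).
Qed.

End Reach.

(** * Advection by the constant field, the shears and the plane modes *)

Section Products.
Variable R : realType.

Definition sg (s : bool) : R := if s then -1 else 1.

Let cosP (s t y : R) : cos ((s + 1 * t) * y) = cos (s * y) * cos (t * y) - sin (s * y) * sin (t * y).
Proof. by rewrite mul1r mulrDl cosD. Qed.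
Let cosM (s t y : R) : cos ((s + -1 * t) * y) = cos (s * y) * cos (t * y) + sin (s * y) * sin (t * y).
Proof. by rewrite mulN1r mulrBl cosB. Qed.
Let sinP (s t y : R) : sin ((s + 1 * t) * y) = sin (s * y) * cos (t * y) + cos (s * y) * sin (t * y).
Proof. by rewrite mul1r mulrDl sinD. Qed.
Let sinM (s t y : R) : sin ((s + -1 * t) * y) = sin (s * y) * cos (t * y) - cos (s * y) * sin (t * y).
Proof. by rewrite mulN1r mulrBl sinB. Qed.
Let cos0y (y : R) : cos (0 * y) = 1. Proof. by rewrite mul0r cos0. Qed.
Let sin0y (y : R) : sin (0 * y) = 0. Proof. by rewrite mul0r sin0. Qed.

Ltac expand_trig :=
  let i := fresh "i" in let x := fresh "x" in let y := fresh "y" in let t := fresh "t" in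
  apply/funext => i; apply/funext => -[[x y] t];
  rewrite !big_cons big_nil addr0 !fctE /advect sum3E !partial_mode;
  rewrite /mode /trig3 /flip /parity /msign !fctE /GRing.scale /sg;
  elim/ord3P: i; rewrite /= /trig_sign /vec3/= /GRing.scale /= !(cosP, cosM, sinP, sinM, cos0y, sin0y);
  rewrite /trig;
  field; by [].

Lemma advect_translation z (n b : 'I_3 -> R) :
  advect (mode true (fun=> 0) (vec3 0 0 1)) (mode z n b) =
  \sum_(r <- [:: tt]) (if z then - n ax3 else n ax3) *: mode (~~ z) n b.
Proof. case: z; expand_trig. Qed.

(** Both sides are zero; the right one is written over the same one-term list as in
    [advect_translation], with amplitude 0, to fit [reach_symB]. *)
Lemma advect_to_translation z (n b : 'I_3 -> R) :
  advect (mode z n b) (mode true (fun=> 0) (vec3 0 0 1)) =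
  \sum_(r <- [:: tt]) (if z then - n ax3 else n ax3) *: mode (~~ z) n (fun=> 0).
Proof. case: z; expand_trig. Qed.

Lemma advect_shear1 (m : R) (n b : 'I_3 -> R) :
  advect (mode true (vec3 m 0 0) (vec3 0 0 1)) (mode false n b) =
  \sum_(r <- [:: false; true]) 2^-1 *: mode true (vec3 (m + sg r * n ax1) (n ax2) (n ax3))
     (vec3 (sg r * n ax3 * b ax1) (n ax3 * b ax2) (n ax3 * b ax3)).
Proof. expand_trig. Qed.

Lemma advect_to_shear1 (m : R) (n b : 'I_3 -> R) :
  advect (mode false n b) (mode true (vec3 m 0 0) (vec3 0 0 1)) =
  \sum_(r <- [:: false; true]) 2^-1 *: mode true (vec3 (m + sg r * n ax1) (n ax2) (n ax3))
     (vec3 0 0 (sg r * b ax1 * m)).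
Proof. expand_trig. Qed.

Lemma advect_shear2 (m : R) (n b : 'I_3 -> R) :
  advect (mode true (vec3 0 m 0) (vec3 0 0 1)) (mode false n b) =
  \sum_(r <- [:: false; true]) 2^-1 *: mode true (vec3 (n ax1) (m + sg r * n ax2) (n ax3))
     (vec3 (n ax3 * b ax1) (sg r * n ax3 * b ax2) (n ax3 * b ax3)).
Proof. expand_trig. Qed.

Lemma advect_to_shear2 (m : R) (n b : 'I_3 -> R) :
  advect (mode false n b) (mode true (vec3 0 m 0) (vec3 0 0 1)) =
  \sum_(r <- [:: false; true]) 2^-1 *: mode true (vec3 (n ax1) (m + sg r * n ax2) (n ax3))
     (vec3 0 0 (sg r * b ax2 * m)).
Proof. expand_trig. Qed.

Definition signs2 : seq (bool * bool) :=
  [:: (false, false); (true, false); (false, true); (true, true)].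
Definition csg (z : bool) (r : bool * bool) : R := 4^-1 * (if z then sg r.2 else 1).

Definition freq13 (m1 m3 : R) (n : 'I_3 -> R) (r : bool * bool) : 'I_3 -> R :=
  vec3 (m1 + sg r.1 * n ax1) (n ax2) (m3 + sg r.2 * n ax3).

Lemma advect_plane13 z (m1 m3 a1 a3 : R) (n b : 'I_3 -> R) :
  advect (mode false (vec3 m1 0 m3) (vec3 a1 0 a3)) (mode z n b) =
  \sum_(r <- signs2) csg z r *: mode z (freq13 m1 m3 n r)
     ((a1 * sg r.1 * n ax1 + a3 * sg r.2 * n ax3) *:
      vec3 (sg r.1 * b ax1) (b ax2) (sg r.2 * b ax3)).
Proof. rewrite /signs2 /csg /freq13; case: z; expand_trig. Qed.

Lemma advect_to_plane13 z (m1 m3 a1 a3 : R) (n b : 'I_3 -> R) :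
  advect (mode z n b) (mode false (vec3 m1 0 m3) (vec3 a1 0 a3)) =
  \sum_(r <- signs2) csg z r *: mode z (freq13 m1 m3 n r)
     ((sg r.1 * b ax1 * m1 + sg r.2 * b ax3 * m3) *: vec3 a1 0 a3).
Proof. rewrite /signs2 /csg /freq13; case: z; expand_trig. Qed.

Definition freq23 (m2 m3 : R) (n : 'I_3 -> R) (r : bool * bool) : 'I_3 -> R :=
  vec3 (n ax1) (m2 + sg r.1 * n ax2) (m3 + sg r.2 * n ax3).

Lemma advect_plane23 z (m2 m3 a2 a3 : R) (n b : 'I_3 -> R) :
  advect (mode false (vec3 0 m2 m3) (vec3 0 a2 a3)) (mode z n b) =
  \sum_(r <- signs2) csg z r *: mode z (freq23 m2 m3 n r)
     ((a2 * sg r.1 * n ax2 + a3 * sg r.2 * n ax3) *: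
      vec3 (b ax1) (sg r.1 * b ax2) (sg r.2 * b ax3)).
Proof. rewrite /signs2 /csg /freq23; case: z; expand_trig. Qed.

Lemma advect_to_plane23 z (m2 m3 a2 a3 : R) (n b : 'I_3 -> R) :
  advect (mode z n b) (mode false (vec3 0 m2 m3) (vec3 0 a2 a3)) =
  \sum_(r <- signs2) csg z r *: mode z (freq23 m2 m3 n r)
     ((sg r.1 * b ax2 * m2 + sg r.2 * b ax3 * m3) *: vec3 0 a2 a3).
Proof. rewrite /signs2 /csg /freq23; case: z; expand_trig. Qed.

(** In a field Y each sign of the amplitude is absorbed by the sine of the same direction; in a
    field Z one sign of the third direction is left over. Hence negative frequencies are full as
    soon as their absolute values are. *)
Lemma mode_refl (e : bool * bool * bool) z (k w : 'I_3 -> R) :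
  mode z (hmul (rho R e) k) (hmul (rho R e) w) =
  (if z then rho R e ax3 else 1) *: mode z k w.
Proof.
apply/funext => i; apply/funext => -[[x y] t].
rewrite /mode /trig3 /parity /msign !fctE /hmul /GRing.scale /rho.
have rN (c d : R) : -1 * c * d = - (c * d) by ring.
have r1 (c d : R) : 1 * c * d = c * d by ring.
case: e => -[[] []] []; case: z; elim/ord3P: i;
  rewrite /= /vec3/= !(rN, r1) /trig ?(sinN, cosN); ring.
Qed.

End Products.

(** * Induction over the frequencies *)

Section Saturation.
Variables (R : realType) (L : 'I_3 -> R).
Hypothesis L_gt0 : forall i, 0 < L i.
Notation vfield := ('I_3 -> R * R * R -> R).
Variable C : set vfield.
Local Notation adm := (adm L).
Local Notation reach := (reach L C).

Definition unit_freq (i : 'I_3) : R := pi / L i.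
Local Notation al := unit_freq.

Definition fr (x y t : int) : 'I_3 -> R :=
  vec3 (x%:~R * al ax1) (y%:~R * al ax2) (t%:~R * al ax3).

Lemma al_gt0 i : 0 < al i. Proof. by rewrite divr_gt0 ?pi_gt0. Qed.

Lemma adm_fr x y t : adm (fr x y t).
Proof.
exists (vec3 x y t); apply: ord3P; rewrite /fr /vec3/= /al; exact: mulrA.
Qed.

Definition full z x y t : Prop :=
  forall w, dot w (fr x y t) = 0 -> reach (mode z (fr x y t) w).

Lemma hmul_rhoK e (w : 'I_3 -> R) : hmul (rho R e) (hmul (rho R e) w) = w.
Proof.
apply/funext => i; rewrite /hmul mulrA /rho; move: i.
by case: e => -[[] []] []; apply: ord3P; rewrite /vec3/=; ring.
Qed.

Lemma dot_hmul_rho e (w k : 'I_3 -> R) : dot (hmul (rho R e) w) (hmul (rho R e) k) = dot w k.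
Proof. by rewrite !dotE /hmul /rho; case: e => -[[] []] [] /=; rewrite /vec3/=; ring. Qed.

Lemma full_refl e z x y t x' y' t' :
  fr x' y' t' = hmul (rho R e) (fr x y t) -> full z x y t -> full z x' y' t'.
Proof.
move=> E fz w; rewrite E => wk.
rewrite -(hmul_rhoK e w) mode_refl; apply: reachZ; apply: fz.
by rewrite -(dot_hmul_rho e) hmul_rhoK.
Qed.

Lemma fullN1 z x y t : full z x y t -> full z (- x) y t.
Proof.
apply: (@full_refl (true, false, false)); apply/funext; apply: ord3P;
  by rewrite /fr /hmul /rho /vec3/= ?rmorphN/=; ring.
Qed.

Lemma fullN2 z x y t : full z x y t -> full z x (- y) t.
Proof.
apply: (@full_refl (false, true, false)); apply/funext; apply: ord3P;
  by rewrite /fr /hmul /rho /vec3/= ?rmorphN/=; ring.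
Qed.

Lemma fullN3 z x y t : full z x y t -> full z x y (- t).
Proof.
apply: (@full_refl (false, false, true)); apply/funext; apply: ord3P;
  by rewrite /fr /hmul /rho /vec3/= ?rmorphN/=; ring.
Qed.

Lemma full_term z x y t k w (c : R) : k = fr x y t -> full z x y t ->
  reach (c *: mode z k (perp_proj k w)).
Proof. by move=> -> fz; apply: reachZ; apply: fz; exact: dot_perp_proj. Qed.

(** Equations for amplitudes need only be solved modulo the frequency. *)
Lemma perp_proj_id (k w : 'I_3 -> R) (la : R) : k != 0 -> dot w k = 0 ->
  perp_proj k (w + la *: k) = w.
Proof.
move=> k0 wk; have kk : dot k k != 0 by apply: contra k0 => /eqP/dot_eq0 ->.
by rewrite /perp_proj dotDl dotZl wk add0r mulfK// addrK.
Qed.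

(** The generators used as first argument of a bracket: the constant vertical field, two shears, and
    plane modes with p = 1, 2. The factors [c] are unspecified because the amplitudes of the
    generating set are arbitrary up to scaling. *)
Hypothesis C_translation : C (mode true (fun=> 0) ((-1) *: vec3 0 0 1)).
Hypothesis C_shear1 : exists2 c : R, c != 0 &
  C (mode true (vec3 (al ax1) 0 0) (c *: vec3 0 0 1)).
Hypothesis C_shear2 : exists2 c : R, c != 0 &
  C (mode true (vec3 0 (al ax2) 0) (c *: vec3 0 0 1)).
Hypothesis C_plane13 : forall p : nat, p \in [:: 1%N; 2%N] -> exists2 c : R, c != 0 &
  C (mode false (vec3 (p%:R * al ax1) 0 (al ax3)) (c *: vec3 (al ax3) 0 (- (p%:R * al ax1)))).
Hypothesis C_plane23 : forall p : nat, p \in [:: 1%N; 2%N] -> exists2 c : R, c != 0 &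
  C (mode false (vec3 0 (p%:R * al ax2) (al ax3)) (c *: vec3 0 (al ax3) (- (p%:R * al ax2)))).

Lemma fr3_neq0 x y t : t != 0 -> fr x y t ax3 != 0.
Proof.
by move=> t0; rewrite /fr/vec3/= mulf_neq0 ?intr_eq0// gt_eqF// al_gt0.
Qed.

(** The bracket with the constant field is, up to sign, the derivative in x_3; it exchanges sines
    and cosines of x_3 and multiplies by k_3, whence [t != 0]. *)
Lemma full_swap z x y t : t != 0 -> full z x y t -> full (~~ z) x y t.
Proof.
move=> t0 fz w wk; have n30 := fr3_neq0 x y t0; have adm00 : adm (fun=> 0) := adm0 L.
have := reach_symB L_gt0 adm00 (adm_fr x y t) (fun=> adm_fr x y t) _
  C_translation (fz w wk) (advect_translation z _ w) (advect_to_translation z _ w).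
rewrite oppr_eq0 oner_eq0 => /(_ isT); rewrite big_seq1.
have -> : w + (fun=> 0) = w by exact: addr0.
rewrite -[w]addr0 -[X in w + X](scale0r (fr x y t)) perp_proj_id//; last first.
  by apply: contra n30 => /eqP ->.
rewrite scale0r addr0; apply: reachZK.
by case: (z); rewrite ?oppr_eq0.
Qed.

Lemma reach_shear1 x y t b : reach (mode false (fr x y t) b) ->
  reach (mode true (fr (1 + x) y t) (perp_proj (fr (1 + x) y t)
           (fr x y t ax3 *: b + vec3 0 0 (b ax1 * al ax1)))
       + mode true (fr (1 - x) y t) (perp_proj (fr (1 - x) y t)
           (fr x y t ax3 *: vec3 (- b ax1) (b ax2) (b ax3)
            - vec3 0 0 (b ax1 * al ax1)))).
Proof.
move=> rb; have [c c0 Cc] := C_shear1.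
have kE r : vec3 (al ax1 + sg R r * fr x y t ax1) (fr x y t ax2) (fr x y t ax3) =
            fr (if r then 1 - x else 1 + x) y t.
  apply/funext; apply: ord3P; rewrite /fr /vec3 /sg/=; case: r;
    by rewrite ?rmorphB ?rmorphD/= ?rmorph1; ring.
have ak r : adm (vec3 (al ax1 + sg R r * fr x y t ax1) (fr x y t ax2) (fr x y t ax3)).
  by rewrite kE; exact: adm_fr.
have am : adm (vec3 (al ax1) 0 0).
  rewrite (_ : vec3 _ _ _ = fr 1 0 0); first exact: adm_fr.
  by apply/funext; apply: ord3P; rewrite /fr /vec3/= ?mul1r ?mul0r.
have := reach_symB L_gt0 am (adm_fr x y t) ak c0 Cc rb
  (advect_shear1 (al ax1) _ b) (advect_to_shear1 (al ax1) _ b).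
rewrite !big_cons big_nil addr0 -scalerDr => /reachZK.
rewrite invr_eq0 pnatr_eq0 => /(_ isT).
rewrite !kE; congr (reach (mode _ _ (perp_proj _ _) + mode _ _ (perp_proj _ _)));
  by apply/funext; apply: ord3P; rewrite !fctE /vec3 /sg /GRing.scale/=; ring.
Qed.

Lemma reach_shear2 x y t b : reach (mode false (fr x y t) b) ->
  reach (mode true (fr x (1 + y) t) (perp_proj (fr x (1 + y) t)
           (fr x y t ax3 *: b + vec3 0 0 (b ax2 * al ax2)))
       + mode true (fr x (1 - y) t) (perp_proj (fr x (1 - y) t)
           (fr x y t ax3 *: vec3 (b ax1) (- b ax2) (b ax3)
            - vec3 0 0 (b ax2 * al ax2)))).
Proof.
move=> rb; have [c c0 Cc] := C_shear2.
have kE r : vec3 (fr x y t ax1) (al ax2 + sg R r * fr x y t ax2) (fr x y t ax3) =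
            fr x (if r then 1 - y else 1 + y) t.
  apply/funext; apply: ord3P; rewrite /fr /vec3 /sg/=; case: r;
    by rewrite ?rmorphB ?rmorphD/= ?rmorph1; ring.
have ak r : adm (vec3 (fr x y t ax1) (al ax2 + sg R r * fr x y t ax2) (fr x y t ax3)).
  by rewrite kE; exact: adm_fr.
have am : adm (vec3 0 (al ax2) 0).
  rewrite (_ : vec3 _ _ _ = fr 0 1 0); first exact: adm_fr.
  by apply/funext; apply: ord3P; rewrite /fr /vec3/= ?mul1r ?mul0r.
have := reach_symB L_gt0 am (adm_fr x y t) ak c0 Cc rb
  (advect_shear2 (al ax2) _ b) (advect_to_shear2 (al ax2) _ b).
rewrite !big_cons big_nil addr0 -scalerDr => /reachZK.
rewrite invr_eq0 pnatr_eq0 => /(_ isT).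
rewrite !kE; congr (reach (mode _ _ (perp_proj _ _) + mode _ _ (perp_proj _ _)));
  by apply/funext; apply: ord3P; rewrite !fctE /vec3 /sg /GRing.scale/=; ring.
Qed.

(* The map b |-> n3 b + b1 m1 e3 (mod k) from the plane orthogonal to n onto
   the plane orthogonal to k = n + m1 e1 is invertible because |n| > |m1|. *)
Lemma shear_amplitude1 (n1 n2 n3 m1 : R) w : 0 < m1 <= n1 -> n3 != 0 ->
  dot w (vec3 (n1 + m1) n2 n3) = 0 ->
  exists b : 'I_3 -> R, exists2 la : R, dot b (vec3 n1 n2 n3) = 0 &
    n3 *: b + vec3 0 0 (b ax1 * m1) = w + la *: vec3 (n1 + m1) n2 n3.
Proof.
move=> /andP[m0 mn] n30 wk.
have wk3 : w ax3 = - (w ax1 * (n1 + m1) + w ax2 * n2) / n3.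
  by apply: (mulIf n30); rewrite divfK//; move: wk; rewrite dotE /vec3/=; lra.
pose D := n1 ^+ 2 + n2 ^+ 2 + n3 ^+ 2 - m1 ^+ 2.
have D0 : D != 0.
  have n3p : 0 < n3 ^+ 2 by rewrite exprn_even_gt0.
  by rewrite gt_eqF// /D; nra.
(* Solving the vector equation for [b] leaves orthogonality to n, which reads
   [la * D = 2 * w ax1 * m1] because w is orthogonal to n + m1 e1. *)
pose la := 2 * w ax1 * m1 / D.
pose b1 := (w ax1 + la * (n1 + m1)) / n3.
exists (vec3 b1 ((w ax2 + la * n2) / n3) ((w ax3 + la * n3 - b1 * m1) / n3)), la.
  rewrite dotE /vec3/= wk3 /b1 /la /D; field.
  by rewrite n30 /=.
apply/funext; apply: ord3P; rewrite !fctE /vec3/= /GRing.scale/= /b1; field; exact: n30.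
Qed.

(** The previous case with the first two axes exchanged. *)
Lemma shear_amplitude2 (n1 n2 n3 m2 : R) w : 0 < m2 <= n2 -> n3 != 0 ->
  dot w (vec3 n1 (n2 + m2) n3) = 0 ->
  exists b : 'I_3 -> R, exists2 la : R, dot b (vec3 n1 n2 n3) = 0 &
    n3 *: b + vec3 0 0 (b ax2 * m2) = w + la *: vec3 n1 (n2 + m2) n3.
Proof.
move=> mn n30; rewrite dotE /vec3/= => wk.
have [|b [la bk E]] := @shear_amplitude1 n2 n1 n3 m2 (vec3 (w ax2) (w ax1) (w ax3)) mn n30.
  by rewrite dotE /vec3/= addrAC -addrA addrC -[RHS]wk; ring.
exists (vec3 (b ax2) (b ax1) (b ax3)), la.
  by rewrite -[RHS]bk !dotE /vec3/=; ring.
have Ei i := congr1 (fun f => f i) E.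
apply/funext; apply: ord3P; [rewrite -[LHS]/((n3 *: b + vec3 0 0 (b ax1 * m2)) ax2)|
  rewrite -[LHS]/((n3 *: b + vec3 0 0 (b ax1 * m2)) ax1)|
  rewrite -[LHS]/((n3 *: b + vec3 0 0 (b ax1 * m2)) ax3)]; exact: Ei.
Qed.

Lemma fr_neq0 x y t : [|| x != 0, y != 0 | t != 0] -> fr x y t != 0.
Proof.
move=> xyt; apply/eqP => k0; have E i : fr x y t i = 0 by rewrite k0.
have m0 (n : int) i : (n%:~R * al i == 0) = (n == 0).
  by rewrite mulf_eq0 intr_eq0 (gt_eqF (al_gt0 i)) orbF.
have /eqP := E ax1; have /eqP := E ax2; have /eqP := E ax3.
rewrite /fr /vec3/= !m0 => z0 y0 x0.
by move: xyt; rewrite x0 y0 z0.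
Qed.

Lemma intr_le1 (x : int) : 0 < x -> 1 <= x%:~R :> R.
Proof. by move=> x0; rewrite (ler1z R x) -gtz0_ge1. Qed.

(** The bracket of Z^(1,0,0) with Y^(x,y,t) has the frequencies 1 + x and 1 - x; the second is the
    reflection of x - 1 and can be subtracted. By [shear_amplitude1] every amplitude at 1 + x arises
    from some [b]. *)
Lemma full_shear1 x y t : 0 < x -> t != 0 -> full false x y t ->
  full true (x - 1) y t -> full true (1 + x) y t.
Proof.
move=> x0 t0 fx fx1 w wk; have n30 := fr3_neq0 x y t0.
have xE : fr (1 + x) y t = vec3 (fr x y t ax1 + al ax1) (fr x y t ax2) (fr x y t ax3).
  by apply/funext; apply: ord3P; rewrite /fr /vec3/= ?rmorphD/= ?rmorph1; ring.
have mn : 0 < al ax1 <= fr x y t ax1.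
  by rewrite al_gt0 /fr/vec3/= ler_peMl ?intr_le1// ltW// al_gt0.
move: (wk); rewrite xE => /(shear_amplitude1 mn n30)[b [la bk E]].
have := reach_shear1 (fx b _); rewrite -{1}bk => /(_ erefl)/reachBr.
rewrite E -xE perp_proj_id//; last by apply: fr_neq0; rewrite t0 !orbT.
apply; rewrite -opprB -[X in reach X]scale1r; apply: full_term => //.
exact: fullN1.
Qed.

Lemma full_shear2 x y t : 0 < y -> t != 0 -> full false x y t ->
  full true x (y - 1) t -> full true x (1 + y) t.
Proof.
move=> y0 t0 fy fy1 w wk; have n30 := fr3_neq0 x y t0.
have yE : fr x (1 + y) t = vec3 (fr x y t ax1) (fr x y t ax2 + al ax2) (fr x y t ax3).
  by apply/funext; apply: ord3P; rewrite /fr /vec3/= ?rmorphD/= ?rmorph1; ring.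
have mn : 0 < al ax2 <= fr x y t ax2.
  by rewrite al_gt0 /fr/vec3/= ler_peMl ?intr_le1// ltW// al_gt0.
move: (wk); rewrite yE => /(shear_amplitude2 mn n30)[b [la bk E]].
have := reach_shear2 (fy b _); rewrite -{1}bk => /(_ erefl)/reachBr.
rewrite E -yE perp_proj_id//; last by apply: fr_neq0; rewrite t0 !orbT.
apply; rewrite -opprB -[X in reach X]scale1r; apply: full_term => //.
exact: fullN2.
Qed.

(* The amplitude in direction i is irrelevant if [mode] carries a factor
   sin (k_j x_j) with k_j = 0 there. *)
Lemma eq_mode z (k w w' : 'I_3 -> R) :
  (forall i, w i = w' i \/ exists2 j, parity z i j & k j = 0) -> mode z k w = mode z k w'.
Proof.
move=> ww'; apply/funext => i; apply/funext => x; rewrite /mode.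
have [->//|[j pj kj]] := ww' i.
suff -> : trig3 (parity z i) k x = 0 by rewrite !mulr0.
rewrite /trig3; move: pj kj; elim/ord3P: j => -> ->;
  by rewrite mul0r /= sin0 ?mul0r ?mulr0 ?mul0r.
Qed.

Lemma mode_eq0 z (k w : 'I_3 -> R) :
  (forall i, w i = 0 \/ exists2 j, parity z i j & k j = 0) -> mode z k w = 0.
Proof.
move=> w0; rewrite (@eq_mode z k w (0 *: 0)) ?modeZ ?scale0r//.
Qed.

(** There is nothing to reach: the horizontal components contain sin 0, and orthogonality to k
    forces the vertical amplitude to be 0. *)
Lemma full_00 z t : t != 0 -> full z 0 0 t.
Proof.
move=> t0 w wk; rewrite mode_eq0; first exact: reach0.
apply: ord3P.
- by right; exists ax1; [case: (z)|rewrite /fr/vec3/= mul0r].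
- by right; exists ax2; [case: (z)|rewrite /fr/vec3/= mul0r].
- left; move: wk; rewrite dotE {1 2}/fr /vec3/= !mul0r !mulr0 !add0r => /eqP.
  by rewrite mulf_eq0 (negbTE (fr3_neq0 0 0 t0)) orbF => /eqP.
Qed.

Definition fullb (x y t : nat) : Prop := forall z, full z x y t.

Lemma fullb1 z (x y t : nat) : (0 < t)%N -> full z x y t -> fullb x y t.
Proof.
move=> t0 fz z'; have [->//|zz'] := eqVneq z' z.
have -> : z' = ~~ z by move: zz' {fz}; case: z' z => -[].
by apply: full_swap; first by rewrite eqz_nat -lt0n.
Qed.

(** The shears give two-step recurrences in x and then in y, so four starting frequencies suffice;
    the fourth, (0,0), is trivial by [full_00]. *)
Lemma full_level (t : nat) : (0 < t)%N ->
  fullb 1 0 t -> fullb 0 1 t -> fullb 1 1 t -> forall x y, fullb x y t.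
Proof.
move=> t0 f10 f01 f11.
have tz : (t : int) != 0 by rewrite eqz_nat -lt0n.
have f00 : fullb 0 0 t by move=> z; exact: full_00.
have up1 y : fullb 0 y t -> fullb 1 y t -> forall x, fullb x y t /\ fullb x.+1 y t.
  move=> f0 f1; elim=> [//|x [IH1 IH2]]; split=> //.
  apply: (@fullb1 true) => //; rewrite -add1n PoszD; apply: full_shear1 => //.
  by rewrite -addn1 PoszD addrK; exact: IH1.
have row x : fullb x 0 t /\ fullb x 1 t.
  by split; [have [] := up1 0%N f00 f10 x|have [] := up1 1%N f01 f11 x].
move=> x; suff up2 y : fullb x y t /\ fullb x y.+1 t by move=> y; have [] := up2 y.
elim: y => [|y [IH1 IH2]]; first exact: row.
split=> //; apply: (@fullb1 true) => //; rewrite -add1n PoszD; apply: full_shear2 => //.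
by rewrite -addn1 PoszD addrK; exact: IH1.
Qed.

Definition sz (s : bool) : int := if s then -1 else 1.

(** The sum of the amplitudes in [advect_plane13] and [advect_to_plane13], before projection, for
    the plane amplitude (al_3, 0, - p al_1) orthogonal to the frequency (p al_1, 0, al_3). *)
Definition amp13 (p : nat) (n b : 'I_3 -> R) (r : bool * bool) : 'I_3 -> R :=
  (al ax3 * sg R r.1 * n ax1 + - (p%:R * al ax1) * sg R r.2 * n ax3) *:
     vec3 (sg R r.1 * b ax1) (b ax2) (sg R r.2 * b ax3)
  + (sg R r.1 * b ax1 * (p%:R * al ax1) + sg R r.2 * b ax3 * al ax3) *:
     vec3 (al ax3) 0 (- (p%:R * al ax1)).

Definition amp23 (p : nat) (n b : 'I_3 -> R) (r : bool * bool) : 'I_3 -> R :=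
  (al ax3 * sg R r.1 * n ax2 + - (p%:R * al ax2) * sg R r.2 * n ax3) *:
     vec3 (b ax1) (sg R r.1 * b ax2) (sg R r.2 * b ax3)
  + (sg R r.1 * b ax2 * (p%:R * al ax2) + sg R r.2 * b ax3 * al ax3) *:
     vec3 0 (al ax3) (- (p%:R * al ax2)).

Lemma sgE s : sg R s = (sz s)%:~R. Proof. by case: s. Qed.

Lemma reach_plane13 z (p : nat) x y t b : p \in [:: 1%N; 2%N] ->
  reach (mode z (fr x y t) b) ->
  reach (\sum_(r <- signs2) csg R z r *:
    mode z (fr (p%:Z + sz r.1 * x) y (1 + sz r.2 * t))
      (perp_proj (fr (p%:Z + sz r.1 * x) y (1 + sz r.2 * t)) (amp13 p (fr x y t) b r))).
Proof.
move=> p12 rb; have [c c0 Cc] := C_plane13 p12.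
have kE r : freq13 (p%:R * al ax1) (al ax3) (fr x y t) r =
            fr (p%:Z + sz r.1 * x) y (1 + sz r.2 * t).
  apply/funext; apply: ord3P; rewrite /freq13 /fr /vec3 !sgE/= ?rmorphD ?rmorphM/= ?rmorph1;
    by rewrite -?pmulrn; ring.
have ak r : adm (freq13 (p%:R * al ax1) (al ax3) (fr x y t) r).
  by rewrite kE; exact: adm_fr.
have am : adm (vec3 (p%:R * al ax1) 0 (al ax3)).
  rewrite (_ : vec3 _ _ _ = fr p%:Z 0 1); first exact: adm_fr.
  by apply/funext; apply: ord3P; rewrite /fr /vec3/= ?mul1r ?mul0r.
have := reach_symB L_gt0 am (adm_fr x y t) ak c0 Cc rb
  (advect_plane13 z _ _ _ _ _ b) (advect_to_plane13 z _ _ _ _ _ b).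
by congr (reach _); apply: eq_bigr => r _; rewrite kE.
Qed.

Lemma reach_plane23 z (p : nat) x y t b : p \in [:: 1%N; 2%N] ->
  reach (mode z (fr x y t) b) ->
  reach (\sum_(r <- signs2) csg R z r *:
    mode z (fr x (p%:Z + sz r.1 * y) (1 + sz r.2 * t))
      (perp_proj (fr x (p%:Z + sz r.1 * y) (1 + sz r.2 * t)) (amp23 p (fr x y t) b r))).
Proof.
move=> p12 rb; have [c c0 Cc] := C_plane23 p12.
have kE r : freq23 (p%:R * al ax2) (al ax3) (fr x y t) r =
            fr x (p%:Z + sz r.1 * y) (1 + sz r.2 * t).
  apply/funext; apply: ord3P; rewrite /freq23 /fr /vec3 !sgE/= ?rmorphD ?rmorphM/= ?rmorph1;
    by rewrite -?pmulrn; ring.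
have ak r : adm (freq23 (p%:R * al ax2) (al ax3) (fr x y t) r).
  by rewrite kE; exact: adm_fr.
have am : adm (vec3 0 (p%:R * al ax2) (al ax3)).
  rewrite (_ : vec3 _ _ _ = fr 0 p%:Z 1); first exact: adm_fr.
  by apply/funext; apply: ord3P; rewrite /fr /vec3/= ?mul1r ?mul0r.
have := reach_symB L_gt0 am (adm_fr x y t) ak c0 Cc rb
  (advect_plane23 z _ _ _ _ _ b) (advect_to_plane23 z _ _ _ _ _ b).
by congr (reach _); apply: eq_bigr => r _; rewrite kE.
Qed.

Lemma reach_sum_isolate (I : eqType) (s : seq I) (F : I -> vfield) r0 :
  r0 \in s -> uniq s -> (forall r, r \in s -> r != r0 -> reach (F r)) ->
  reach (\sum_(r <- s) F r) -> reach (F r0).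
Proof.
move=> rs us Fr; rewrite (bigD1_seq r0)//= => /reachBr; apply.
rewrite big_seq_cond; elim/big_ind: _ => [||r /andP[]]; [exact: reach0|exact: reachD|exact: Fr].
Qed.

(** The amplitudes reached modulo [k]: a linear space containing [k] itself when [k] is nonzero, so
    that bracket amplitudes can be used without computing their projection. *)
Definition ampl z k (w : 'I_3 -> R) : Prop := reach (mode z k (perp_proj k w)).

Lemma amplD z k w w' : ampl z k w -> ampl z k w' -> ampl z k (w + w').
Proof. by rewrite /ampl perp_projD modeD; exact: reachD. Qed.

Lemma amplZ z k (c : R) (w : 'I_3 -> R) : ampl z k w -> ampl z k (c *: w).
Proof. by rewrite /ampl perp_projZ modeZ; exact: reachZ. Qed.

Lemma ampl_freq z k : k != 0 -> ampl z k k.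
Proof.
move=> k0; rewrite /ampl (_ : perp_proj k k = 0 *: 0); last first.
  rewrite scale0r /perp_proj divff ?scale1r ?subrr//.
  by apply: contra k0 => /eqP/dot_eq0 ->.
by rewrite modeZ scale0r; exact: reach0.
Qed.

Lemma ampl_reach z k w : k != 0 -> dot w k = 0 -> ampl z k w -> reach (mode z k w).
Proof.
by move=> k0 wk; rewrite /ampl -[X in perp_proj k X]addr0 -(scale0r k) perp_proj_id.
Qed.

Definition det3 (a b c : 'I_3 -> R) : R :=
  a ax1 * (b ax2 * c ax3 - b ax3 * c ax2) - a ax2 * (b ax1 * c ax3 - b ax3 * c ax1)
  + a ax3 * (b ax1 * c ax2 - b ax2 * c ax1).

Lemma cramer3 (a b c w : 'I_3 -> R) : det3 a b c != 0 ->
  w = (det3 w b c / det3 a b c) *: a + (det3 a w c / det3 a b c) *: b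
      + (det3 a b w / det3 a b c) *: c.
Proof.
move=> d0; apply/funext => i; rewrite !fctE /GRing.scale/=.
have e u v : u / det3 a b c * v * det3 a b c = u * v by rewrite mulrAC divfK.
apply: (mulIf d0); rewrite !mulrDl !e.
by move: i; apply: ord3P; rewrite /det3; ring.
Qed.

(** With the frequency, [a] and [b] form a basis, and all three are reached modulo the frequency. *)
Lemma full_of_two_amplitudes z x y t a b : fr x y t != 0 ->
  det3 a b (fr x y t) != 0 ->
  ampl z (fr x y t) a -> ampl z (fr x y t) b -> full z x y t.
Proof.
move=> k0 d0 ha hb w wk; apply: ampl_reach => //.
rewrite (cramer3 w d0); apply: amplD; last by apply: amplZ; exact: ampl_freq.
by apply: amplD; exact: amplZ.
Qed.

(** When k_j = 0 and the component j carries a sine in its own direction, that component is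
    invisible and the amplitudes orthogonal to k form a line in the plane of i and l. One [V] not
    parallel to k in that plane spans it; the minor in the hypothesis measures this. *)
Lemma full_planar z x y t (i l j : 'I_3) (V : 'I_3 -> R) :
  (forall m, [\/ m = i, m = l | m = j]) ->
  (forall u, dot u (fr x y t) = u i * fr x y t i + u l * fr x y t l) ->
  parity z j j -> fr x y t j = 0 ->
  V i * fr x y t l - V l * fr x y t i != 0 ->
  ampl z (fr x y t) V -> full z x y t.
Proof.
set k := fr x y t; move=> ilj dotk pj kj D0 hV w; rewrite dotk => wk.
set D := _ - _ in D0.
have kk0 : k i ^+ 2 + k l ^+ 2 != 0.
  apply: contra D0; rewrite paddr_eq0 ?sqr_ge0// !sqrf_eq0 => /andP[/eqP ki /eqP kl].
  by rewrite /D ki kl !mulr0 subr0.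
pose c := (w i * k l - w l * k i) / D.
rewrite (@eq_mode z k w (c *: perp_proj k V)); first by rewrite modeZ; exact: reachZ.
have PV m : perp_proj k V m = V m - (V i * k i + V l * k l) / (k i ^+ 2 + k l ^+ 2) * k m.
  by rewrite /perp_proj !dotk -!expr2.
have PVi : perp_proj k V i = k l * D / (k i ^+ 2 + k l ^+ 2).
  by rewrite PV /D; field.
have PVl : perp_proj k V l = - k i * D / (k i ^+ 2 + k l ^+ 2).
  by rewrite PV /D; field.
have wi : (w i * k l - w l * k i) * k l = w i * (k i ^+ 2 + k l ^+ 2).
  by rewrite -[RHS]subr0 -(mulr0 (k i)) -wk; ring.
have wl : - (w i * k l - w l * k i) * k i = w l * (k i ^+ 2 + k l ^+ 2).
  by rewrite -[RHS]subr0 -(mulr0 (k l)) -wk; ring.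
move=> m; have [->|->|->] := ilj m; [left|left|by right; exists j].
- rewrite -[RHS]/(c * perp_proj k V i) PVi /c.
  apply: (mulIf kk0); rewrite -wi; field.
  by rewrite kk0 D0.
- rewrite -[RHS]/(c * perp_proj k V l) PVl /c.
  apply: (mulIf kk0); rewrite -wl; field.
  by rewrite kk0 D0.
Qed.

Lemma fr0E i : fr 0 0 0 i = 0.
Proof. by move: i; apply: ord3P; rewrite /fr /vec3/= mul0r. Qed.

Lemma full_planar2 z x t (V : 'I_3 -> R) :
  V ax1 * fr x 0 t ax3 - V ax3 * fr x 0 t ax1 != 0 ->
  ampl z (fr x 0 t) V -> full z x 0 t.
Proof.
apply: (@full_planar z x 0 t ax1 ax3 ax2).
- by apply: ord3P; [constructor 1|constructor 3|constructor 2].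
- by move=> u; rewrite dotE /fr /vec3/= mul0r mulr0 addr0.
- by case: z.
- by rewrite /fr/vec3/= mul0r.
Qed.

Lemma full_planar1 z y t (V : 'I_3 -> R) :
  V ax2 * fr 0 y t ax3 - V ax3 * fr 0 y t ax2 != 0 ->
  ampl z (fr 0 y t) V -> full z 0 y t.
Proof.
apply: (@full_planar z 0 y t ax2 ax3 ax1).
- by apply: ord3P; [constructor 3|constructor 1|constructor 2].
- by move=> u; rewrite dotE /fr /vec3/= mul0r mulr0 add0r.
- by case: z.
- by rewrite /fr/vec3/= mul0r.
Qed.

Lemma full_planar3 x y (V : 'I_3 -> R) :
  V ax1 * fr x y 0 ax2 - V ax2 * fr x y 0 ax1 != 0 ->
  ampl false (fr x y 0) V -> full false x y 0.
Proof.
apply: (@full_planar false x y 0 ax1 ax2 ax3).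
- by apply: ord3P; [constructor 1|constructor 2|constructor 3].
- by move=> u; rewrite dotE /fr /vec3/= mul0r mulr0 addr0.
- by [].
- by rewrite /fr/vec3/= mul0r.
Qed.

(** Since the partner (0,y,s) has first frequency 0, the four terms have only two frequencies,
    (p,y,1+s) and (p,y,1-s). The latter is the reflection of level s - 1 and is subtracted. *)
Lemma ampl_plane13 (p y s : nat) : p \in [:: 1%N; 2%N] -> (1 < s)%N ->
  fullb 0 y s -> fullb p y s.-1 ->
  ampl false (fr p y (1 + s%:Z))
    (amp13 p (fr 0%N y s) (vec3 0 (fr 0%N y s ax3) (- fr 0%N y s ax2)) (false, false)).
Proof.
move=> p12 s1 f0 fp; set b := vec3 _ _ _.
have bk : dot b (fr 0%N y s) = 0 by rewrite dotE /b /fr /vec3/=; ring.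
have := reach_plane13 p12 (f0 false b bk).
have freqE r1 r2 : fr (p%:Z + sz r1 * 0%N) y (1 + sz r2 * s) = fr p y (if r2 then 1 - s%:Z else 1 + s%:Z).
  by rewrite [sz r1 * _]mulr0 addr0; case: r2; rewrite ?mul1r ?mulN1r.
rewrite !big_cons big_nil !freqE addr0 addrA => /reachBr H.
have fN : full false p y (1 - s%:Z).
  by rewrite (_ : 1 - s%:Z = - (s.-1)%:Z); [apply: fullN3; exact: fp|lia].
have {H} := H (reachD (full_term _ _ erefl fN) (full_term _ _ erefl fN)).
(* The first sign is irrelevant because both [b] and the partner frequency have first component 0;
   the two terms add up rather than cancel. *)
rewrite (_ : amp13 p _ b (true, false) = amp13 p (fr 0%N y s) b (false, false)); last first.
  by apply/funext; apply: ord3P; rewrite /amp13 /b !fctE /fr /vec3 /sg /GRing.scale/=; ring.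
rewrite -scalerDl; apply: reachZK.
by rewrite /csg /= mulr1 gt_eqF// addr_gt0// invr_gt0 ltr0n.
Qed.

Lemma ampl_plane23 (p x s : nat) : p \in [:: 1%N; 2%N] -> (1 < s)%N ->
  fullb x 0 s -> fullb x p s.-1 ->
  ampl false (fr x p (1 + s%:Z))
    (amp23 p (fr x 0%N s) (vec3 (fr x 0%N s ax3) 0 (- fr x 0%N s ax1)) (false, false)).
Proof.
move=> p12 s1 f0 fp; set b := vec3 _ _ _.
have bk : dot b (fr x 0%N s) = 0 by rewrite dotE /b /fr /vec3/=; ring.
have := reach_plane23 p12 (f0 false b bk).
have freqE r1 r2 : fr x (p%:Z + sz r1 * 0%N) (1 + sz r2 * s) = fr x p (if r2 then 1 - s%:Z else 1 + s%:Z).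
  by rewrite [sz r1 * _]mulr0 addr0; case: r2; rewrite ?mul1r ?mulN1r.
rewrite !big_cons big_nil !freqE addr0 addrA => /reachBr H.
have fN : full false x p (1 - s%:Z).
  by rewrite (_ : 1 - s%:Z = - (s.-1)%:Z); [apply: fullN3; exact: fp|lia].
have {H} := H (reachD (full_term _ _ erefl fN) (full_term _ _ erefl fN)).
rewrite (_ : amp23 p _ b (true, false) = amp23 p (fr x 0%N s) b (false, false)); last first.
  by apply/funext; apply: ord3P; rewrite /amp23 /b !fctE /fr /vec3 /sg /GRing.scale/=; ring.
rewrite -scalerDl; apply: reachZK.
by rewrite /csg /= mulr1 gt_eqF// addr_gt0// invr_gt0 ltr0n.
Qed.

Lemma fr_gt0 (x y t : nat) i : (0 < x)%N -> (0 < y)%N -> (0 < t)%N -> 0 < fr x y t i.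
Proof.
move=> x0 y0 t0; move: i; apply: ord3P; rewrite /fr/vec3/=;
  by rewrite mulr_gt0 ?al_gt0// -pmulrn ltr0n.
Qed.

(** Each family of plane modes contributes one amplitude at (p,q,s+1). In the determinant, [S - r]
    is (s - 1) al_3 and every other factor is nonzero, so independence is exactly the condition 1 <
    s. *)
Lemma fullb_inner (p q s : nat) : p \in [:: 1%N; 2%N] -> q \in [:: 1%N; 2%N] ->
  (1 < s)%N -> (forall x y, fullb x y s) -> (forall x y, fullb x y s.-1) ->
  fullb p q s.+1.
Proof.
move=> p12 q12 s1 fs fs1; apply: (@fullb1 false) => //.
have p0 : (0 < p)%N by move: p12; rewrite !inE => /orP[]/eqP ->.
have q0 : (0 < q)%N by move: q12; rewrite !inE => /orP[]/eqP ->.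
have h1 := ampl_plane13 p12 s1 (fs 0%N q) (fs1 p q).
have h2 := ampl_plane23 q12 s1 (fs p 0%N) (fs1 p q).
rewrite -addn1 PoszD addrC; apply: full_of_two_amplitudes h1 h2.
  by apply: fr_neq0; rewrite eqz_nat -lt0n p0.
set A := amp13 _ _ _ _; set B := amp23 _ _ _ _.
pose P := p%:R * al ax1; pose Q := q%:R * al ax2; pose r := al ax3; pose S := s%:R * al ax3.
have P0 : 0 < P by rewrite mulr_gt0 ?ltr0n ?al_gt0.
have Q0 : 0 < Q by rewrite mulr_gt0 ?ltr0n ?al_gt0.
have r0 : 0 < r by exact: al_gt0.
have Sr : r < S by rewrite /S /r ltr_pMl ?ltr1n ?al_gt0.
have AE : A = vec3 (- Q * r ^+ 2) (- P * S ^+ 2) (P * Q * (S + r)).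
  by apply/funext; apply: ord3P; rewrite /A /amp13 !fctE /fr /vec3 /sg /GRing.scale/= -?pmulrn
    -/P -/Q -/r -/S; ring.
have BE : B = vec3 (- Q * S ^+ 2) (- P * r ^+ 2) (P * Q * (S + r)).
  by apply/funext; apply: ord3P; rewrite /B /amp23 !fctE /fr /vec3 /sg /GRing.scale/= -?pmulrn
    -/P -/Q -/r -/S; ring.
have kE : fr p q (1 + s%:Z) = vec3 P Q (S + r).
  by apply/funext; apply: ord3P; rewrite /fr /vec3/= ?rmorphD/= ?rmorph1 -?pmulrn
    -/P -/Q -/r -/S; rewrite ?mulrDl ?mul1r -/r -/S; ring.
rewrite AE BE kE (_ : det3 _ _ _ = - ((S - r) * (S + r) * (P * Q * (S + r)) *
    (P ^+ 2 + Q ^+ 2 + r ^+ 2 + S ^+ 2))); last by rewrite /det3 /vec3/=; ring.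
have S0 : 0 < S by lra.
have h1 : 0 < S - r by lra.
have h2 : 0 < S + r by lra.
have h3 : 0 < P * Q by exact: mulr_gt0.
have h4 : 0 < P ^+ 2 + Q ^+ 2 + r ^+ 2 + S ^+ 2.
  by do 3 (apply: addr_gt0; last exact: exprn_gt0); exact: exprn_gt0.
rewrite oppr_eq0 gt_eqF//.
exact: (mulr_gt0 (mulr_gt0 (mulr_gt0 h1 h2) (mulr_gt0 h3 h2)) h4).
Qed.

(** A downward step: the shear Z^(0,1,0) applied to (1,1,t) couples (1,2,t), which is subtracted,
    with (1,0,t), where a single amplitude suffices. *)
Lemma fullb_edge2 (t : nat) : (0 < t)%N -> fullb 1 1 t -> fullb 1 2 t -> fullb 1 0 t.
Proof.
move=> t0 f11 f12; apply: (@fullb1 true) => //.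
have tz : (t : int) != 0 by rewrite eqz_nat -lt0n.
pose n := fr 1%N 1%N t; pose b : 'I_3 -> R := vec3 (n ax3) 0 (- n ax1).
have bk : dot b n = 0 by rewrite dotE /b /vec3/=; ring.
have := reach_shear2 (f11 false b bk); rewrite addrC => /reachBr.
have f12' : full true 1%N (1 + 1%N%:Z) t := f12 true.
rewrite -[X in reach X -> _]scale1r => /(_ (full_term _ _ erefl f12')).
rewrite -[fr _ (1 - _) t]/(fr 1 0 t); apply: full_planar2.
have n1 : 0 < n ax1 by apply: fr_gt0.
have n3 : 0 < n ax3 by apply: fr_gt0.
have n1E : fr 1 0 t ax1 = n ax1 by [].
have n3E : fr 1 0 t ax3 = n ax3 by [].
rewrite n1E n3E !fctE -/n /b /vec3/= /GRing.scale/= gt_eqF//.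
rewrite (_ : _ - _ = n ax3 * (n ax3 ^+ 2 + n ax1 ^+ 2)); last by ring.
by rewrite mulr_gt0// addr_gt0// exprn_gt0.
Qed.

Lemma fullb_edge1 (t : nat) : (0 < t)%N -> fullb 1 1 t -> fullb 2 1 t -> fullb 0 1 t.
Proof.
move=> t0 f11 f21; apply: (@fullb1 true) => //.
have tz : (t : int) != 0 by rewrite eqz_nat -lt0n.
pose n := fr 1%N 1%N t; pose b : 'I_3 -> R := vec3 0 (n ax3) (- n ax2).
have bk : dot b n = 0 by rewrite dotE /b /vec3/=; ring.
have := reach_shear1 (f11 false b bk); rewrite addrC => /reachBr.
have f21' : full true (1 + 1%N%:Z) 1%N t := f21 true.
rewrite -[X in reach X -> _]scale1r => /(_ (full_term _ _ erefl f21')).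
rewrite -[fr (1 - _) _ t]/(fr 0 1 t); apply: full_planar1.
have n2 : 0 < n ax2 by apply: fr_gt0.
have n3 : 0 < n ax3 by apply: fr_gt0.
have n2E : fr 0 1 t ax2 = n ax2 by [].
have n3E : fr 0 1 t ax3 = n ax3 by [].
rewrite n2E n3E !fctE -/n /b /vec3/= /GRing.scale/= gt_eqF//.
rewrite (_ : _ - _ = n ax3 * (n ax3 ^+ 2 + n ax2 ^+ 2)); last by ring.
by rewrite mulr_gt0// addr_gt0// exprn_gt0.
Qed.

Hypothesis C_base : forall t : nat, t \in [:: 1%N; 2%N] ->
  [/\ full false 1%N 0%N t, full false 0%N 1%N t & full false 1%N 1%N t].

(** Level s + 1 is entered from the levels s and s - 1 at (1,1), (1,2), (2,1); from there the shears
    go down to the edges (1,0) and (0,1), after which [full_level] fills the level. *)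
Lemma fullb_pos (t : nat) : (0 < t)%N -> forall x y, fullb x y t.
Proof.
have base s : s \in [:: 1%N; 2%N] -> forall x y, fullb x y s.
  move=> s12; have s0 : (0 < s)%N by move: s12; rewrite !inE => /orP[]/eqP ->.
  by have [f1 f2 f3] := C_base s12; apply: full_level => //; exact: (@fullb1 false).
elim/ltn_ind: t => t IH t0; have [t3|t3] := leqP t 2.
  by apply: base; move: t t0 t3 {IH} => [|[|[|]]].
case: t IH t0 t3 => // s IH _ s2.
have fs : forall x y, fullb x y s by apply: IH => //; lia.
have fs1 : forall x y, fullb x y s.-1 by apply: IH; lia.
have f11 : fullb 1 1 s.+1 by apply: fullb_inner.
have f12 : fullb 1 2 s.+1 by apply: fullb_inner.
have f21 : fullb 2 1 s.+1 by apply: fullb_inner.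
by apply: full_level => //; [exact: fullb_edge2|exact: fullb_edge1].
Qed.

Lemma csg_neq0 z r : csg R z r != 0.
Proof.
rewrite /csg mulf_neq0 ?invr_eq0 ?pnatr_eq0//.
by case: z; rewrite ?oner_eq0// /sg; case: ifP; rewrite ?oppr_eq0 oner_eq0.
Qed.

(** Y^(1,0,1) applied to (x,y,1) gives two frequencies of level 2, already full, and two of level 0.
    One of these is the reflection of (x-1,y,0), so only (x+1,y,0) remains. *)
Lemma ampl_plane13_0 z (x y : nat) b : (0 < x)%N -> full z x.-1 y 0 ->
  dot b (fr x y 1%N) = 0 ->
  ampl z (fr x.+1 y 0) (amp13 1 (fr x y 1%N) b (false, true)).
Proof.
move=> x0 f0 bk.
have := reach_plane13 (isT : 1%N \in [:: 1%N; 2%N]) (@fullb_pos 1 isT x y z b bk).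
have xE : 1%N%:Z + sz true * x = - (x.-1)%:Z by rewrite /sz mulN1r; lia.
move=> /(@reach_sum_isolate _ _ _ (false, true)) H.
have {H} := H isT isT; rewrite /= -[1 + _ * 1%N%:Z]/(0 : int).
rewrite (_ : 1%N%:Z + sz false * x = x.+1%:Z); last by rewrite /sz mul1r; lia.
move=> H; apply: (@reachZK _ _ _ (csg R z (false, true))); first exact: csg_neq0.
apply: H => -[[] []] _ // _ /=; rewrite /= ?xE.
- by apply: full_term => //; apply: fullN1; exact: f0.
- by apply: full_term => //; apply: fullN1; exact: (@fullb_pos 2).
- rewrite (_ : 1%N%:Z + sz false * x = x.+1%:Z); last by rewrite /sz mul1r; lia.
  by apply: full_term => //; exact: (@fullb_pos 2).
Qed.

Lemma ampl_plane23_0 z (x y : nat) b : (0 < y)%N -> full z x y.-1 0 ->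
  dot b (fr x y 1%N) = 0 ->
  ampl z (fr x y.+1 0) (amp23 1 (fr x y 1%N) b (false, true)).
Proof.
move=> y0 f0 bk.
have := reach_plane23 (isT : 1%N \in [:: 1%N; 2%N]) (@fullb_pos 1 isT x y z b bk).
have yE : 1%N%:Z + sz true * y = - (y.-1)%:Z by rewrite /sz mulN1r; lia.
move=> /(@reach_sum_isolate _ _ _ (false, true)) H.
have {H} := H isT isT; rewrite /= -[1 + _ * 1%N%:Z]/(0 : int).
rewrite (_ : 1%N%:Z + sz false * y = y.+1%:Z); last by rewrite /sz mul1r; lia.
move=> H; apply: (@reachZK _ _ _ (csg R z (false, true))); first exact: csg_neq0.
apply: H => -[[] []] _ // _ /=; rewrite /= ?yE.
- by apply: full_term => //; apply: fullN2; exact: f0.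
- by apply: full_term => //; apply: fullN2; exact: (@fullb_pos 2).
- rewrite (_ : 1%N%:Z + sz false * y = y.+1%:Z); last by rewrite /sz mul1r; lia.
  by apply: full_term => //; exact: (@fullb_pos 2).
Qed.

(** For k_3 = 0 only the vertical amplitude of a field Z is visible, and the projection does not
    change it. *)
Lemma full_true0 (x y : int) (V : 'I_3 -> R) : V ax3 != 0 ->
  ampl true (fr x y 0) V -> full true x y 0.
Proof.
move=> V3 hV w _; set k := fr x y 0.
have k3 : k ax3 = 0 by rewrite /k/fr/vec3/= mul0r.
rewrite (@eq_mode true k w ((w ax3 / V ax3) *: perp_proj k V)).
  by rewrite modeZ; exact: reachZ.
apply: ord3P; [by right; exists ax3|by right; exists ax3|left].
rewrite -[RHS]/(w ax3 / V ax3 * (V ax3 - dot V k / dot k k * k ax3)).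
by rewrite k3 mulr0 subr0 divfK.
Qed.

(** For k_3 = 0 the vertical component of a field Y vanishes, so one horizontal amplitude not
    parallel to k is enough. The partner amplitude [b] makes the relevant minor a product of
    positive numbers. *)
Lemma full_false_step1 (x y : nat) : (0 < x)%N -> (0 < y)%N ->
  full false x.-1 y 0 -> full false x.+1 y 0.
Proof.
move=> x0 y0 f0; set n := fr x y 1%N.
have nE : fr x.+1 y 0 = vec3 (n ax1 + al ax1) (n ax2) 0.
  by apply/funext; apply: ord3P; rewrite /n /fr /vec3/= -?pmulrn -?natr1; ring.
have n1 : 0 < n ax1 by exact: fr_gt0.
have n2 : 0 < n ax2 by exact: fr_gt0.
have n3 : 0 < n ax3 by exact: fr_gt0.
have n3E : n ax3 = al ax3 by rewrite /n/fr/vec3/= mul1r.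
pose b : 'I_3 -> R := vec3 (n ax3) 0 (- n ax1).
have bk : dot b n = 0 by rewrite dotE /b /vec3/=; ring.
apply: full_planar3 (ampl_plane13_0 x0 f0 bk).
rewrite nE /amp13 -/n /b !fctE /vec3 /sg /GRing.scale/= -n3E.
rewrite (_ : _ - _ = 2 * n ax3 ^+ 2 * (n ax1 + al ax1) * n ax2); last by ring.
have a0 : 0 < al ax1 by exact: al_gt0.
have na : 0 < n ax1 + al ax1 by lra.
rewrite gt_eqF//.
exact: (mulr_gt0 (mulr_gt0 (mulr_gt0 (@ltr0Sn R 1) (exprn_gt0 2 n3)) na) n2).
Qed.

Lemma full_false_step2 (x y : nat) : (0 < x)%N -> (0 < y)%N ->
  full false x y.-1 0 -> full false x y.+1 0.
Proof.
move=> x0 y0 f0; set n := fr x y 1%N.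
have nE : fr x y.+1 0 = vec3 (n ax1) (n ax2 + al ax2) 0.
  by apply/funext; apply: ord3P; rewrite /n /fr /vec3/= -?pmulrn -?natr1; ring.
have n1 : 0 < n ax1 by exact: fr_gt0.
have n2 : 0 < n ax2 by exact: fr_gt0.
have n3 : 0 < n ax3 by exact: fr_gt0.
have n3E : n ax3 = al ax3 by rewrite /n/fr/vec3/= mul1r.
pose b : 'I_3 -> R := vec3 0 (n ax3) (- n ax2).
have bk : dot b n = 0 by rewrite dotE /b /vec3/=; ring.
apply: full_planar3 (ampl_plane23_0 y0 f0 bk).
rewrite nE /amp23 -/n /b !fctE /vec3 /sg /GRing.scale/= -n3E.
rewrite (_ : _ - _ = - (2 * n ax3 ^+ 2 * (n ax2 + al ax2) * n ax1)); last by ring.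
have a0 : 0 < al ax2 by exact: al_gt0.
have na : 0 < n ax2 + al ax2 by lra.
rewrite oppr_eq0 gt_eqF//.
exact: (mulr_gt0 (mulr_gt0 (mulr_gt0 (@ltr0Sn R 1) (exprn_gt0 2 n3)) na) n1).
Qed.

(** For y = 0 the vertical amplitude obtained contains the factor n_1 - al_1, which vanishes at x =
    1. This is why (2,0,0), and likewise (0,2,0), appears among the starting frequencies in
    [C_base0]. *)
Lemma full_true_step1 (x y : nat) : (0 < x)%N -> (0 < y)%N || (1 < x)%N ->
  full true x.-1 y 0 -> full true x.+1 y 0.
Proof.
move=> x0 yx f0; set n := fr x y 1%N.
have n1 : 0 < n ax1 by rewrite /n/fr/vec3/= mulr_gt0 ?al_gt0// -pmulrn ltr0n.
have n3E : n ax3 = al ax3 by rewrite /n/fr/vec3/= mul1r.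
have r0 := al_gt0 ax3.
have [y0|y0] := posnP y; last first.
  have n2 : 0 < n ax2 by exact: fr_gt0.
  pose b : 'I_3 -> R := vec3 0 (n ax3) (- n ax2).
  have bk : dot b n = 0 by rewrite dotE /b /vec3/=; ring.
  apply: full_true0 (ampl_plane13_0 x0 f0 bk).
  rewrite /amp13 -/n /b !fctE /vec3 /sg /GRing.scale/= n3E.
  rewrite [X in X != 0](_ : _ = al ax3 * n ax1 * n ax2); last by ring.
  rewrite gt_eqF//; exact: (mulr_gt0 (mulr_gt0 r0 n1) n2).
have x1 : (1 < x)%N by move: yx; rewrite y0.
have n1a : al ax1 < n ax1 by rewrite /n/fr/vec3/= ltr_pMl ?al_gt0// -pmulrn ltr1n.
pose b : 'I_3 -> R := vec3 (n ax3) 0 (- n ax1).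
have bk : dot b n = 0 by rewrite dotE /b /vec3/=; ring.
apply: full_true0 (ampl_plane13_0 x0 f0 bk).
rewrite /amp13 -/n /b !fctE /vec3 /sg /GRing.scale/= n3E.
rewrite [X in X != 0](_ : _ = al ax3 * ((n ax1 + al ax1) * (n ax1 - al ax1))); last by ring.
have a0 : 0 < al ax1 by exact: al_gt0.
have na : 0 < n ax1 + al ax1 by lra.
have nb : 0 < n ax1 - al ax1 by lra.
rewrite gt_eqF//; exact: (mulr_gt0 r0 (mulr_gt0 na nb)).
Qed.

Lemma full_true_step2 (x y : nat) : (0 < y)%N -> (0 < x)%N || (1 < y)%N ->
  full true x y.-1 0 -> full true x y.+1 0.
Proof.
move=> y0 xy f0; set n := fr x y 1%N.
have n2 : 0 < n ax2 by rewrite /n/fr/vec3/= mulr_gt0 ?al_gt0// -pmulrn ltr0n.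
have n3E : n ax3 = al ax3 by rewrite /n/fr/vec3/= mul1r.
have r0 := al_gt0 ax3.
have [x0|x0] := posnP x; last first.
  have n1 : 0 < n ax1 by exact: fr_gt0.
  pose b : 'I_3 -> R := vec3 (n ax3) 0 (- n ax1).
  have bk : dot b n = 0 by rewrite dotE /b /vec3/=; ring.
  apply: full_true0 (ampl_plane23_0 y0 f0 bk).
  rewrite /amp23 -/n /b !fctE /vec3 /sg /GRing.scale/= n3E.
  rewrite [X in X != 0](_ : _ = al ax3 * n ax1 * n ax2); last by ring.
  rewrite gt_eqF//; exact: (mulr_gt0 (mulr_gt0 r0 n1) n2).
have y1 : (1 < y)%N by move: xy; rewrite x0.
have n2a : al ax2 < n ax2 by rewrite /n/fr/vec3/= ltr_pMl ?al_gt0// -pmulrn ltr1n.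
pose b : 'I_3 -> R := vec3 0 (n ax3) (- n ax2).
have bk : dot b n = 0 by rewrite dotE /b /vec3/=; ring.
apply: full_true0 (ampl_plane23_0 y0 f0 bk).
rewrite /amp23 -/n /b !fctE /vec3 /sg /GRing.scale/= n3E.
rewrite [X in X != 0](_ : _ = al ax3 * ((n ax2 + al ax2) * (n ax2 - al ax2))); last by ring.
have a0 : 0 < al ax2 by exact: al_gt0.
have na : 0 < n ax2 + al ax2 by lra.
have nb : 0 < n ax2 - al ax2 by lra.
rewrite gt_eqF//; exact: (mulr_gt0 r0 (mulr_gt0 na nb)).
Qed.

(** With two zero frequencies a field Y orthogonal to k vanishes: the components along them contain
    sin 0, and the remaining amplitude is 0 by orthogonality. *)
Lemma full_false_edge (x y : nat) : x = 0%N \/ y = 0%N -> full false x y 0.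
Proof.
move=> xy w wk; rewrite mode_eq0; first exact: reach0.
have k3 : fr x y 0 ax3 = 0 by rewrite /fr/vec3/= mul0r.
have al0 i : (al i == 0) = false by rewrite gt_eqF// al_gt0.
move: wk; rewrite dotE k3 mulr0 addr0.
have k1 : fr x y 0 ax1 = x%:R * al ax1 by [].
have k2 : fr x y 0 ax2 = y%:R * al ax2 by [].
move=> wk; apply: ord3P; last by right; exists ax3.
- have [x0|x0] := posnP x; first by right; exists ax1; rewrite // k1 x0 mul0r.
  left; case: xy => [xy|y0]; first by rewrite xy in x0.
  move/eqP: wk; rewrite k1 k2 y0 mul0r mulr0 addr0 mulf_eq0 => /orP[/eqP//|].
  by rewrite gt_eqF// mulr_gt0 ?al_gt0 ?ltr0n.
- have [y0|y0] := posnP y; first by right; exists ax2; rewrite // k2 y0 mul0r.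
  left; case: xy => [x0|xy]; last by rewrite xy in y0.
  move/eqP: wk; rewrite k1 k2 x0 mul0r mulr0 add0r mulf_eq0 => /orP[/eqP//|].
  by rewrite gt_eqF// mulr_gt0 ?al_gt0 ?ltr0n.
Qed.

Lemma full_true_000 : full true 0 0 0.
Proof.
move=> w _; rewrite (_ : mode _ _ _ = (- w ax3) *: mode true (fun=> 0) ((-1) *: vec3 0 0 1)).
  by apply: reachZ; exact: reach_C.
rewrite -modeZ (_ : fr 0 0 0 = (fun=> 0)); last by apply/funext => i; exact: fr0E.
apply: eq_mode; apply: ord3P; [by right; exists ax3|by right; exists ax3|left].
by rewrite !fctE /vec3/= /GRing.scale/=; ring.
Qed.

Hypothesis C_base0 : [/\ forall z, full z 1%N 1%N 0, full true 1%N 0%N 0,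
  full true 2%N 0%N 0, full true 0%N 1%N 0 & full true 0%N 2%N 0].

Lemma full_zero z (x y : nat) : full z x y 0.
Proof.
have [f11 f10 f20 f01 f02] := C_base0.
have two_step (P : nat -> Prop) : P 0%N -> P 1%N ->
    (forall x, (0 < x)%N -> P x.-1 -> P x.+1) -> forall x, P x.
  move=> P0 P1 PS n; suff : P n /\ P n.+1 by case.
  by elim: n => [//|n [IH1 IH2]]; split=> //; exact: PS.
case: z.
- have e1 : forall x : nat, full true x 0%N 0.
    apply: two_step => [||x0 x0_gt0 IH]; [exact: full_true_000|exact: f10|].
    have [x1|x1] := leqP x0 1; last exact: full_true_step1.
    (* The exceptional step from 1 to 2, where the recurrence degenerates: (2,0,0) is a starting
       frequency. *)
    by have -> : x0 = 1%N by lia.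
  have e2 : forall y : nat, full true 0%N y 0.
    apply: two_step => [||y0 y0_gt0 IH]; [exact: full_true_000|exact: f01|].
    have [y1|y1] := leqP y0 1; last exact: full_true_step2.
    by have -> : y0 = 1%N by lia.
  have e3 : forall y : nat, full true 1%N y 0.
    by apply: two_step => [||y0 y0_gt0 IH]; [exact: e1|exact: f11|exact: full_true_step2].
  move: x; apply: two_step => [||x0 x0_gt0 IH]; [exact: e2|exact: e3|].
  have [y0|y0] := posnP y; first by rewrite y0; exact: e1.
  by apply: full_true_step1 => //; rewrite y0.
- have [y0|y0] := posnP y; first by apply: full_false_edge; right.
  have e3 : full false 1%N y 0.
    move: y {y0}; apply: two_step => [||y0 y0_gt0 IH]; [|exact: f11|exact: full_false_step2].
    by apply: full_false_edge; right.
  move: x; apply: two_step => [||x0 x0_gt0 IH]; [|exact: e3|exact: full_false_step1].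
  by apply: full_false_edge; left.
Qed.

Lemma full_all z (x y t : nat) : full z x y t.
Proof. by case: t => [|t]; [exact: full_zero|exact: (@fullb_pos t.+1)]. Qed.

End Saturation.

(** * Density *)

Section Thresholds.
Variable R : realType.

Lemma bernoulli_ineq (x : R) n : -1 <= x -> 1 + n%:R * x <= (1 + x) ^+ n.
Proof.
move=> x1; elim: n => [|n IH]; first by rewrite mul0r addr0 expr0.
rewrite exprSr; apply: le_trans (ler_wpM2r _ IH); last lra.
have n0 : 0 <= n%:R * x ^+ 2 by rewrite mulr_ge0 ?sqr_ge0.
by rewrite -natr1; nra.
Qed.

(* As m grows this tends to 1 if q < 1/2 and to 0 if 1/2 <= q <= 1, because
   (m * 4 ^ m) q ^ (2 m) = m (2 q) ^ (2 m). *)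
Definition threshold (m : nat) (q : R) : R :=
  (1 - q ^+ (2 * m)%N) ^+ (m * 4 ^ m)%N.

Lemma threshold_bounds m q : 0 <= q <= 1 -> 0 <= threshold m q <= 1.
Proof.
move=> /andP[q0 q1]; have qm0 : 0 <= q ^+ (2 * m)%N by exact: exprn_ge0.
have qm1 : q ^+ (2 * m)%N <= 1 by exact: exprn_ile1.
by rewrite exprn_ge0 ?exprn_ile1//; lra.
Qed.

Lemma exponent_threshold m (q : R) :
  (m * 4 ^ m)%:R * q ^+ (2 * m)%N = m%:R * ((2 * q) ^+ m) ^+ 2.
Proof.
rewrite natrM natrX -mulrA exprM -exprMn exprAC.
by congr (_ * _ ^+ _); ring.
Qed.

(** Bernoulli bounds the threshold below by 1 - m r^2 with r = (1 - h)^m and h = 1 - 2q. A second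
    use of Bernoulli, (1 + h)^m >= h (m + 1), together with (1 - h)(1 + h) <= 1, gives r <= 1 / (h
    (m + 1)). *)
Lemma threshold_low m (q : R) : 0 <= q < 1 / 2 ->
  1 - (1 - 2 * q) ^- 2 * harmonic m <= threshold m q.
Proof.
move=> /andP[q0 q12]; have qm1 : q ^+ (2 * m)%N <= 1 by apply: exprn_ile1; lra.
set h := 1 - 2 * q; have h0 : 0 < h by rewrite /h; lra.
have := @bernoulli_ineq (- q ^+ (2 * m)%N) (m * 4 ^ m)%N; rewrite mulrN exponent_threshold.
move=> B; apply: le_trans (B _); last by rewrite lerNr opprK.
rewrite lerD2l lerN2.
set r := (2 * q) ^+ m; have r0 : 0 <= r by rewrite exprn_ge0// mulr_ge0.
have hr : r * (h * m.+1%:R) <= 1.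
  apply: (@le_trans _ _ (r * (1 + h) ^+ m)).
    rewrite ler_wpM2l//; apply: le_trans (bernoulli_ineq m _); last lra.
    by rewrite -natr1 mulrDr mulr1 mulrC [leRHS]addrC lerD2l /h; lra.
  rewrite /r -exprMn exprn_ile1// /h; nra.
have m1 : 0 < m.+1%:R :> R by rewrite ltr0n.
have hm : 0 < h * m.+1%:R by rewrite mulr_gt0.
have rle : r <= (h * m.+1%:R)^-1 by rewrite -[leRHS]div1r ler_pdivlMr.
apply: (@le_trans _ _ (m.+1%:R * ((h * m.+1%:R)^-1) ^+ 2)).
  apply: ler_pM => //; [exact: sqr_ge0|by rewrite ler_nat|].
  by rewrite lerXn2r ?nnegrE// invr_ge0 ltW.
rewrite /harmonic/= le_eqVlt; apply/orP; left; apply/eqP.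
have uE (u v : R) : 0 < u -> 0 < v -> u * ((v * u)^-1) ^+ 2 = v ^- 2 * u^-1.
  by move=> u0 v0; field; rewrite !gt_eqF.
exact: uE.
Qed.

(** With x = q^(2m) and M the outer exponent, (1 - x)^M (1 + x)^M <= 1, while Bernoulli gives (1 +
    x)^M >= 1 + M x >= 1 + m. *)
Lemma threshold_high m (q : R) : 1 / 2 <= q <= 1 -> threshold m q <= harmonic m.
Proof.
move=> /andP[q12 q1]; set x := q ^+ (2 * m)%N; have q0 : 0 <= q by lra.
have x0 : 0 <= x by exact: exprn_ge0.
have x1 : x <= 1 by exact: exprn_ile1.
set M := (m * 4 ^ m)%N.
have Mx : m%:R <= M%:R * x.
  rewrite exponent_threshold ler_peMr// -exprM exprn_ege1//; lra.
have B : m.+1%:R <= (1 + x) ^+ M.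
  apply: le_trans (bernoulli_ineq M _); last lra.
  by rewrite -natr1 addrC lerD2l.
have m1 : 0 < m.+1%:R :> R by rewrite ltr0n.
rewrite /harmonic /threshold -/x -/M -[leRHS]div1r ler_pdivlMr//.
apply: (@le_trans _ _ ((1 - x) ^+ M * (1 + x) ^+ M)).
  by rewrite ler_wpM2l// exprn_ge0//; lra.
by rewrite -exprMn exprn_ile1//; nra.
Qed.

Lemma cvg_threshold (q : R) : 0 <= q <= 1 ->
  threshold m q @[m --> \oo] --> ((q < 1 / 2)%R%:R : R).
Proof.
move=> /andP[q0 q1]; have [q12|q12] := ltP q (1 / 2).
- apply: (@squeeze_cvgr _ _ _ _ (fun m => 1 - (1 - 2 * q) ^- 2 * harmonic m) (fun=> 1)).
  + near=> m; rewrite threshold_low ?q0//=.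
    by have /andP[] : 0 <= threshold m q <= 1 by apply: threshold_bounds; rewrite q0.
  + rewrite -[X in _ --> X]subr0; apply: cvgB; first exact: cvg_cst.
    rewrite -[X in _ --> X](mulr0 ((1 - 2 * q) ^- 2)); apply: cvgM; first exact: cvg_cst.
    exact: cvg_harmonic.
  + exact: cvg_cst.
- apply: (@squeeze_cvgr _ _ _ _ (fun=> 0) harmonic).
  + near=> m; rewrite threshold_high ?q12// andbT.
    by have /andP[] : 0 <= threshold m q <= 1 by apply: threshold_bounds; rewrite q0.
  + exact: cvg_cst.
  + exact: cvg_harmonic.
Unshelve. all: by end_near. Qed.

End Thresholds.

Section TrigPolynomials.
Variables (R : realType) (L : 'I_3 -> R).
Notation sfield := (R * R * R -> R).
Local Notation fr := (fr L).

(** Only cosines in x_1 and x_2, but both sine and cosine in x_3: cosines already separate the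
    points of (0, L_1) and (0, L_2), and products with [weight] are then components of modes. *)
Definition tpoly : set sfield :=
  lspan [set f | exists s (x y t : int), f = pot s (fr x y t)].

Lemma tpoly_pot s x y t : tpoly (pot s (fr x y t)).
Proof. by apply: lspan_sub; exists s, x, y, t. Qed.

Lemma tpoly_smooth f : tpoly f -> smooth f.
Proof.
apply: lspan_min; [|exact: smoothD|exact: smoothZ|].
- rewrite -(scale0r (pot false (fr 0 0 0))); apply: smoothZ; exact: smooth_pot.
- by move=> _ [s [x [y [t ->]]]]; exact: smooth_pot.
Qed.

Lemma pot_mul s s' (k k' : 'I_3 -> R) :
  pot s k * pot s' k' =
  \sum_(r <- signs) (8^-1 * csign s s' (rho R r)) *: pot (s (+) s') (k + hmul (rho R r) k').
Proof.
have cP (s0 t y : R) : cos ((s0 + 1 * t) * y) = cos (s0 * y) * cos (t * y) - sin (s0 * y) * sin (t * y).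
  by rewrite mul1r mulrDl cosD.
have cM (s0 t y : R) : cos ((s0 + -1 * t) * y) = cos (s0 * y) * cos (t * y) + sin (s0 * y) * sin (t * y).
  by rewrite mulN1r mulrBl cosB.
have sP (s0 t y : R) : sin ((s0 + 1 * t) * y) = sin (s0 * y) * cos (t * y) + cos (s0 * y) * sin (t * y).
  by rewrite mul1r mulrDl sinD.
have sM (s0 t y : R) : sin ((s0 + -1 * t) * y) = sin (s0 * y) * cos (t * y) - cos (s0 * y) * sin (t * y).
  by rewrite mulN1r mulrBl sinB.
apply/funext => -[[x y] t].
rewrite /signs !big_cons big_nil addr0 !fctE /pot /trig3 /csign /rho /hmul /GRing.scale.
case: s; case: s'; rewrite /= /vec3/= !(cP, cM, sP, sM); rewrite /trig; field; by [].
Qed.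

Lemma fr_hmul x y t x' y' t' r : exists a b c,
  fr x y t + hmul (rho R r) (fr x' y' t') = fr a b c.
Proof.
exists (x + sz r.1.1 * x'), (y + sz r.1.2 * y'), (t + sz r.2 * t').
have rE s : (if s then -1 else 1) = (sz s)%:~R :> R by case: s.
by apply/funext; apply: ord3P; rewrite !fctE /hmul /rho /fr /vec3/= !rE rmorphD rmorphM/=; ring.
Qed.

Lemma tpolyM f g : tpoly f -> tpoly g -> tpoly (f * g).
Proof.
move=> Af; move: g; apply: lspan_min.
- by rewrite mulr0; exact: lspan0.
- by move=> u v; rewrite mulrDr; exact: lspanD.
- move=> c u; rewrite (_ : f * (c *: u) = c *: (f * u)); first exact: lspanZ.
  by apply/funext => x; exact: mulrCA.
move=> _ [s [x [y [t ->]]]]; move: f Af; apply: lspan_min.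
- by rewrite mul0r; exact: lspan0.
- by move=> u v; rewrite mulrDl; exact: lspanD.
- move=> c u; rewrite (_ : (c *: u) * _ = c *: (u * pot s (fr x y t))).
    exact: lspanZ.
  by apply/funext => w; exact: (esym (mulrA c (u w) _)).
move=> _ [s' [x' [y' [t' ->]]]]; rewrite pot_mul.
elim/big_ind: _ => [|u v|r _]; [exact: lspan0|exact: lspanD|].
have [a [b [c ->]]] := fr_hmul x' y' t' x y t r.
by apply: lspanZ; exact: tpoly_pot.
Qed.

Lemma tpoly1 : tpoly 1.
Proof.
rewrite (_ : 1 = pot false (fr 0 0 0)); first exact: tpoly_pot.
apply/funext => x; rewrite -[LHS]/(1 : R) /pot /trig3 !fr0E !mul0r.
by rewrite -[RHS]/(cos 0 * cos 0 * cos 0) cos0 !mulr1.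
Qed.

Lemma tpolyX f n : tpoly f -> tpoly (f ^+ n).
Proof.
move=> Af; elim: n => [|n IH]; first by rewrite expr0; exact: tpoly1.
by rewrite exprS; exact: tpolyM.
Qed.

Lemma tpolyB f g : tpoly f -> tpoly g -> tpoly (f - g).
Proof. by move=> Af Ag; rewrite -scaleN1r; apply: lspanD => //; exact: lspanZ. Qed.

Lemma tpoly_threshold m f : tpoly f -> tpoly (fun x => threshold m (f x)).
Proof.
move=> Af; rewrite (_ : (fun _ => _) = (1 - f ^+ (2 * m)%N) ^+ (m * 4 ^ m)%N).
  by apply: tpolyX; apply: tpolyB; [exact: tpoly1|exact: tpolyX].
have XE (g : sfield) n x : (g ^+ n) x = g x ^+ n.
  by elim: n => [//|n IH]; rewrite !exprS -IH.
by apply/funext => x; rewrite XE /threshold -[(1 - _) x]/(1 - (f ^+ (2 * m)%N) x) XE.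
Qed.

End TrigPolynomials.

(** * Mean-square approximation by weighted trigonometric polynomials *)

Section LfunTwo.
Context d (T : measurableType d) (R : realType).
Variable mu : {measure set T -> \bar R}.
Implicit Types f g : T -> R.
Local Notation L2f f := (f \in Lfun mu 2%:E).

Lemma Lfun2_add f g : L2f f -> L2f g -> L2f (fun x => f x + g x).
Proof.
move=> /Lfun2P[mf f2] /Lfun2P[mg g2].
have mfg : measurable_fun setT (fun x => f x + g x) by exact: measurable_funD.
apply/Lfun2P; split => //.
apply: (@le_integrable _ _ _ mu setT measurableT _ (EFin \o (fun x => 2 * f x ^+ 2 + 2 * g x ^+ 2))).
- by apply/measurable_EFinP; exact: measurable_funX.
- move=> x _ /=; rewrite lee_fin; apply: le_trans (ler_norm _); rewrite ger0_norm ?sqr_ge0//.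
  by have := sqr_ge0 (f x - g x); nra.
- exact: (integrable_addr (integrable_mull f2 2) (integrable_mull g2 2)).
Qed.

Lemma Lfun2_mull (c : R) f : L2f f -> L2f (fun x => c * f x).
Proof.
move=> /Lfun2P[mf f2]; apply/Lfun2P; split; first exact: measurable_funM.
rewrite (_ : (fun x => _) = (fun x => c ^+ 2 * f x ^+ 2)); first exact: (integrable_mull f2).
by apply/funext => x; rewrite exprMn.
Qed.

Lemma Lfun2_sub f g : L2f f -> L2f g -> L2f (fun x => f x - g x).
Proof.
move=> hf hg; rewrite (_ : (fun x => _) = (fun x => f x + (-1) * g x)).
  by apply: Lfun2_add => //; exact: Lfun2_mull.
by apply/funext => x; rewrite mulN1r.
Qed.

Lemma sq_integrable f : L2f f -> mu.-integrable setT (EFin \o (fun x => f x ^+ 2)).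
Proof. by move=> /Lfun2P[]. Qed.

Lemma sq_add_le f g : L2f f -> L2f g ->
  \int[mu]_x (f x + g x) ^+ 2 <=
  2 * \int[mu]_x (f x ^+ 2) + 2 * \int[mu]_x (g x ^+ 2).
Proof.
move=> hf hg; have if2 := sq_integrable hf; have ig2 := sq_integrable hg.
rewrite -!RintegralZl// -Rintegral_add; [|exact: (integrable_mull if2)|exact: (integrable_mull ig2)].
apply: le_Rintegral => //.
- by apply: sq_integrable; exact: Lfun2_add.
- exact: (integrable_addr (integrable_mull if2 2) (integrable_mull ig2 2)).
- by move=> x _; have := sqr_ge0 (f x - g x); nra.
Qed.

End LfunTwo.

Section MeanSquare.
Variables (R : realType) (L : 'I_3 -> R).
Notation sfield := (R * R * R -> R).
Let mR := measurableTypeR R.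
Let leb := @lebesgue_measure R.
Local Notation muO := (muO L).
Local Notation cell := (cell L).
Local Notation L2f f := (f \in Lfun muO 2%:E).
Implicit Types f g : sfield.

(** The null slice x_3 = 0 is given up because periodic functions cannot separate 0 from the end of
    the period: at x_3 = 0 the polynomial of [coord_threshold3] equals 1/2, the critical value of
    the threshold. *)
Lemma ae_muO (P : R * R * R -> Prop) :
  (forall x, cell x -> x.2 != 0 -> P x) -> {ae muO, forall x, P x}.
Proof.
move=> HP; exists ((~` cell) `|` (setT `*` [set 0] : set (mR * mR * mR))).
have m0 : measurable (setT `*` [set 0] : set (mR * mR * mR)).
  by apply: measurableX => //; exact: measurable_set1.
have mc : measurable (~` cell : set (mR * mR * mR)).
  by apply: measurableC; exact: measurable_cell.
split; first exact: measurableU.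
  apply/eqP; rewrite eq_le measure_ge0 andbT.
  apply: (le_trans (measureU2 _ mc m0)); rewrite /= /mrestr setICl measure0 add0e.
  apply: (@le_trans _ _ ((leb \x leb \x leb)%E (setT `*` [set 0] : set (mR * mR * mR)))).
    by apply: le_measure; rewrite ?inE//; apply: measurableI => //; exact: measurable_cell.
  by rewrite product_measure1E//= lebesgue_measure_set1 mule0.
move=> x /= nP; have [cx|] := pselect (cell x); last by left.
by right; split => //=; apply/eqP; apply: contra_notT nP; exact: HP.
Qed.

Lemma cvg_mean_square (f_ : nat -> sfield) f g :
  (forall n, L2f (f_ n)) -> L2f f -> L2f g ->
  (forall x, cell x -> x.2 != 0 -> f_ n x @[n --> \oo] --> f x) ->
  (forall n x, cell x -> `|f_ n x| <= g x) -> (forall x, cell x -> `|f x| <= g x) ->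
  (fun n => \int[muO]_x ((f x - f_ n x) ^+ 2)) @ \oo --> (0 : R).
Proof.
move=> hfn hf hg fnf fng fg.
pose F n x := ((f x - f_ n x) ^+ 2)%:E.
have mF n : measurable_fun setT (F n : mR * mR * mR -> \bar R).
  have /Lfun2P[+ _] := Lfun2_sub hf (hfn n).
  by move=> h; apply/measurable_EFinP; exact: measurable_funX.
have [||||_ _ H] := @dominated_convergence _ _ _ muO setT measurableT F (cst 0%E)
    (EFin \o (fun x => 4 * g x ^+ 2)) mF.
- exact: measurable_cst.
- apply: ae_muO => x cx x3 _; rewrite /F /cst.
  apply: cvg_EFin; first by near=> n.
  have c0 : (fun n => f x - f_ n x) @ \oo --> (0 : R).
    by rewrite -(subrr (f x)); apply: cvgB; [exact: cvg_cst|exact: fnf].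
  by rewrite -(mulr0 (0 : R)); exact: cvgM.
- by apply: integrable_mull; exact: sq_integrable.
- apply: ae_muO => x cx x3 n _; rewrite /F /= lee_fin ger0_norm ?sqr_ge0//.
  have := fng n x cx; have := fg x cx; rewrite !ler_norml => /andP[? ?] /andP[? ?]; nra.
move: H; rewrite integral0 => H.
exact: (fine_cvg H).
Unshelve. all: by end_near. Qed.

End MeanSquare.

Section Approximation.
Variables (R : realType) (L : 'I_3 -> R).
Notation sfield := (R * R * R -> R).
Let mR := measurableTypeR R.
Local Notation muO := (muO L).
Local Notation cell := (cell L).
Local Notation L2f f := (f \in Lfun muO 2%:E).
Implicit Types f g s p : sfield.

Definition msq f : R := \int[muO]_x (f x ^+ 2).

(** The weight [s] is 1 in the measure-theoretic argument on indicators and a sine vanishing on two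
    faces in the final approximation of a component. *)
Definition approximable s f : Prop :=
  forall e, 0 < e -> exists2 p, tpoly L p & msq (fun x => f x - s x * p x) < e.

Lemma msq_ge0 f : 0 <= msq f.
Proof. by apply: Rintegral_ge0 => x _; exact: sqr_ge0. Qed.

Lemma msqD_lt f g (e : R) : L2f f -> L2f g -> msq f < e / 4 -> msq g < e / 4 ->
  msq (fun x => f x + g x) < e.
Proof.
move=> hf hg fe ge.
have h : msq (fun x => f x + g x) <= 2 * msq f + 2 * msq g := sq_add_le hf hg.
apply: (le_lt_trans h); move: (msq f) (msq g) fe ge => a b; lra.
Qed.

Lemma continuous_L2 f : continuous f -> L2f f.
Proof.
move=> cf; apply: bounded_L2_muO; first exact: continuous_measurable3.
exact: continuous_cell_bounded.
Qed.

Section Weight.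
Variable s : sfield.
Hypotheses (cs : continuous s) (s1 : forall x, `|s x| <= 1).

Lemma weighted_L2 p : tpoly L p -> L2f (fun x => s x * p x).
Proof.
move=> /tpoly_smooth/smooth_continuous cp; apply: continuous_L2 => x.
by apply: cvgM; [exact: cs|exact: cp].
Qed.

Lemma approximable_close f : L2f f ->
  (forall e, 0 < e -> exists g, [/\ L2f g, approximable s g &
     msq (fun x => f x - g x) < e]) -> approximable s f.
Proof.
move=> hf H e e0; have e4 : 0 < e / 4 by rewrite divr_gt0.
have [g [hg ag fg]] := H _ e4; have [p Ap gp] := ag _ e4.
exists p => //; rewrite (_ : (fun x => _) = (fun x => (f x - g x) + (g x - s x * p x))).
  by apply: msqD_lt => //; apply: Lfun2_sub => //; exact: weighted_L2.
by apply/funext => x; rewrite addrA subrK.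
Qed.

Lemma approximable_lim (f_ : nat -> sfield) f g :
  (forall n, L2f (f_ n)) -> L2f f -> L2f g ->
  (forall x, cell x -> x.2 != 0 -> f_ n x @[n --> \oo] --> f x) ->
  (forall n x, cell x -> `|f_ n x| <= g x) -> (forall x, cell x -> `|f x| <= g x) ->
  (forall n, approximable s (f_ n)) -> approximable s f.
Proof.
move=> hfn hf hg fnf fng fg afn; apply: approximable_close => // e e0.
have /cvgrPdist_lt/(_ _ e0)[N _ /(_ N (leqnn N))] :=
  cvg_mean_square hfn hf hg fnf fng fg.
rewrite sub0r normrN ger0_norm ?msq_ge0// => NE.
by exists (f_ N).
Qed.

Lemma approximableD f g : L2f f -> L2f g ->
  approximable s f -> approximable s g -> approximable s (fun x => f x + g x).
Proof.
move=> hf hg af ag e e0; have e4 : 0 < e / 4 by rewrite divr_gt0.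
have [p Ap fp] := af _ e4; have [q Aq gq] := ag _ e4.
exists (p + q); first exact: lspanD.
rewrite (_ : (fun x => _) = (fun x => (f x - s x * p x) + (g x - s x * q x))).
  by apply: msqD_lt => //; apply: Lfun2_sub => //; exact: weighted_L2.
by apply/funext => x; rewrite -[(p + q) x]/(p x + q x); ring.
Qed.

Lemma approximableZ (c : R) f : L2f f -> approximable s f ->
  approximable s (fun x => c * f x).
Proof.
move=> hf af e e0; have c0 : 0 < c ^+ 2 + 1 by rewrite ltr_wpDl ?sqr_ge0.
have [p Ap fp] := af _ (divr_gt0 e0 c0); exists (c *: p); first exact: lspanZ.
rewrite (_ : msq _ = c ^+ 2 * msq (fun x => f x - s x * p x)).
  rewrite ltr_pdivlMr// in fp; apply: le_lt_trans fp.
  by rewrite mulrC ler_wpM2l ?msq_ge0// lerDl.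
rewrite /msq -RintegralZl//; last first.
  by apply: sq_integrable; apply: Lfun2_sub => //; exact: weighted_L2.
apply: eq_Rintegral => x _; rewrite -[(c *: p) x]/(c * p x); ring.
Qed.

Lemma approximable_weight f : L2f f -> approximable 1 f ->
  approximable s (fun x => s x * f x).
Proof.
move=> hf af e e0; have [p Ap fp] := af _ e0; exists p => //.
apply: le_lt_trans fp.
have hp : L2f p by apply: smooth_Lfun; exact: tpoly_smooth Ap.
have hfp := Lfun2_sub hf hp.
have mfp : measurable_fun setT (fun x => f x - p x : R) by have /Lfun2P[] := hfp.
apply: le_Rintegral => //.
- apply: (le_integrable measurableT _ _ (sq_integrable hfp)).
    apply/measurable_EFinP; apply: measurable_funX.
    rewrite (_ : (fun x => _) = (fun x => s x * (f x - p x))).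
      by apply: measurable_funM => //; exact: continuous_measurable3.
    by apply/funext => x; rewrite mulrBr.
  move=> x _; rewrite /= lee_fin -mulrBr exprMn normrM ler_piMl// normrX.
  by rewrite exprn_ile1.
- rewrite (_ : (fun x => _) = (fun x => f x - p x) ^+ 2); first exact: sq_integrable.
  by apply/funext => x; rewrite -[1 x]/(1 : R) mul1r.
- move=> x _; rewrite -mulrBr exprMn -[1 x]/(1 : R) mul1r ler_piMl ?sqr_ge0//.
  by rewrite -real_normK ?num_real// exprn_ile1.
Qed.

End Weight.

Lemma cst1_continuous : continuous (1 : sfield).
Proof. by move=> x; exact: cvg_cst. Qed.

Local Notation limA := (approximable_lim cst1_continuous).

Definition good_set (A : set (R * R * R)) : Prop := approximable 1 (\1_A : sfield).

Lemma indic_L2 (A : set (mR * mR * mR)) : measurable A -> L2f (\1_A : sfield).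
Proof.
move=> mA; apply: bounded_L2_muO.
  exact: measurable_indic.
by exists 1 => x _; rewrite indicE normr_nat lern1 leq_b1.
Qed.

Lemma indic_norm_le (A : set (R * R * R)) x : `|\1_A x| <= 1 :> R.
Proof. by rewrite indicE normr_nat lern1 leq_b1. Qed.

Lemma one_L2 : L2f (fun=> 1 : R).
Proof. by apply: continuous_L2 => x; exact: cvg_cst. Qed.

Lemma good_set_ext (A B : set (mR * mR * mR)) : measurable A -> measurable B ->
  (forall x, cell x -> x.2 != 0 -> A x <-> B x) -> good_set A -> good_set B.
Proof.
move=> mA mB AB gA; apply: (limA (f_ := fun=> \1_A) (g := fun=> 1)) => //.
- by move=> _; exact: indic_L2.
- exact: indic_L2.
- exact: one_L2.
- move=> x cx x3; rewrite !indicE; have -> : (x \in A) = (x \in B).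
    by apply/idP/idP; rewrite !inE => /(AB x cx x3).
  exact: cvg_cst.
- by move=> _ x _; exact: indic_norm_le.
- by move=> x _; exact: indic_norm_le.
Qed.

Lemma good_setD (A B : set (mR * mR * mR)) : measurable A -> measurable B ->
  B `<=` A -> good_set A -> good_set B -> good_set (A `\` B).
Proof.
move=> mA mB BA gA gB; rewrite /good_set.
rewrite (_ : \1_(A `\` B) = (fun x => \1_A x + (-1) * \1_B x) :> sfield).
  apply: approximableD => //; [exact: cst1_continuous|exact: indic_L2|
    by apply: Lfun2_mull; exact: indic_L2|].
  by apply: approximableZ => //; [exact: cst1_continuous|exact: indic_L2].
apply/funext => x; rewrite !indicE in_setD.
have [xB|xB] := boolP (x \in B); last by rewrite andbT mulr0 addr0.
by rewrite (mem_set (BA x (set_mem xB))) mulN1r subrr.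
Qed.

Lemma good_setU (A B : set (mR * mR * mR)) : measurable A -> measurable B ->
  A `&` B = set0 -> good_set A -> good_set B -> good_set (A `|` B).
Proof.
move=> mA mB AB gA gB; rewrite /good_set.
rewrite (_ : \1_(A `|` B) = (fun x => \1_A x + \1_B x) :> sfield).
  by apply: approximableD => //; [exact: cst1_continuous|exact: indic_L2|exact: indic_L2].
apply/funext => x; rewrite !indicE in_setU.
have [xA|xA] := boolP (x \in A); have [xB|xB] := boolP (x \in B); rewrite ?addr0 ?add0r//.
suff : (A `&` B) x by rewrite AB.
by split; exact: set_mem.
Qed.

Lemma good_set0 : good_set set0.
Proof.
rewrite /good_set indic0 => e e0; exists 0; first exact: lspan0.
rewrite /msq (_ : (fun x => _) = cst 0); first by rewrite /Rintegral integral0.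
by apply/funext => x; rewrite /= -[0 x]/(0 : R) mulr0 subrr expr0n.
Qed.

Lemma good_set_bigcup (F : nat -> set (mR * mR * mR)) : (forall n, measurable (F n)) ->
  trivIset setT F -> (forall n, good_set (F n)) -> good_set (\bigcup_n F n).
Proof.
move=> mF tF gF; pose U n := \big[setU/set0]_(i < n) F i.
have mU n : measurable (U n) by exact: bigsetU_measurable.
have gU n : good_set (U n).
  elim: n => [|n IH]; first by rewrite /U big_ord0; exact: good_set0.
  rewrite (_ : U n.+1 = U n `|` F n); last by rewrite /U big_ord_recr.
  apply: good_setU => //; rewrite /U -bigcup_mkord; apply/seteqP; split => // x [[i /= ni Fix] Fnx].
  have /trivIsetP/(_ i n I I) := tF; rewrite ltn_eqF// => /(_ isT).
  by move=> E; have : (F i `&` F n) x by []; rewrite E.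
apply: (limA (f_ := fun n => \1_(U n)) (g := fun=> 1)) => //.
- by move=> n; exact: indic_L2.
- by apply: indic_L2; exact: bigcup_measurable.
- exact: one_L2.
- move=> x _ _; rewrite !indicE; have [|xF] := boolP (x \in \bigcup_n F n).
    move=> /set_mem[n _ Fnx]; apply: cvg_near_cst; near=> m.
    rewrite indicE mem_set// /U -bigcup_mkord; exists n => //=; near: m; exact: nbhs_infty_gt.
  apply: cvg_near_cst; near=> m; rewrite indicE memNset// /U -bigcup_mkord => -[n _ Fnx].
  by move: xF; rewrite notin_setE; apply; exists n.
- by move=> n x _; exact: indic_norm_le.
- by move=> x _; exact: indic_norm_le.
Unshelve. all: by end_near. Qed.

(** Relative to a fixed [B] and along a map [f], typically a projection, so that the generators can
    be replaced by arbitrary measurable sets one factor at a time. *)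
Lemma good_set_dynkin d (T : measurableType d) (f : mR * mR * mR -> T)
    (B : set (mR * mR * mR)) (G : set (set T)) :
  measurable_fun setT f -> measurable B ->
  @measurable _ T = <<s G >> -> setI_closed G -> good_set B ->
  (forall A, G A -> good_set (f @^-1` A `&` B)) ->
  forall A, measurable A -> good_set (f @^-1` A `&` B).
Proof.
move=> mf mB GE GI gB gG A; rewrite GE.
have mpre S : measurable S -> measurable (f @^-1` S `&` B).
  by move=> mS; apply: measurableI => //; rewrite -[X in measurable X]setTI; exact: mf.
apply: (dynkin_induction (P := fun A => good_set (f @^-1` A `&` B)) GE GI) => //.
- by rewrite preimage_setT setTI.
- move=> S mS gS; rewrite preimage_setC.
  rewrite (_ : ~` (f @^-1` S) `&` B = B `\` (f @^-1` S `&` B)).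
    by apply: good_setD => //; first [exact: mpre | exact: subIsetr].
  by rewrite setDIr setDv setU0 setDE setIC.
- move=> F mF tF gF; rewrite preimage_bigcup setI_bigcupl.
  apply: good_set_bigcup => //; first by move=> n; exact: mpre.
  apply/trivIsetP => i j _ _ ij; have /trivIsetP/(_ i j I I ij) := tF.
  move=> FF; rewrite setIACA -preimage_setI FF preimage_set0 set0I//.
Qed.

End Approximation.

(** * From rays to boxes to measurable sets *)

Section Boxes.
Variables (R : realType) (L : 'I_3 -> R).
Hypothesis L_gt0 : forall i, 0 < L i.
Notation sfield := (R * R * R -> R).
Let mR := measurableTypeR R.
Local Notation muO := (muO L).
Local Notation cell := (cell L).
Local Notation al := (unit_freq L).
Local Notation fr := (fr L).
Implicit Types f g s p q : sfield.

Definition coord_threshold (i : 'I_3) (a : R) : Prop :=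
  exists phi : nat -> sfield, [/\ forall n, tpoly L (phi n),
    forall n x, 0 <= phi n x <= 1 &
    forall x, cell x -> x.2 != 0 -> phi n x @[n --> \oo] --> ((crd x i < a)%R%:R : R)].

Lemma coord_threshold_of i a q : tpoly L q -> (forall x, 0 <= q x <= 1) ->
  (forall x, cell x -> x.2 != 0 -> (q x < 1 / 2) = (crd x i < a)) ->
  coord_threshold i a.
Proof.
move=> tq q01 qa; exists (fun m x => threshold m (q x)); split.
- by move=> m; exact: tpoly_threshold.
- by move=> m x; exact: threshold_bounds.
- by move=> x cx x3; rewrite -qa//; exact: cvg_threshold.
Qed.

Lemma coord_threshold_cst i a (b : bool) :
  (forall x, cell x -> (crd x i < a) = b) -> coord_threshold i a.
Proof.
move=> xb; exists (fun _ => (b%:R : R) *: (1 : sfield)); split.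
- by move=> _; apply: lspanZ; exact: tpoly1.
- by move=> _ x; rewrite -[(_ *: _) x]/(b%:R * 1 : R) mulr1; case: (b); rewrite ?lexx ?ler01.
- move=> x cx _; rewrite xb// -[X in _ --> X]mulr1; exact: cvg_cst.
Qed.

(** Cosine decreases on [0, pi], so x_i < a amounts to cos (al_i a) < cos (al_i x_i), that is q <
    1/2; the factor 1/4 keeps [q] within [0, 1]. Values of [a] outside (0, L_i) give a constant
    condition on the cell. *)
Lemma coord_threshold_half i a (c : sfield) : tpoly L c ->
  (forall x, c x = cos (al i * crd x i)) -> (forall x, cell x -> 0 < crd x i < L i) ->
  coord_threshold i a.
Proof.
move=> tc cE ci.
have [a0|a0] := leP a 0.
  apply: (@coord_threshold_cst _ _ false) => x /ci /andP[x0 _].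
  by apply/negbTE; rewrite -leNgt (le_trans a0)// ltW.
have [aL|aL] := leP (L i) a.
  by apply: (@coord_threshold_cst _ _ true) => x /ci /andP[_ xL]; exact: lt_le_trans xL aL.
have ali := al_gt0 L_gt0 i.
have alL : al i * L i = pi by rewrite /unit_freq divfK// gt_eqF.
pose q := (1 / 2 + cos (al i * a) / 4) *: (1 : sfield) + (- (1 / 4)) *: c.
have qE x : q x = 1 / 2 + cos (al i * a) / 4 - cos (al i * crd x i) / 4.
  by rewrite -[q x]/((1 / 2 + cos (al i * a) / 4) * 1 + (- (1 / 4)) * c x) cE; lra.
apply: (@coord_threshold_of _ _ q).
- by apply: lspanD; apply: lspanZ => //; exact: tpoly1.
- move=> x; rewrite qE; have := cos_le1 (al i * a); have := cos_geN1 (al i * a).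
  by have := cos_le1 (al i * crd x i); have := cos_geN1 (al i * crd x i); lra.
- move=> x /ci /andP[x0 xL] _; rewrite qE.
  transitivity (cos (al i * a) < cos (al i * crd x i)); first by apply/idP/idP => ?; lra.
  have hI t : 0 < t < L i -> al i * t \in `[0, pi]%R.
    by move=> /andP[t0 tL]; rewrite in_itv/= -alL ler_pM2l// (ltW tL) mulr_ge0// ltW.
  by rewrite ltr_cos ?ltr_pM2l//; apply: hI; apply/andP; split.
Qed.

Lemma coord_threshold1 a : coord_threshold ax1 a.
Proof.
apply: (@coord_threshold_half _ _ (pot false (fr 1 0 0))); first exact: tpoly_pot.
- move=> x; rewrite /pot /trig3 /fr /vec3/= !mul0r cos0 !mulr1 mul1r.
  by [].
- by move=> x /mem_cell[].
Qed.

Lemma coord_threshold2 a : coord_threshold ax2 a.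
Proof.
apply: (@coord_threshold_half _ _ (pot false (fr 0 1 0))); first exact: tpoly_pot.
- move=> x; rewrite /pot /trig3 /fr /vec3/= !mul0r cos0 !mulr1 !mul1r.
  by [].
- by move=> x /mem_cell[].
Qed.

(** On the circle, 0 < x_3 < a is the arc centred at h = a/2 with half-length h. It is described by
    cos (k (x_3 - h)) > cos (k h), which expands into the cosine and the sine of k x_3. *)
Lemma coord_threshold3 a : coord_threshold ax3 a.
Proof.
have c3 x : cell x -> 0 <= crd x ax3 < 2 * L ax3 by move=> /mem_cell[].
have [a0|a0] := leP a 0.
  apply: (@coord_threshold_cst _ _ false) => x /c3 /andP[x0 _].
  by apply/negbTE; rewrite -leNgt (le_trans a0).
have [aL|aL] := leP (2 * L ax3) a.
  by apply: (@coord_threshold_cst _ _ true) => x /c3 /andP[_ xL]; exact: lt_le_trans xL aL.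
set h := a / 2; pose k := al ax3.
have k0 : 0 < k := al_gt0 L_gt0 ax3.
have kL : k * L ax3 = pi by rewrite /k /unit_freq divfK// gt_eqF.
pose q := (1 / 2 + cos (k * h) / 4) *: (1 : sfield) + (- (cos (k * h) / 4)) *: pot false (fr 0 0 1)
  + (- (sin (k * h) / 4)) *: pot true (fr 0 0 1).
have qE x : q x = 1 / 2 + cos (k * h) / 4 - cos (k * (crd x ax3 - h)) / 4.
  rewrite -[q x]/((1 / 2 + cos (k * h) / 4) * 1 + (- (cos (k * h) / 4)) * pot false (fr 0 0 1) x
  + (- (sin (k * h) / 4)) * pot true (fr 0 0 1) x).
  rewrite /pot /trig3 /fr /vec3/= !mul0r cos0 !mul1r mulrBr cosB /crd /vec3/= -/k; lra.
apply: (@coord_threshold_of _ _ q).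
- by apply: lspanD; [apply: lspanD|]; apply: lspanZ; first [exact: tpoly1|exact: tpoly_pot].
- move=> x; rewrite qE; have := cos_le1 (k * h); have := cos_geN1 (k * h).
  by have := cos_le1 (k * (crd x ax3 - h)); have := cos_geN1 (k * (crd x ax3 - h)); lra.
- move=> x /c3; rewrite -[x.2]/(crd x ax3); set t := crd x ax3 => /andP[t0 tL] tN0.
  have tp : 0 < t by rewrite lt_neqAle eq_sym tN0.
  rewrite qE -/t; transitivity (cos (k * h) < cos (k * (t - h))); first by apply/idP/idP => ?; lra.
  have hI : k * h \in `[0, pi]%R by rewrite in_itv/= -kL; apply/andP; rewrite /h; split; nra.
  have ah : a = 2 * h by rewrite /h; lra.
  (* Cosine is monotone only up to half a period. Beyond it, [t] is closer to [h] the other way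
     round the circle, at distance 2 L_3 - (t - h), which is still at least [h]. *)
  have [th|th] := leP `|t - h| (L ax3).
  + rewrite -[cos (k * (t - h))]cos_norm normrM (gtr0_norm k0) ltr_cos ?ltr_pM2l//.
      by rewrite ltr_norml; apply/andP/idP => [[? ?]|?]; [|split]; lra.
    by rewrite in_itv/= -kL ler_pM2l// th mulr_ge0// ltW.
  + have hL : h < L ax3 by rewrite /h; lra.
    have th' : L ax3 < t - h.
      by move: th; rewrite ltr_normr => /orP[//|]; lra.
    have -> : cos (k * (t - h)) = cos (k * (2 * L ax3 - (t - h))).
      have -> : k * (2 * L ax3 - (t - h)) = - (k * (t - h)) + pi *+ 2.
        by rewrite -kL -mulr_natl; ring.
      by rewrite cosD2pi cosN.
    have sI : k * (2 * L ax3 - (t - h)) \in `[0, pi]%R.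
      by rewrite in_itv/= -kL; apply/andP; split; nra.
    rewrite ltr_cos// ltr_pM2l//.
    by transitivity false; [apply/negbTE; rewrite -leNgt; lra|
      apply/esym/negbTE; rewrite -leNgt; lra].
Qed.

Definition box3 (A1 A2 A3 : set mR) : set (mR * mR * mR) :=
  [set x | [/\ A1 x.1.1, A2 x.1.2 & A3 x.2]].

Lemma measurable_box3 A1 A2 A3 : measurable A1 -> measurable A2 -> measurable A3 ->
  measurable (box3 A1 A2 A3).
Proof.
move=> m1 m2 m3; rewrite (_ : box3 _ _ _ = A1 `*` A2 `*` A3).
  by apply: measurableX => //; exact: measurableX.
by apply/seteqP; split=> [x []|x [[]]].
Qed.

Lemma good_box_rays a1 a2 a3 : good_set L (box3 `]-oo, a1[ `]-oo, a2[ `]-oo, a3[).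
Proof.
have [p1 [t1 b1 c1]] := coord_threshold1 a1.
have [p2 [t2 b2 c2]] := coord_threshold2 a2.
have [p3 [t3 b3 c3]] := coord_threshold3 a3.
have tp n : tpoly L (p1 n * p2 n * p3 n).
  by apply: tpolyM => //; exact: tpolyM.
apply: (approximable_lim (@cst1_continuous R) (f_ := fun n => p1 n * p2 n * p3 n) (g := fun=> 1)).
- by move=> n; apply: smooth_Lfun; exact: tpoly_smooth (tp n).
- apply: indic_L2; apply: measurable_box3; exact: measurable_itv.
- exact: one_L2.
- move=> x cx x3; rewrite indicE.
  have -> : (x \in box3 `]-oo, a1[ `]-oo, a2[ `]-oo, a3[)%:R =
    (crd x ax1 < a1)%R%:R * (crd x ax2 < a2)%R%:R * (crd x ax3 < a3)%R%:R :> R.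
    rewrite -!natrM !mulnb; congr (nat_of_bool _)%:R.
    apply/idP/idP => [/set_mem[]|/andP[/andP[h1 h2] h3]].
      by rewrite /= !in_itv/= => -> -> ->.
    by apply/mem_set; split; rewrite /= in_itv/=.
  by apply: cvgM; [apply: cvgM; [exact: c1|exact: c2]|exact: c3].
- move=> n x _; rewrite -[(_ * _) x]/(p1 n x * p2 n x * p3 n x).
  have /andP[? ?] := b1 n x; have /andP[? ?] := b2 n x; have /andP[? ?] := b3 n x.
  rewrite ger0_norm ?mulr_ge0//; apply: mulr_ile1 => //; first exact: mulr_ge0.
  exact: mulr_ile1.
- by move=> x _; exact: indic_norm_le.
- move=> n e e0; exists (p1 n * p2 n * p3 n) => //.
  rewrite /msq (_ : (fun x => _) = cst 0); first by rewrite /Rintegral integral0.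
  by apply/funext => x; rewrite -[1 x]/(1 : R) mul1r subrr expr0n.
Qed.

Lemma rays_setI : setI_closed (@RGenInftyO.G R).
Proof.
move=> _ _ [a ->] [b ->]; exists (Num.min a b).
by apply/seteqP; split=> x /=; rewrite !in_itv/= lt_min => /andP.
Qed.

Let mrays := @RGenInftyO.measurableE R.

Lemma good_box_3 a1 a2 A3 : measurable A3 -> good_set L (box3 `]-oo, a1[ `]-oo, a2[ A3).
Proof.
move=> mA3; rewrite (_ : box3 _ _ _ = snd @^-1` A3 `&` box3 `]-oo, a1[ `]-oo, a2[ setT); last first.
  by apply/seteqP; split=> [x []|x [? []]].
apply: (good_set_dynkin _ _ mrays rays_setI) => //.
- by apply: measurable_box3 => //; exact: measurable_itv.
(* On the cell, the ray ending at the length of the side imposes nothing, so it stands for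
   [setT]. *)
- apply: good_set_ext (good_box_rays a1 a2 (2 * L ax3)).
  + by apply: measurable_box3; exact: measurable_itv.
  + by apply: measurable_box3 => //; exact: measurable_itv.
  + move=> x /mem_cell[_ _ /andP[_ x3]] _.
    by split=> -[h1 h2 h3]; split=> //; rewrite /= in_itv/=.
- move=> _ [a3 ->]; rewrite (_ : _ `&` _ = box3 `]-oo, a1[ `]-oo, a2[ `]-oo, a3[).
    exact: good_box_rays.
  by apply/seteqP; split=> [x [? []]|x []].
Qed.

Lemma good_box_23 a1 A2 A3 : measurable A2 -> measurable A3 ->
  good_set L (box3 `]-oo, a1[ A2 A3).
Proof.
move=> mA2 mA3; rewrite (_ : box3 _ _ _ = (snd \o fst) @^-1` A2 `&` box3 `]-oo, a1[ setT A3); last first.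
  by apply/seteqP; split=> [x []|x [? []]].
apply: (good_set_dynkin _ _ mrays rays_setI) => //.
- exact: measurableT_comp.
- by apply: measurable_box3 => //; exact: measurable_itv.
- apply: good_set_ext (good_box_3 a1 (L ax2) mA3).
  + by apply: measurable_box3 => //; exact: measurable_itv.
  + by apply: measurable_box3 => //; exact: measurable_itv.
  + move=> x /mem_cell[_ /andP[_ x2] _] _.
    by split=> -[h1 h2 h3]; split=> //; rewrite /= in_itv/=.
- move=> _ [a2 ->]; rewrite (_ : _ `&` _ = box3 `]-oo, a1[ `]-oo, a2[ A3).
    exact: good_box_3.
  by apply/seteqP; split=> [x [? []]|x []].
Qed.

Lemma good_box A1 A2 A3 : measurable A1 -> measurable A2 -> measurable A3 ->
  good_set L (box3 A1 A2 A3).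
Proof.
move=> mA1 mA2 mA3; rewrite (_ : box3 _ _ _ = (fst \o fst) @^-1` A1 `&` box3 setT A2 A3); last first.
  by apply/seteqP; split=> [x []|x [? []]].
apply: (good_set_dynkin _ _ mrays rays_setI) => //.
- exact: measurableT_comp.
- exact: measurable_box3.
- apply: good_set_ext (good_box_23 (L ax1) mA2 mA3).
  + by apply: measurable_box3 => //; exact: measurable_itv.
  + exact: measurable_box3.
  + move=> x /mem_cell[/andP[_ x1] _ _] _.
    by split=> -[h1 h2 h3]; split=> //; rewrite /= in_itv/=.
- move=> _ [a1 ->]; rewrite (_ : _ `&` _ = box3 `]-oo, a1[ A2 A3).
    exact: good_box_23.
  by apply/seteqP; split=> [x [? []]|x []].
Qed.

Lemma rectangles_setI d1 d2 (T1 : measurableType d1) (T2 : measurableType d2) :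
  setI_closed [set A `*` B | A in @measurable _ T1 & B in @measurable _ T2].
Proof.
move=> _ _ [A1 mA1 [B1 mB1 <-]] [A2 mA2 [B2 mB2 <-]].
exists (A1 `&` A2); first exact: measurableI.
by exists (B1 `&` B2); [exact: measurableI|rewrite setXI].
Qed.

Lemma good_cylinder (B : set (mR * mR)) A3 : measurable B -> measurable A3 ->
  good_set L (B `*` A3).
Proof.
move=> mB mA3; rewrite (_ : B `*` A3 = fst @^-1` B `&` box3 setT setT A3); last first.
  by apply/seteqP; split=> [x []|x [? []]].
apply: (good_set_dynkin _ _ (measurable_prod_measurableType _ _) (@rectangles_setI _ _ _ _)) => //.
- exact: measurable_box3.
- exact: good_box.
- move=> _ [A1 mA1 [A2 mA2 <-]]; rewrite (_ : _ `&` _ = box3 A1 A2 A3); first exact: good_box.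
  by apply/seteqP; split=> [x [[? ?] []]|x []].
Qed.

Lemma good_measurable (A : set (mR * mR * mR)) : measurable A -> good_set L A.
Proof.
move=> mA; rewrite (_ : A = id @^-1` A `&` setT); last by rewrite setIT.
apply: (good_set_dynkin _ _ (measurable_prod_measurableType _ _) (@rectangles_setI _ _ _ _)) => //.
- rewrite (_ : setT = setT `*` setT); first exact: good_cylinder.
  by apply/seteqP; split.
- by move=> _ [B mB [A3 mA3 <-]]; rewrite setIT; exact: good_cylinder.
Qed.

End Boxes.

Section WeightedApproximation.
Import HBNNSimple.
Variables (R : realType) (L : 'I_3 -> R).
Hypothesis L_gt0 : forall i, 0 < L i.
Notation sfield := (R * R * R -> R).
Let mR := measurableTypeR R.
Local Notation muO := (muO L).
Local Notation cell := (cell L).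
Local Notation L2f f := (f \in Lfun muO 2%:E).

Lemma approximable_step n (c : 'I_n -> R) (A : 'I_n -> set (mR * mR * mR)) :
  (forall i, measurable (A i)) ->
  approximable L 1 (fun x => \sum_i c i * \1_(A i) x) /\
  L2f (fun x => \sum_i c i * \1_(A i) x : R).
Proof.
move=> mA; elim: n => [|n IH] in c A mA *.
  rewrite (_ : (fun x => _) = \1_set0); last first.
    by apply/funext => x; rewrite big_ord0 indic0.
  by split; [exact: good_set0|exact: indic_L2].
rewrite (_ : (fun x => _) = (fun x => \sum_(i < n) c (widen_ord (leqnSn n) i) *
    \1_(A (widen_ord (leqnSn n) i)) x + c ord_max * \1_(A ord_max) x)); last first.
  by apply/funext => x; rewrite big_ord_recr.
have [a1 h1] := IH (fun i => c (widen_ord (leqnSn n) i)) _ (fun i => mA (widen_ord (leqnSn n) i)).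
have h2 : L2f (\1_(A ord_max) : sfield) by exact: indic_L2.
split; last by apply: Lfun2_add => //; exact: Lfun2_mull.
apply: approximableD => //; [exact: cst1_continuous|exact: Lfun2_mull|].
by apply: approximableZ => //; [exact: cst1_continuous|exact: good_measurable].
Qed.

Lemma measurable_funV : measurable_fun setT (GRing.inv : mR -> mR).
Proof.
have -> : setT = [set x | x != 0] `|` [set 0] :> set mR.
  by apply/seteqP; split=> // x _ /=; have [->|] := eqVneq x 0; [right|left].
have o0 : open ([set x | x != 0] : set R).
  rewrite (_ : [set x | x != 0] = ~` [set 0]); first by apply: closed_openC; exact: closed_eq.
  by apply/seteqP; split=> x /= /eqP.
apply/measurable_funU; [exact: open_measurable|exact: measurable_set1|split].
  apply: open_continuous_measurable_fun => // x; rewrite inE /=; exact: inv_continuous.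
exact: measurable_fun_set1.
Qed.

Lemma Lfun2_norm (f : sfield) : L2f f -> L2f (fun x => `|f x|).
Proof.
move=> /Lfun2P[mf f2]; apply/Lfun2P; split; first exact: measurableT_comp.
rewrite (_ : (fun x => _) = (fun x => f x ^+ 2)) //.
by apply/funext => x; rewrite real_normK ?num_real.
Qed.

Lemma Lfun2_le (f g : sfield) : measurable_fun setT (f : mR * mR * mR -> mR) -> L2f g ->
  (forall x, `|f x| <= `|g x|) -> L2f f.
Proof.
move=> mf /Lfun2P[mg g2] fg; apply/Lfun2P; split => //.
apply: (le_integrable measurableT _ _ g2).
  by apply/measurable_EFinP; exact: measurable_funX.
by move=> x _; rewrite /= lee_fin !normrX lerXn2r ?nnegrE.
Qed.

Section Weight.
Variable s : sfield.
Hypotheses (cs : continuous s) (s1 : forall x, `|s x| <= 1).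

(** Square integrability is known for [s * g] only, since [g] will be a quotient by [s]. Simple
    functions increasing to [g] are square integrable, and their products with [s] are dominated by
    [s * g]. *)
Lemma approximable_weight_ge0 (g : sfield) : measurable_fun setT (g : mR * mR * mR -> mR) ->
  (forall x, 0 <= g x) -> L2f (fun x => s x * g x) ->
  approximable L s (fun x => s x * g x).
Proof.
move=> mg g0 hsg.
have mg' : measurable_fun setT (EFin \o g : mR * mR * mR -> \bar R).
  exact/measurable_EFinP.
pose G := nnsfun_approx measurableT mg'.
have Gg n x : G n x <= g x.
  by rewrite -lee_fin nnsfun_approxE; apply: le_approx => // y _; rewrite lee_fin.
have stepG n : approximable L 1 (G n) /\ L2f (G n : sfield).
  have -> : (G n : sfield) = _ := funext (fimfunEord (G n)).
  exact: approximable_step.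
have aG n := (stepG n).1; have hG n := (stepG n).2.
have hs n : L2f (fun x => s x * G n x).
  apply: Lfun2_le (hG n) _.
    have /Lfun2P[mG _] := hG n; apply: measurable_funM => //; exact: continuous_measurable3.
  by move=> x; rewrite normrM ler_piMl.
apply: (approximable_lim cs (f_ := fun n x => s x * G n x) (g := fun x => `|s x * g x|)) => //.
- exact: Lfun2_norm.
- move=> x _ _; apply: cvgM; first exact: cvg_cst.
  have := @cvg_nnsfun_approx _ _ _ _ measurableT _ mg' (fun y _ => g0 y) x I.
  by move=> /fine_cvgP[].
- by move=> n x _; rewrite !normrM ler_wpM2l// !ger0_norm.
- by move=> n; exact: approximable_weight.
Qed.

Lemma L2_approximable f : (forall x, cell x -> s x != 0) -> L2f f -> approximable L s f.
Proof.
move=> s0 hf; pose g x := f x / s x.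
have mf : measurable_fun setT (f : mR * mR * mR -> mR) by have /Lfun2P[] := hf.
have ms : measurable_fun setT (s : mR * mR * mR -> mR) by exact: continuous_measurable3.
have mg : measurable_fun setT (g : mR * mR * mR -> mR).
  by apply: measurable_funM => //; apply: measurableT_comp => //; exact: measurable_funV.
(* Outside the cell [s] may vanish; the quotient is then 0 by convention and the bound still
   holds. *)
have sg_le x : `|s x * g x| <= `|f x|.
  rewrite /g mulrCA normrM ler_piMr//; have [->|sx] := eqVneq (s x) 0.
    by rewrite mul0r normr0 ler01.
  by rewrite divff// normr1.
have hp (h : sfield) : measurable_fun setT (h : mR * mR * mR -> mR) ->
    (forall x, 0 <= h x) -> (forall x, h x <= `|g x|) ->
    L2f (fun x => s x * h x) /\ approximable L s (fun x => s x * h x).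
  move=> mh h0 hg.
  have H : L2f (fun x => s x * h x).
    apply: Lfun2_le hf _; first exact: measurable_funM.
    move=> x; apply: le_trans (sg_le x).
    by rewrite normrM [leRHS]normrM ler_wpM2l// ger0_norm.
  by split => //; exact: approximable_weight_ge0.
have mN : measurable_fun setT (fun x => - g x : mR) by exact: measurableT_comp.
have max_ge0 (t : R) : 0 <= Num.max t 0 by rewrite le_max lexx orbT.
have [h1 a1] : L2f (fun x => s x * Num.max (g x) 0) /\ approximable L s (fun x => s x * Num.max (g x) 0).
  apply: hp => //; first exact: (measurable_maxr mg (measurable_cst _)).
  by move=> x; rewrite ge_max ler_norm normr_ge0.
have [h2 a2] : L2f (fun x => s x * Num.max (- g x) 0) /\ approximable L s (fun x => s x * Num.max (- g x) 0).
  apply: hp => //; first exact: (measurable_maxr mN (measurable_cst _)).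
  by move=> x; rewrite ge_max normr_ge0 andbT -normrN ler_norm.
have hE x : cell x -> s x * Num.max (g x) 0 + (-1) * (s x * Num.max (- g x) 0) = f x.
  move=> /s0 sx; transitivity (s x * g x); last by rewrite /g mulrCA divff// mulr1.
  rewrite mulrCA -mulrDr mulN1r; congr (_ * _).
  by move: (g x) => t; rewrite !maxr_absE !subr0 !addr0 normrN; lra.
apply: (approximable_lim cs (f_ := fun _ x => s x * Num.max (g x) 0 +
    (-1) * (s x * Num.max (- g x) 0)) (g := fun x => `|f x|)).
- by move=> _; apply: Lfun2_add => //; exact: Lfun2_mull.
- exact: hf.
- exact: Lfun2_norm.
- by move=> x cx _; rewrite hE//; exact: cvg_cst.
- by move=> _ x cx; rewrite hE.
- by [].
- move=> _; apply: approximableD => //; first exact: Lfun2_mull.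
  exact: approximableZ.
Qed.

End Weight.
End WeightedApproximation.

(** * Approximation of a field of H by reached modes *)

Section Density.
Variables (R : realType) (L : 'I_3 -> R).
Hypothesis L_gt0 : forall i, 0 < L i.
Notation sfield := (R * R * R -> R).
Notation vfield := ('I_3 -> R * R * R -> R).
Local Notation muO := (muO L).
Local Notation cell := (cell L).
Local Notation L2f f := (f \in Lfun muO 2%:E).
Local Notation al := (unit_freq L).
Local Notation fr := (fr L).
Variable C : set vfield.
Local Notation reach := (reach L C).

(* The sine vanishing on the faces orthogonal to e_i (1 if i = 3): a trigonometric
   polynomial times [weight i] is the i-th component of a combination of modes. *)
Definition weight (i : 'I_3) : sfield :=
  trig3 (fun j => (j == i) && (j != ax3)) (fr (i == ax1 : nat) (i == ax2 : nat) 0).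

Lemma weight_le1 i x : `|weight i x| <= 1.
Proof.
have t1 s (y : R) : `|trig s y| <= 1.
  by case: s; rewrite ler_norml; [rewrite sin_geN1 sin_le1|rewrite cos_geN1 cos_le1].
by rewrite /weight /trig3 !normrM !mulr_ile1 ?mulr_ge0.
Qed.

Lemma weight_neq0 i x : cell x -> weight i x != 0.
Proof.
have sp j t : 0 < t < L j -> sin (al j * t) != 0.
  move=> /andP[t0 tL]; have aj := al_gt0 L_gt0 j.
  have ajL : al j * L j = pi by rewrite /unit_freq divfK// gt_eqF.
  by rewrite gt_eqF// sin_gt0_pi// mulr_gt0//= -ajL ltr_pM2l.
move=> /mem_cell[x1 x2 _]; elim/ord3P: i; rewrite /weight /trig3 /fr /vec3/= !mul0r cos0 ?mulr1 ?mul1r.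
- exact: sp x1.
- exact: sp x2.
- exact: oner_neq0.
Qed.

Definition component (i : 'I_3) (f : sfield) : vfield := fun j x => if j == i then f x else 0.

Definition decomposable (v : vfield) : Prop :=
  exists P phi, [/\ reach P, good L P, nice L phi & v = P + grad phi].

Lemma decomposable0 : decomposable 0.
Proof.
exists 0, (0 *: pot false 0); split; [exact: reach0|exact: good0| |].
  by apply: niceZ; apply: nice_trig3 => //; exact: adm0.
by rewrite add0r; apply/funext => i; rewrite /grad partialZ ?scale0r//; exact: smooth_pot.
Qed.

Lemma decomposableD u v : decomposable u -> decomposable v -> decomposable (u + v).
Proof.
move=> [P [phi [rP gP nphi ->]]] [Q [psi [rQ gQ npsi ->]]].
exists (P + Q), (phi + psi); split; [exact: reachD|exact: goodD|exact: niceD|].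
rewrite addrACA; congr (_ + _); apply/funext => i.
by rewrite /grad partialD//; [exact: nphi.1|exact: npsi.1].
Qed.

Lemma decomposableZ (c : R) u : decomposable u -> decomposable (c *: u).
Proof.
move=> [P [phi [rP gP nphi ->]]].
exists (c *: P), (c *: phi); split; [exact: reachZ|exact: goodZ|exact: niceZ|].
rewrite scalerDr; congr (_ + _); apply/funext => i.
by rewrite /grad partialZ//; exact: nphi.1.
Qed.

Lemma component0 i : component i 0 = 0.
Proof. by apply/funext => j; apply/funext => x; rewrite /component; case: ifP. Qed.

Lemma componentD i f g : component i (f + g) = component i f + component i g.
Proof.
apply/funext => j; apply/funext => x; rewrite /component.
rewrite -[RHS]/((if j == i then f x else 0) + (if j == i then g x else 0)).
by case: ifP => // _; rewrite addr0.
Qed.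

Lemma componentZ i (c : R) f : component i (c *: f) = c *: component i f.
Proof.
apply/funext => j; apply/funext => x; rewrite /component.
rewrite -[RHS]/(c * (if j == i then f x else 0)).
by case: ifP => // _; rewrite mulr0.
Qed.

Hypothesis full_modes : forall z (x y t : nat), full L C z x y t.

Lemma full_int z (x y t : int) : full L C z x y t.
Proof.
have full3 (a b : nat) (c : int) : full L C z a b c.
  by case: c => n; [exact: full_modes|rewrite NegzE; apply: fullN3; exact: full_modes].
have full2 (a : nat) (b c : int) : full L C z a b c.
  by case: b => n; [exact: full3|rewrite NegzE; apply: fullN2; exact: full3].
by case: x => n; [exact: full2|rewrite NegzE; apply: fullN1; exact: full2].
Qed.

Lemma decomposable_mode z x y t w : decomposable (mode z (fr x y t) w).
Proof.
rewrite mode_decomp; eexists; eexists; split; last by [].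
- by apply: full_int; exact: dot_perp_proj.
- by apply: good_mode => //; [exact: adm_fr|exact: dot_perp_proj].
- by apply: niceZ; apply: nice_trig3 => //; exact: adm_fr.
Qed.

(** In the directions 1 and 2, sine times cosine is half a difference of sines with frequencies
    shifted by 1, so the field is a combination of two modes of amplitude e_i. In the direction 3
    the opposite family already has the required factor. *)
Lemma decomposable_component i p : tpoly L p -> decomposable (component i (weight i * p)).
Proof.
move: p; apply: lspan_min.
- by rewrite mulr0 component0; exact: decomposable0.
- by move=> p q; rewrite mulrDr componentD; exact: decomposableD.
- move=> c p; rewrite (_ : weight i * (c *: p) = c *: (weight i * p)); last first.
    by apply/funext => x; exact: mulrCA.
  by rewrite componentZ; exact: decomposableZ.
move=> _ [z [x [y [t ->]]]].
have sP (a s b : R) : sin (1 * a * s) * cos (b * a * s) =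
    2^-1 * sin ((b + 1) * a * s) - 2^-1 * sin ((b - 1) * a * s).
  rewrite -!mulrA !mul1r mulrDl mulrBl mul1r sinD sinB; field; by [].
elim/ord3P: i.
- rewrite (_ : component _ _ = 2^-1 *: mode z (fr (x + 1) y t) (vec3 1 0 0) +
                               (- 2^-1) *: mode z (fr (x - 1) y t) (vec3 1 0 0)).
    by apply: decomposableD; apply: decomposableZ; exact: decomposable_mode.
  apply/funext => j; apply/funext => q.
  rewrite -[RHS]/(2^-1 * mode z (fr (x + 1) y t) (vec3 1 0 0) j q +
                  (- 2^-1) * mode z (fr (x - 1) y t) (vec3 1 0 0) j q).
  rewrite /component /mode; elim/ord3P: j => /=; last 2 first.
  + by rewrite /vec3/= !(mulr0, mul0r) addr0.
  + by rewrite /vec3/= !(mulr0, mul0r) addr0.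
  rewrite -[X in X = _]/(weight ax1 q * pot z (fr x y t) q) /weight /pot /trig3 /parity /fr /msign /vec3/=.
  rewrite !andbF /= !mul0r cos0 !mulr1 rmorphD rmorphB/= rmorph1.
  rewrite [LHS](_ : _ = (sin (1 * al ax1 * q.1.1) * cos (x%:~R * al ax1 * q.1.1)) *
    cos (y%:~R * al ax2 * q.1.2) * trig z (t%:~R * al ax3 * q.2)).
    by rewrite sP andbT; ring.
  by rewrite andbT; ring.
- rewrite (_ : component _ _ = 2^-1 *: mode z (fr x (y + 1) t) (vec3 0 1 0) +
                               (- 2^-1) *: mode z (fr x (y - 1) t) (vec3 0 1 0)).
    by apply: decomposableD; apply: decomposableZ; exact: decomposable_mode.
  apply/funext => j; apply/funext => q.
  rewrite -[RHS]/(2^-1 * mode z (fr x (y + 1) t) (vec3 0 1 0) j q +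
                  (- 2^-1) * mode z (fr x (y - 1) t) (vec3 0 1 0) j q).
  rewrite /component /mode; elim/ord3P: j => /=.
  + by rewrite /vec3/= !(mulr0, mul0r) addr0.
  + rewrite -[X in X = _]/(weight ax2 q * pot z (fr x y t) q) /weight /pot /trig3 /parity /fr /msign /vec3/=.
    rewrite !andbF /= !mul0r cos0 !mulr1 rmorphD rmorphB/= rmorph1.
    rewrite [LHS](_ : _ = (sin (1 * al ax2 * q.1.2) * cos (y%:~R * al ax2 * q.1.2)) *
      cos (x%:~R * al ax1 * q.1.1) * trig z (t%:~R * al ax3 * q.2)).
      by rewrite sP andbT; ring.
    by rewrite andbT; ring.
  + by rewrite /vec3/= !(mulr0, mul0r) addr0.
- rewrite (_ : component _ _ = mode (~~ z) (fr x y t) (vec3 0 0 (if z then 1 else -1))).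
    exact: decomposable_mode.
  apply/funext => j; apply/funext => q.
  rewrite /component /mode; elim/ord3P: j => /=.
  + by rewrite /vec3/= !(mulr0, mul0r).
  + by rewrite /vec3/= !(mulr0, mul0r).
  rewrite -[X in X = _]/(weight ax3 q * pot z (fr x y t) q) /weight /pot /trig3 /parity /fr /msign /vec3/=.
  by rewrite !mul0r cos0 !mul1r; case: (z) => /=; ring.
Qed.

Lemma Lfun2_Rintegral_sub (f g h : sfield) : L2f f -> L2f g -> L2f h ->
  \int[muO]_x ((f x - g x) * h x) = \int[muO]_x (f x * h x) - \int[muO]_x (g x * h x).
Proof.
move=> hf hg hh; rewrite -[X in _ + X]mulN1r -RintegralZl//; last exact: Lfun2_integrableM.
have e1 := Lfun2_integrableM hf hh.
have e2 := integrable_mull (Lfun2_integrableM hg hh) (-1).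
apply: etrans _ (Rintegral_add e1 e2).
by apply: eq_Rintegral => x _; ring.
Qed.

(* h - P lies in H, hence is orthogonal to grad phi: Pythagoras. *)
Lemma dist_leray_le h P phi : H L h -> good L P -> nice L phi ->
  dotL2 L (h - P) (h - P) <= dotL2 L (h - (P + grad phi)) (h - (P + grad phi)).
Proof.
move=> Hh gP nphi; have HP := good_H L_gt0 gP.
have [L2h _ _] := Hh; have [L2P _ _] := HP.
have hg i : L2f (grad phi i).
  by apply: smooth_Lfun; apply: smooth_partial; exact: nphi.1.
have hq i : L2f (fun x => h i x - P i x).
  by apply: Lfun2_sub; [exact: (L2h i).2|exact: (L2P i).2].
have hd i : L2f (fun x => (h i x - P i x) - grad phi i x) by exact: Lfun2_sub.
have I1 i : \int[muO]_x ((h i x - P i x) * (h i x - P i x)) <=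
   \int[muO]_x (((h i x - P i x) - grad phi i x) * ((h i x - P i x) - grad phi i x)) +
   2 * (\int[muO]_x (h i x * grad phi i x) - \int[muO]_x (P i x * grad phi i x)).
  rewrite -Lfun2_Rintegral_sub//; [|exact: (L2h i).2|exact: (L2P i).2].
  have iqg := Lfun2_integrableM (hq i) (hg i).
  have idd := Lfun2_integrableM (hd i) (hd i).
  rewrite -RintegralZl//.
  apply: le_trans (_ : _ <= \int[muO]_x (((h i x - P i x) - grad phi i x) *
     ((h i x - P i x) - grad phi i x) + 2 * ((h i x - P i x) * grad phi i x))) _.
    apply: le_Rintegral => //.
    - exact: Lfun2_integrableM.
    - exact: (integrable_addr idd (integrable_mull iqg 2)).
    - move=> x _; have := sqr_ge0 (grad phi i x); nra.
  by rewrite (Rintegral_add idd (integrable_mull iqg 2)).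
have dE u v : dotL2 L u v = \sum_(i < 3) \int[muO]_x (u i x * v i x) by [].
apply: (@le_trans _ _ (\sum_(i < 3) (\int[muO]_x
   (((h i x - P i x) - grad phi i x) * ((h i x - P i x) - grad phi i x)) +
   2 * (\int[muO]_x (h i x * grad phi i x) - \int[muO]_x (P i x * grad phi i x))))).
  by apply: ler_sum => i _; exact: I1.
rewrite big_split/= -mulr_sumr sumrB -!dE (grad_orth_H Hh nphi) (grad_orth_H HP nphi).
rewrite subrr mulr0 addr0 le_eqVlt; apply/orP; left; apply/eqP; apply: eq_bigr => i _.
apply: eq_Rintegral => x _.
by rewrite -[(h - (P + grad phi)) i x]/(h i x - (P i x + grad phi i x)) opprD addrA.
Qed.

Lemma reach_dense h (eps : R) : H L h -> 0 < eps -> exists2 g, reach g & normL2 L (h - g) < eps.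
Proof.
move=> Hh eps0; have [L2h _ _] := Hh.
have e0 : 0 < eps ^+ 2 / 3 by rewrite divr_gt0// exprn_gt0.
have ap i := L2_approximable L_gt0 (@continuous_trig3 _ _ _) (weight_le1 i)
  (fun x => @weight_neq0 i x) (L2h i).2 e0.
have {ap}[p [tp hp]] : exists p : 'I_3 -> sfield, (forall i, tpoly L (p i)) /\
    forall i, msq L (fun x => h i x - weight i x * p i x) < eps ^+ 2 / 3.
  have := fun i => cid2 (ap i) => A.
  by exists (fun i => s2val (A i)); split=> i; [exact: (s2valP (A i))|exact: (s2valP' (A i))].
pose v := component ax1 (weight ax1 * p ax1) + component ax2 (weight ax2 * p ax2) +
  component ax3 (weight ax3 * p ax3).
have [P [phi [rP gP nphi vE]]] : decomposable v.
  by apply: decomposableD; [apply: decomposableD|]; exact: decomposable_component.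
exists P => //; rewrite /normL2.
rewrite -[ltRHS]ger0_norm ?ltW// -sqrtr_sqr ltr_sqrt ?exprn_gt0//.
apply: (le_lt_trans (dist_leray_le Hh gP nphi)); rewrite -vE /dotL2 sum3E.
have vi i : \int[muO]_x ((h - v) i x * (h - v) i x) < eps ^+ 2 / 3.
  apply: le_lt_trans (hp i); rewrite le_eqVlt; apply/orP; left; apply/eqP.
  apply: eq_Rintegral => x _; rewrite expr2; suff -> : (h - v) i x = h i x - weight i x * p i x by [].
  rewrite -[LHS]/(h i x - (component ax1 (weight ax1 * p ax1) i x +
     component ax2 (weight ax2 * p ax2) i x + component ax3 (weight ax3 * p ax3) i x)).
  by congr (_ - _); elim/ord3P: i {hp tp}; rewrite /component/= ?addr0 ?add0r.
have := vi ax1; have := vi ax2; have := vi ax3; lra.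
Qed.

End Density.

(** * The generating set *)

Section GeneratingSet.
Variables (R : realType) (L : 'I_3 -> R).
Hypothesis L_gt0 : forall i, 0 < L i.
Local Notation al := (unit_freq L).
Local Notation fr := (fr L).
Implicit Types (k n : 'I_3 -> nat) (a b w : 'I_3 -> R).

Definition freq k : 'I_3 -> R := fr (k ax1) (k ax2) (k ax3).

Lemma freqE k i : freq k i = (k i)%:R * al i.
Proof. by move: i; apply: ord3P; rewrite /freq /fr /vec3/=. Qed.

Lemma trig_freq s k i (t : R) : trig s ((k i)%:R * pi * t / L i) = trig s (freq k i * t).
Proof. by rewrite freqE /unit_freq; congr (trig s _); rewrite !mulrA mulrAC. Qed.

Lemma Ck_trig k i x : Ck L k i x = trig false (freq k i * crd x i).
Proof. exact: (trig_freq false k i). Qed.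

Lemma Sk_trig k i x : Sk L k i x = trig true (freq k i * crd x i).
Proof. exact: (trig_freq true k i). Qed.

Lemma Y_mode w k : Y L w k = mode false (freq k) w.
Proof.
apply/funext; apply: ord3P; apply/funext => x.
- transitivity (w ax1 * Sk L k ax1 x * Ck L k ax2 x * Ck L k ax3 x); first by [].
  by rewrite !Ck_trig !Sk_trig /mode /trig3 /msign /= mul1r !mulrA.
- transitivity (w ax2 * Ck L k ax1 x * Sk L k ax2 x * Ck L k ax3 x); first by [].
  by rewrite !Ck_trig !Sk_trig /mode /trig3 /msign /= mul1r !mulrA.
- transitivity (w ax3 * Ck L k ax1 x * Ck L k ax2 x * Sk L k ax3 x); first by [].
  by rewrite !Ck_trig !Sk_trig /mode /trig3 /msign /= mul1r !mulrA.
Qed.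

Lemma Z_mode w k : Z L w k = mode true (freq k) w.
Proof.
apply/funext; apply: ord3P; apply/funext => x.
- transitivity (w ax1 * Sk L k ax1 x * Ck L k ax2 x * Sk L k ax3 x); first by [].
  by rewrite !Ck_trig !Sk_trig /mode /trig3 /msign /= mul1r !mulrA.
- transitivity (w ax2 * Ck L k ax1 x * Sk L k ax2 x * Sk L k ax3 x); first by [].
  by rewrite !Ck_trig !Sk_trig /mode /trig3 /msign /= mul1r !mulrA.
- transitivity (- w ax3 * Ck L k ax1 x * Ck L k ax2 x * Ck L k ax3 x); first by [].
  by rewrite !Ck_trig /mode /trig3 /msign /= mulN1r !mulrA.
Qed.

Lemma dot_freq w k : dot w (freq k) = pi * \sum_(i < 3) w i * (k i)%:R / L i.
Proof.
by rewrite /dot mulr_sumr; apply: eq_bigr => i _; rewrite freqE /unit_freq; ring.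
Qed.

Lemma perp_dot w k : perpL L k w -> dot w (freq k) = 0.
Proof. by case=> _ w0 _; rewrite dot_freq w0 mulr0. Qed.

Lemma num0E k : num0 k = ((k ax1 == 0) + (k ax2 == 0) + (k ax3 == 0))%N.
Proof.
rewrite /num0 -sum1_card big_mkcond; apply: etrans (sum3E _) _.
by congr (_ + _ + _)%N; rewrite inE; case: eqP.
Qed.

(** The squared determinant is the Gram determinant, which for an orthogonal family is the product
    of the squared norms. The coefficient along [k] is then 0 because [w] is orthogonal to [k]. *)
Lemma orth_span a b (k : 'I_3 -> R) w : dot a k = 0 -> dot b k = 0 -> dot a b = 0 ->
  a != 0 -> b != 0 -> k != 0 -> dot w k = 0 ->
  exists s t : R, w = s *: a + t *: b.
Proof.
move=> ak bk ab a0 b0 k0 wk.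
have sq_neq0 (u : 'I_3 -> R) : u != 0 -> dot u u != 0.
  by apply: contra => /eqP/dot_eq0 ->.
have d0 : det3 a b k != 0.
  have : det3 a b k ^+ 2 = dot a a * dot b b * dot k k.
    transitivity (dot a a * dot b b * dot k k + 2 * dot a b * dot b k * dot a k -
      dot a a * dot b k ^+ 2 - dot b b * dot a k ^+ 2 - dot k k * dot a b ^+ 2).
      by rewrite /det3 !dotE; ring.
    by rewrite ak bk ab; ring.
  move=> dE; rewrite -sqrf_eq0 dE !mulf_neq0//; exact: sq_neq0.
have := cramer3 w d0; set s := _ / _; set t := _ / _; set r := _ / _ => wE.
exists s, t; rewrite wE; suff -> : r = 0 by rewrite scale0r addr0.
move: wk; rewrite wE !dotDl !dotZl ak bk !mulr0 !add0r => /eqP.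
by rewrite mulf_eq0 (negbTE (sq_neq0 k k0)) orbF => /eqP.
Qed.

Lemma freq_neq0 k : (num0 k <= 1)%N -> freq k != 0.
Proof.
move=> k1; apply/negP => /eqP k0.
have ki i : k i == 0%N.
  have := congr1 (fun f => f i) k0; rewrite freqE -[RHS]/(0 : R) => /eqP.
  by rewrite mulf_eq0 pnatr_eq0 (gt_eqF (al_gt0 L_gt0 i)) orbF.
by move: k1; rewrite num0E !ki.
Qed.

Variables (wY wZ : nat -> ('I_3 -> nat) -> 'I_3 -> R).
Hypotheses (wYadm : admissibleY L wY) (wZadm : admissibleZ L wZ).
Local Notation C := (Ctilde L wY wZ).
Local Notation reach := (reach L C).
Local Notation full := (full L C).

Lemma finite_Ctilde : finite_set C.
Proof.
pose idx (g : {ffun 'I_3 -> 'I_5} * 'I_3) : 'I_3 -> nat := fun i => g.1 i.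
pose fY (g : {ffun 'I_3 -> 'I_5} * 'I_3) := Y L (wY (g.2 : nat) (idx g)) (idx g).
pose fZ (g : {ffun 'I_3 -> 'I_5} * 'I_3) := Z L (wZ (g.2 : nat) (idx g)) (idx g).
apply: (@sub_finite_set _ _ (fY @` setT `|` fZ @` setT `|` [set Z000 L])); last first.
  by rewrite !finite_setU; split; [split; exact: finite_image|exact: finite_set1].
have idxE n j : (forall i, (n i <= 4)%N) -> (j < 3)%N ->
    exists g, idx g = n /\ nat_of_ord g.2 = j.
  move=> n4 j3; exists ([ffun i => inord (n i)], Ordinal j3); split => //.
  by apply/funext => i; rewrite /idx/= ffunE inordK// ltnS.
have j3 n j : j \in jset n -> (j < 3)%N.
  by rewrite /jset !inE => /orP[/eqP ->//|/eqP ->]; rewrite ltnS leq_subr.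
move=> u [[[]|]|]; last by right.
- move=> [n [j [_ n3 jn ->]]]; left; left.
  have [g [gn gj]] := idxE n j (fun i => leq_trans (n3 i) (leqnSn 3)) (j3 _ _ jn).
  by exists g => //; rewrite /fY gn gj.
- move=> [n [j [_ n4 jn ->]]]; left; right.
  by have [g [gn gj]] := idxE n j n4 (j3 _ _ jn); exists g => //; rewrite /fZ gn gj.
- move=> [n [_ _ n4 ->]]; left; right.
  by have [g [gn gj]] := idxE n 1%N n4 isT; exists g => //; rewrite /fZ gn gj.
Qed.

Lemma dot_vertical w k : w ax1 = 0 -> w ax2 = 0 -> k ax3 = 0%N -> dot w (freq k) = 0.
Proof. by move=> w1 w2 k3; rewrite dotE w1 w2 !freqE k3 !mul0r mulr0 !addr0. Qed.

Lemma jset1 n j : num0 n = 1%N -> j \in jset n -> j = 1%N.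
Proof. by move=> n1; rewrite /jset n1 !inE => /orP[] /eqP. Qed.

Lemma Ctilde_DA : C `<=` DA L.
Proof.
have aF k : adm L (freq k) by exact: adm_fr.
move=> u Cu; apply: good_DA => //; case: Cu => [[[]|]|].
- move=> [n [j [n1 _ jn ->]]]; rewrite Y_mode; apply: good_mode => //.
  by have [/(_ _ jn)/perp_dot] := wYadm n1.
- move=> [n [j [n1 _ jn ->]]]; rewrite Z_mode; apply: good_mode => //.
  (* For n_3 = 0 the amplitude is vertical instead of taken from a perpendicular family; exactly one
     frequency vanishes there, which forces j = 1. *)
  have [n30|n30] := eqVneq (n ax3) 0%N.
    have n01 : num0 n = 1%N by apply/eqP; rewrite eqn_leq n1 num0E n30 eqxx addn1.
    have [w1 w2 _] := wZadm.2 n n30 (or_introl n01).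
    by rewrite (jset1 n01 jn); exact: dot_vertical.
  by have [/(_ _ jn)/perp_dot] := wZadm.1 n n1 (elimN eqP n30).
- move=> [n [n2 n30 _ ->]]; rewrite Z_mode; apply: good_mode => //.
  by have [w1 w2 _] := wZadm.2 n n30 (or_intror n2); exact: dot_vertical.
- move=> ->; rewrite /Z000 Z_mode; apply: good_mode => //.
  exact: dot_vertical.
Qed.

(** Without zero frequency the two given amplitudes span the plane orthogonal to k. With one zero
    frequency there is a single amplitude; e_(i0) completes it to a basis of that plane, and its own
    mode is zero. *)
Lemma full_Y n : (num0 n <= 1)%N -> (forall i, (n i <= 3)%N) ->
  full false (n ax1) (n ax2) (n ax3).
Proof.
move=> n1 n3 w; rewrite -/(freq n) => wn.
have rY j : j \in jset n -> reach (mode false (freq n) (wY j n)).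
  by move=> jn; rewrite -Y_mode; apply: reach_C; left; left; left; exists n, j.
have [wP wO _] := wYadm n1.
have j1 : 1%N \in jset n by rewrite inE eqxx.
have [[i0 ni0]|n00] : (exists i, n i = 0%N) \/ num0 n = 0%N.
  move: n1; rewrite num0E; have [?|_] := eqVneq (n ax1) 0%N; first by left; exists ax1.
  have [?|_] := eqVneq (n ax2) 0%N; first by left; exists ax2.
  by have [?|_] := eqVneq (n ax3) 0%N; [left; exists ax3|right].
- pose e : 'I_3 -> R := fun i => (i == i0)%:R.
  have dote v : dot v e = v i0.
    by rewrite /dot (bigD1 i0)//= /e eqxx mulr1 big1 ?addr0// => i /negbTE ->; rewrite mulr0.
  have dotC u v : dot u v = dot v u by rewrite !dotE; ring.
  have [s [t ->]] : exists s t : R, w = s *: wY 1%N n + t *: e.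
    have [a0 _ ai0] := wP _ j1.
    apply: (@orth_span _ _ (freq n)) => //.
    + exact: perp_dot (wP _ j1).
    + by rewrite dotC dote freqE ni0 mul0r.
    + by rewrite dote ai0.
    + apply/negP => /eqP/(congr1 (fun f => f i0)); rewrite /e eqxx => /eqP.
      by rewrite oner_eq0.
    + exact: freq_neq0.
  rewrite modeD !modeZ [mode _ _ e]mode_eq0 ?scaler0 ?addr0.
    by apply: reachZ; exact: rY.
  move=> i; rewrite /e; have [->|_] := eqVneq i i0; last by left.
  by right; exists i0; [rewrite /parity eqxx|rewrite freqE ni0 mul0r].
- have j2 : 2%N \in jset n by rewrite /jset n00 !inE.
  have [s [t ->]] : exists s t : R, w = s *: wY 1%N n + t *: wY 2%N n.
    have [a0 _ _] := wP _ j1; have [b0 _ _] := wP _ j2.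
    apply: (@orth_span _ _ (freq n)) => //.
    + exact: perp_dot (wP _ j1).
    + exact: perp_dot (wP _ j2).
    + exact: wO.
    + exact: freq_neq0.
  by rewrite modeD !modeZ; apply: reachD; apply: reachZ; exact: rY.
Qed.

Lemma C_vertical n : n ax3 = 0%N -> num0 n = 1%N \/ num0 n = 2%N ->
  (forall i, (n i <= 4)%N) ->
  exists2 c : R, c != 0 & C (mode true (freq n) (c *: vec3 0 0 1)).
Proof.
move=> n3 n12 n4; have [w1 w2 w3] := wZadm.2 n n3 n12.
exists (wZ 1%N n ax3) => //; rewrite (_ : _ *: _ = wZ 1%N n).
  rewrite -Z_mode; case: n12 => nE; [left; left; right|left; right].
    by exists n, 1%N; split => //; rewrite ?nE ?inE.
  by exists n.
apply/funext; apply: ord3P; rewrite ?w1 ?w2 /vec3/=;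
  by rewrite -[LHS]/(_ * _ : R)/= ?mulr0 ?mulr1.
Qed.

Lemma full_vertical n : n ax3 = 0%N -> num0 n = 1%N \/ num0 n = 2%N ->
  (forall i, (n i <= 4)%N) -> full true (n ax1) (n ax2) (n ax3).
Proof.
move=> n3 n12 n4 w _; rewrite -/(freq n).
have [c c0 Cc] := C_vertical n3 n12 n4.
rewrite (@eq_mode _ _ _ _ ((w ax3 / c) *: (c *: vec3 0 0 1))).
  by rewrite modeZ; apply: reachZ; exact: reach_C.
have f3 : freq n ax3 = 0 by rewrite freqE n3 mul0r.
apply: ord3P; [by right; exists ax3|by right; exists ax3|left].
by rewrite scalerA divfK// -[RHS]/(w ax3 * 1) mulr1.
Qed.

Lemma C_translation : C (mode true (fun=> 0) ((-1) *: vec3 0 0 1)).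
Proof.
right; rewrite /= /Z000 Z_mode; congr (mode true _ _).
  by apply/funext => i; rewrite freqE mul0r.
apply/funext; apply: ord3P; rewrite /vec3/= -[LHS]/(_ * _ : R)/= ?mulr0 ?mulr1//.
Qed.

(** An admissible amplitude at such a frequency lies on the line of (al_l, - p al_i) in the plane of
    i and l, and the factor is nonzero because the amplitude is. Stated for abstract axes to serve
    both families of plane modes. *)
Lemma C_plane (p : nat) (i j l : 'I_3) n : n i = p -> n j = 0%N -> n l = 1%N ->
  (forall r, [\/ r = i, r = j | r = l]) ->
  (forall F : 'I_3 -> R, \sum_r F r = F i + F j + F l) ->
  num0 n = 1%N -> (forall i, (n i <= 3)%N) ->
  exists2 c : R, c != 0 & exists2 w, C (mode false (freq n) w) &
    [/\ w i = c * al l, w j = 0 & w l = c * - (p%:R * al i)].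
Proof.
move=> ni nj nl ijl sE n1 n3.
have j1 : 1%N \in jset n by rewrite inE eqxx.
have n1' : (num0 n <= 1)%N by rewrite n1.
have [/(_ _ j1) Pw _ _] := wYadm n1'; have [w0 _ wj] := Pw.
have := perp_dot Pw; set w := wY 1%N n in w0 wj *.
have al0 r : al r != 0 by rewrite gt_eqF// al_gt0.
move=> wn.
have {}wn : w i * (p%:R * al i) + w l * al l = 0.
  by rewrite -[RHS]wn /dot sE !freqE ni nj nl mul0r mulr0 addr0 mulr1n mul1r.
exists (w i / al l).
  rewrite mulf_neq0 ?invr_eq0//; apply: contra w0 => /eqP wi.
  apply/eqP/funext => r; rewrite -[RHS]/(0 : R).
  have wl : w l = 0.
    by apply/eqP; move/eqP: wn; rewrite wi mul0r add0r mulf_eq0 (negbTE (al0 l)) orbF.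
  by have [->|->|->] := ijl r; rewrite ?wi ?wl ?wj.
exists w; first by rewrite -Y_mode; left; left; left; exists n, 1%N.
split; [by rewrite divfK|exact: wj|].
by apply: (mulIf (al0 l)); rewrite mulrAC divfK//; lra.
Qed.

Lemma saturating_Ctilde : saturating L C.
Proof.
split; [exact: finite_Ctilde|exact: Ctilde_DA|].
move=> h Hh eps eps0.
suff fa : forall z (x y t : nat), full z x y t.
  have [g rg hg] := reach_dense L_gt0 fa Hh eps0; exists g; [exact: reach_Gseq|exact: hg].
apply: full_all => //.
- exact: C_translation.
- have [|||c c0 Cc] := @C_vertical (vec3 1 0 0)%N; [by []|by right; rewrite num0E|exact: ord3P|].
  exists c => //; move: Cc; rewrite (_ : freq _ = vec3 (al ax1) 0 0)//.
  by apply/funext; apply: ord3P; rewrite freqE /vec3/= ?mulr1n ?mul1r ?mul0r.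
- have [|||c c0 Cc] := @C_vertical (vec3 0 1 0)%N; [by []|by right; rewrite num0E|exact: ord3P|].
  exists c => //; move: Cc; rewrite (_ : freq _ = vec3 0 (al ax2) 0)//.
  by apply/funext; apply: ord3P; rewrite freqE /vec3/= ?mulr1n ?mul1r ?mul0r.
- move=> p pI; have [p0 p3] : p != 0%N /\ (p <= 3)%N by move: pI; rewrite !inE => /orP[] /eqP ->.
  have [||||c c0 [w Cw [w1 w2 w3]]] := @C_plane p ax1 ax2 ax3 (vec3 p 0 1)%N erefl erefl erefl.
  + by apply: ord3P; [constructor 1|constructor 2|constructor 3].
  + by move=> F; exact: sum3E.
  + by rewrite num0E/= (negbTE p0).
  + by apply: ord3P.
  exists c => //; move: Cw; rewrite (_ : freq _ = vec3 (p%:R * al ax1) 0 (al ax3)); last first.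
    by apply/funext; apply: ord3P; rewrite freqE /vec3/= ?mulr1n ?mul1r ?mul0r.
  have -> // : c *: vec3 (al ax3) 0 (- (p%:R * al ax1)) = w.
  apply/funext; apply: ord3P; [exact: esym w1| |exact: esym w3].
  by rewrite w2 -[LHS]/(c * 0) mulr0.
- move=> p pI; have [p0 p3] : p != 0%N /\ (p <= 3)%N by move: pI; rewrite !inE => /orP[] /eqP ->.
  have [||||c c0 [w Cw [w2 w1 w3]]] := @C_plane p ax2 ax1 ax3 (vec3 0 p 1)%N erefl erefl erefl.
  + by apply: ord3P; [constructor 2|constructor 1|constructor 3].
  + by move=> F; rewrite sum3E [F ax1 + _]addrC.
  + by rewrite num0E/= (negbTE p0).
  + by apply: ord3P.
  exists c => //; move: Cw; rewrite (_ : freq _ = vec3 0 (p%:R * al ax2) (al ax3)); last first.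
    by apply/funext; apply: ord3P; rewrite freqE /vec3/= ?mulr1n ?mul1r ?mul0r.
  have -> // : c *: vec3 0 (al ax3) (- (p%:R * al ax2)) = w.
  apply/funext; apply: ord3P; [|exact: esym w2|exact: esym w3].
  by rewrite w1 -[LHS]/(c * 0) mulr0.
- move=> t tI; have [t0 t3] : t != 0%N /\ (t <= 3)%N by move: tI; rewrite !inE => /orP[] /eqP ->.
  split.
  + by apply: (@full_Y (vec3 1 0 t)%N); [rewrite num0E/= (negbTE t0)|apply: ord3P].
  + by apply: (@full_Y (vec3 0 1 t)%N); [rewrite num0E/= (negbTE t0)|apply: ord3P].
  + by apply: (@full_Y (vec3 1 1 t)%N); [rewrite num0E/= (negbTE t0)|apply: ord3P].
- split.
  + case; first by apply: (@full_vertical (vec3 1 1 0)%N); [|left; rewrite num0E|apply: ord3P].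
    by apply: (@full_Y (vec3 1 1 0)%N); [rewrite num0E|apply: ord3P].
  + by apply: (@full_vertical (vec3 1 0 0)%N); [|right; rewrite num0E|apply: ord3P].
  + by apply: (@full_vertical (vec3 2 0 0)%N); [|right; rewrite num0E|apply: ord3P].
  + by apply: (@full_vertical (vec3 0 1 0)%N); [|right; rewrite num0E|apply: ord3P].
  + by apply: (@full_vertical (vec3 0 2 0)%N); [|right; rewrite num0E|apply: ord3P].
Qed.

End GeneratingSet.

Theorem corollary4p1 (R : realType) (L : 'I_3 -> R) (L_gt0 : forall i, 0 < L i)
    (wY wZ : nat -> ('I_3 -> nat) -> 'I_3 -> R)
    (wYadm : admissibleY L wY) (wZadm : admissibleZ L wZ) :
  saturating L (Ctilde L wY wZ).
Proof. exact: saturating_Ctilde. Qed.
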